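(* Let $p\ge 2$, let $X_2$ be a Riemannian symmetric space of compact type, let $\rho$ be the smallest Ricci curvature of any unit tangent vector to $S^p\times X_2$, and let $q=2-\frac{1}{\dim X_2}$. There exists $\Lambda>0$ such that if $M$ is a $p$-dimensional closed connected minimal submanifold of $S^p\times X_2$ that satisfies, at every point of $M$, $$\|\pi_2\|<\Lambda,\qquad \|A\|^2<\frac{\rho}{q},$$ then $M=S^p\times\{x\}$ for some $x\in X_2$.
   Context: A symmetric space of compact type $X=G/H$, with $\mathfrak g=\mathfrak h+\mathfrak m$ (eigenspaces of the involution, $\mathfrak g$ semisimple with negative definite Killing form), carries the $G$-invariant metric given by the negative of the Killing form on $\mathfrak m\cong T_pX$. This convention applies to $S^p$ (so $S^p$ is the round sphere of constant sectional curvature $\frac{1}{2(p-1)}$) and to $X_2$; $S^p\times X_2$ has the product metric. $\pi_2$ denotes the derivative of the projection $M\to X_2$, a bundle map $TM\to TX_2|_M$, and $\|\pi_2\|$ is its operator norm at a point. $A$ is the second fundamental form of $M$: $A^\nu Y=-(\nabla_Y\nu)^T$ for $\nu$ normal and $Y$ tangent to $M$; $\|A\|^2=\sum_{j,k}|A^{\eta_j}(e_k)|^2$ for orthonormal bases $\{e_k\}$ of $T_xM$ and $\{\eta_j\}$ of the normal space. $M$ is minimal if $A^\nu$ is trace-free for all normal $\nu$. Closed means compact without boundary. *)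

(* Defs.v *)
From HB Require Import structures.
From mathcomp Require Import all_boot all_order all_algebra.
From mathcomp Require Import ring.
From mathcomp Require Import all_classical all_reals all_analysis.
Set Implicit Arguments.
Unset Strict Implicit.
Unset Printing Implicit Defensive.
Import Order.TTheory GRing.Theory Num.Theory.
Import numFieldNormedType.Exports.
Local Open Scope classical_set_scope.
Local Open Scope ring_scope.

(* Vectors are rows; the Jacobian 'J F u sends the row Y to 'D_Y F u = Y *m 'J F u,
   so the pull-back of the Gram matrix g by F is 'J F u *m g *m ('J F u)^T. *)

(* C^k on an open set U: C^0 is continuity; C^(k+1) is differentiability at each
   point of U together with all directional derivatives being C^k. *)
Fixpoint Ck (R : realType) (k : nat) (V W : normedModType R) (U : set V)
    (f : V -> W) : Prop :=
  match k with
  | 0%N => forall x, U x -> {for x, continuous f}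
  | k'.+1 => (forall x, U x -> differentiable f x) /\
             (forall v, Ck k' U (fun x => 'D_v f x))
  end.

Definition smooth_on (R : realType) (V W : normedModType R) (U : set V)
  (f : V -> W) : Prop := forall k, Ck k U f.

(* Raw data of an n-dimensional manifold; the values of [chart i] outside
   [chart_dom i], and of [chart_inv i] outside [chart i @` chart_dom i], are irrelevant. *)
Structure charted (R : realType) (n : nat) := Charted {
  carrier :> topologicalType;
  chart_index : Type;
  chart_dom : chart_index -> set carrier;
  chart : chart_index -> carrier -> 'rV[R]_n;
  chart_inv : chart_index -> 'rV[R]_n -> carrier }.

Definition chart_img (R : realType) n (N : charted R n) (i : chart_index N) :
  set 'rV[R]_n := chart i @` chart_dom i.

Record is_manifold (R : realType) (n : nat) (N : charted R n) : Prop := {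
  mfd_hausdorff : hausdorff_space N;
  mfd_countable : @second_countable N;
  mfd_cover : forall x : N, exists i, chart_dom i x;
  mfd_open_dom : forall i : chart_index N, open (chart_dom i);
  mfd_open_img : forall i : chart_index N, open (chart_img i);
  mfd_chartK : forall (i : chart_index N) x, chart_dom i x ->
    chart_inv i (chart i x) = x;
  mfd_chart_cont : forall (i : chart_index N) x, chart_dom i x ->
    {for x, continuous (chart i)};
  mfd_chart_inv_cont : forall (i : chart_index N) y, chart_img i y ->
    {for y, continuous (chart_inv i)};
  mfd_transition : forall i j : chart_index N,
    smooth_on (chart i @` (chart_dom i `&` chart_dom j)) (chart j \o chart_inv i) }.

Definition smooth_map (R : realType) m n (M : charted R m) (N : charted R n)
    (f : M -> N) : Prop :=
  continuous f /\
  forall (i : chart_index M) (j : chart_index N),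
    smooth_on (chart i @` (chart_dom i `&` f @^-1` chart_dom j)) (chart j \o f \o chart_inv i).

Definition prod_charted (R : realType) m n (M : charted R m) (N : charted R n) :
    charted R (m + n) :=
  @Charted R (m + n) (M * N)%type (chart_index M * chart_index N)%type
    (fun i => chart_dom i.1 `*` chart_dom i.2)
    (fun i x => row_mx (chart i.1 x.1) (chart i.2 x.2))
    (fun i y => (chart_inv i.1 (lsubmx y), chart_inv i.2 (rsubmx y))).

Definition inner (R : realType) n (g : 'M[R]_n) (v w : 'rV[R]_n) : R :=
  (v *m g *m w^T) 0 0.

Definition pullback (R : realType) m n (g : 'rV[R]_n -> 'M[R]_n)
    (F : 'rV[R]_m -> 'rV[R]_n) (u : 'rV[R]_m) : 'M[R]_m :=
  'J F u *m g (F u) *m ('J F u)^T.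

(* [metric i y] is the Gram matrix of the coordinate frame of the chart i at the
   point with coordinates y. *)
Structure riemannian (R : realType) (n : nat) := Riemannian {
  manifold_of :> charted R n;
  metric : chart_index manifold_of -> 'rV[R]_n -> 'M[R]_n }.

Record is_riemannian (R : realType) (n : nat) (N : riemannian R n) : Prop := {
  riem_manifold : is_manifold N;
  riem_smooth : forall (i : chart_index N) (a b : 'I_n),
    smooth_on (chart_img i) (fun y => metric i y a b : R);
  riem_sym : forall (i : chart_index N) y, chart_img i y -> (metric i y)^T = metric i y;
  riem_pos : forall (i : chart_index N) y, chart_img i y ->
    forall v, v != 0 -> 0 < inner (metric i y) v v;
  riem_transition : forall (i j : chart_index N) y,
    (chart i @` (chart_dom i `&` chart_dom j)) y ->
    metric i y = pullback (metric j) (chart j \o chart_inv i) y }.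

Definition prod_riemannian (R : realType) m n (M : riemannian R m)
    (N : riemannian R n) : riemannian R (m + n) :=
  @Riemannian R (m + n) (prod_charted M N)
    (fun i y => block_mx (metric i.1 (lsubmx y)) 0 0 (metric i.2 (rsubmx y))).

Definition isometric_map (R : realType) m n (M : riemannian R m)
    (N : riemannian R n) (f : M -> N) : Prop :=
  smooth_map f /\
  forall (i : chart_index M) (j : chart_index N) x, chart_dom i x -> chart_dom j (f x) ->
    metric i (chart i x) = pullback (metric j) (chart j \o f \o chart_inv i) (chart i x).

Section Curvature.
Variables (R : realType) (n : nat) (g : 'rV[R]_n -> 'M[R]_n).

Definition partial (f : 'rV[R]_n -> R) (i : 'I_n) (y : 'rV[R]_n) : R :=
  'D_(delta_mx 0 i) f y.

(* Levi-Civita connection: nabla_(d_i) d_j = \sum_k christoffel k i j y d_k *)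
Definition christoffel (k i j : 'I_n) (y : 'rV[R]_n) : R :=
  2^-1 * \sum_l invmx (g y) k l *
    (partial (fun z => g z j l) i y + partial (fun z => g z i l) j y
     - partial (fun z => g z i j) l y).

(* The d_l-component of
   nabla_(d_i) nabla_(d_j) d_k - nabla_(d_j) nabla_(d_i) d_k. *)
Definition riemann_tensor (l i j k : 'I_n) (y : 'rV[R]_n) : R :=
  partial (christoffel l j k) i y - partial (christoffel l i k) j y
  + \sum_m (christoffel l i m y * christoffel m j k y
            - christoffel l j m y * christoffel m i k y).

(* Ric(v, w) = tr (u |-> R(u, v) w) *)
Definition ricci_mx (y : 'rV[R]_n) : 'M[R]_n :=
  \matrix_(j, k) \sum_i riemann_tensor i i j k y.

End Curvature.

(* rho is the minimum of Ric(v, v) over all unit tangent vectors v of N. *)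
Definition smallest_ricci (R : realType) n (N : riemannian R n) (rho : R) : Prop :=
  (exists (i : chart_index N) (y v : 'rV[R]_n),
     [/\ chart_img i y, inner (metric i y) v v = 1
       & inner (ricci_mx (metric i) y) v v = rho]) /\
  (forall (i : chart_index N) (y v : 'rV[R]_n),
     chart_img i y -> inner (metric i y) v v = 1 ->
     rho <= inner (ricci_mx (metric i) y) v v).

Record is_lie_group (R : realType) (k : nat) (G : charted R k)
    (mul : G -> G -> G) (inv : G -> G) (one : G) : Prop := {
  lie_manifold : is_manifold G;
  lie_mulA : associative mul;
  lie_mul1 : left_id one mul;
  lie_mulV : left_inverse one inv mul;
  lie_mul_smooth : @smooth_map R (k + k) k (prod_charted G G) G
                     (fun a => mul a.1 a.2);
  lie_inv_smooth : smooth_map inv }.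

Section LieAlgebra.
Variables (R : realType) (k : nat) (G : charted R k).
Variables (mul : G -> G -> G) (one : G).

(* The Lie algebra is T_one G, identified with 'rV_k through a chart i with
   [chart_dom i one]. [left_inv_field i v] is the left invariant vector field with value
   v at one, in this chart, and the bracket is that of vector fields. *)
Definition left_inv_field (i : chart_index G) (v y : 'rV[R]_k) : 'rV[R]_k :=
  'D_v (fun z => chart i (mul (chart_inv i y) (chart_inv i z))) (chart i one).

Definition lie_bracket (i : chart_index G) (v w : 'rV[R]_k) : 'rV[R]_k :=
  'D_v (left_inv_field i w) (chart i one) - 'D_w (left_inv_field i v) (chart i one).

Definition killing (i : chart_index G) (v w : 'rV[R]_k) : R :=
  \tr (lin1_mx (lie_bracket i v) *m lin1_mx (lie_bracket i w)).

End LieAlgebra.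

(* X is presented as G/H, for a symmetric pair (G, H), by a smooth transitive action
   of G with isotropy group H at o; the tangent space of X at o is the image of m
   under the derivative of a |-> a o at one. *)
Record is_symmetric_pair_space (R : realType) (k d : nat) (G : charted R k)
    (mul : G -> G -> G) (inv : G -> G) (one : G) (sigma : G -> G)
    (X : riemannian R d) (act : G -> X -> X) (o : X) : Prop := {
  sym_riemannian : is_riemannian X;
  sym_group : is_lie_group mul inv one;
  sym_connected : connected [set: G];
  sym_sigma_smooth : smooth_map sigma;
  sym_sigmaM : {morph sigma : a b / mul a b};
  sym_sigmaK : involutive sigma;
  sym_killing : forall i : chart_index G, chart_dom i one ->
    forall v, v != 0 -> killing mul one i v v < 0;
  sym_act1 : forall x, act one x = x;
  sym_actM : forall a b x, act (mul a b) x = act a (act b x);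
  sym_act_smooth : @smooth_map R (k + d) d (prod_charted G X) X
                     (fun z => act z.1 z.2);
  sym_transitive : forall x y, exists a, act a x = y;
  sym_isotropy_sub : [set a | act a o = o] `<=` [set a | sigma a = a];
  sym_isotropy_sup :
    connected_component [set a | sigma a = a] one `<=` [set a | act a o = o];
  sym_invariant : forall a, isometric_map (act a);
  sym_metric : forall (i : chart_index G) (j : chart_index X),
    chart_dom i one -> chart_dom j o ->
    let orbit := fun z => chart j (act (chart_inv i z) o) in
    let dsigma v := 'D_v (chart i \o sigma \o chart_inv i) (chart i one) in
    forall v w, dsigma v = - v -> dsigma w = - w ->
    inner (metric j (chart j o)) ('D_v orbit (chart i one)) ('D_w orbit (chart i one))
    = - killing mul one i v w }.

Definition symmetric_space_of_compact_type (R : realType) (d : nat)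
    (X : riemannian R d) : Prop :=
  exists (k : nat) (G : charted R k) mul inv one sigma act o,
    @is_symmetric_pair_space R k d G mul inv one sigma X act o.

Section Sphere.
Variables (R : realType) (p : nat) (r : R).

Definition norm2 (n : nat) (x : 'rV[R]_n) : R := (x *m x^T) 0 0.

Definition sphere_set : set 'rV[R]_(1 + p) := [set x | norm2 x = r ^+ 2].

(* inverse stereographic projection from the pole ((-1)^s r, 0, ..., 0) *)
Definition stereo_inv (s : bool) (y : 'rV[R]_p) : 'rV[R]_(1 + p) :=
  row_mx (const_mx ((-1) ^+ s * r * (norm2 y - 1) / (norm2 y + 1)))
         ((2 * r / (norm2 y + 1)) *: y).

Lemma norm2_ge0 n (y : 'rV[R]_n) : 0 <= norm2 y.
Proof.
by rewrite /norm2 mxE sumr_ge0 // => i _; rewrite mxE -expr2 sqr_ge0.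
Qed.

Lemma stereo_inv_sphere s y : stereo_inv s y \in sphere_set.
Proof.
have h0 : norm2 y + 1 != 0 by rewrite gt_eqF // ltr_wpDl // norm2_ge0.
rewrite inE /sphere_set /= /norm2 /stereo_inv tr_row_mx mul_row_col.
rewrite mxE trmx_const linearZ /= -scalemxAl -scalemxAr scalerA.
rewrite [X in X + _]mxE big_ord1 !mxE [X in _ + _ * X](_ : _ = norm2 y); last first.
  by rewrite /norm2 mxE.
have ss : (-1) ^+ s * (-1) ^+ s = 1 :> R by rewrite -expr2 sqrr_sign.
move: ((-1) ^+ s) (norm2 y) ss h0 => e t ss h0.
transitivity (e * e * (r * (t - 1) / (t + 1)) ^+ 2 + (2 * r / (t + 1)) ^+ 2 * t).
  by field.
by rewrite ss; field.
Qed.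

Definition sphere_charted : charted R p :=
  @Charted R p (set_type sphere_set) bool
    (fun s x => (-1) ^+ s * (val x) 0 0 != r)
    (fun s x => (r - (-1) ^+ s * (val x) 0 0)^-1 *: rsubmx (val x))
    (fun s y => exist _ (stereo_inv s y) (stereo_inv_sphere s y)).

(* the metric induced by the Euclidean metric of R^(1+p) *)
Definition sphere : riemannian R p :=
  @Riemannian R p sphere_charted (fun s => pullback (fun=> 1%:M) (stereo_inv s)).

End Sphere.

(* S^p with minus the Killing form of so(p+1), i.e. of sectional curvature
   1 / (2 (p - 1)). *)
Definition killing_sphere (R : realType) (p : nat) : riemannian R p :=
  sphere p (Num.sqrt (2 * (p%:R - 1)) : R).

Record local_param (R : realType) (m n : nat) (N : charted R n) (M : set N)
    (U : set 'rV[R]_m) (f : 'rV[R]_m -> N) : Prop := {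
  lp_open : open U;
  lp_sub : f @` U `<=` M;
  lp_inj : set_inj U f;
  lp_cont : forall u, U u -> {for u, continuous f};
  lp_homeo : forall V, open V -> V `<=` U -> exists2 W, open W & f @` V = M `&` W;
  lp_smooth : forall i : chart_index N,
    smooth_on (U `&` f @^-1` chart_dom i) (chart i \o f);
  lp_immersion : forall (i : chart_index N) u, U u -> chart_dom i (f u) ->
    \rank ('J (chart i \o f) u) = m }.

Definition embedded_submanifold (R : realType) (m n : nat) (N : charted R n)
    (M : set N) : Prop :=
  forall x, M x -> exists (U : set 'rV[R]_m) f u,
    [/\ local_param M U f, U u & f u = x].

(* [connected] holds of the empty set in the library. *)
Definition closed_connected_submanifold (R : realType) (m n : nat)
    (N : charted R n) (M : set N) : Prop :=
  [/\ embedded_submanifold m M, M !=set0, compact M & connected M].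

(* P holds at all points of M, in every local parametrization (f u) and ambient
   chart (i); it is used for P independent of these choices. *)
Definition at_all_points (R : realType) (m n : nat) (N : charted R n) (M : set N)
    (P : chart_index N -> ('rV[R]_m -> N) -> 'rV[R]_m -> Prop) : Prop :=
  forall U f, local_param M U f ->
  forall (i : chart_index N) u, U u -> chart_dom i (f u) -> P i f u.

(* Second fundamental form of an immersion F of an open set of R^m in an open set
   of R^n with metric g. Vectors tangent to the submanifold at F u are represented by
   rows Y : 'rV_m, standing for Y *m 'J F u, with Gram matrix [pullback g F u]. *)
Section SecondFundamentalForm.
Variables (R : realType) (m n : nat) (g : 'rV[R]_n -> 'M[R]_n).
Variables (F : 'rV[R]_m -> 'rV[R]_n).

Definition is_normal (u : 'rV[R]_m) (nu : 'rV[R]_n) : Prop :=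
  forall Y, inner (g (F u)) (Y *m 'J F u) nu = 0.

(* covariant derivative of a vector field nu along F *)
Definition cov_deriv (nu : 'rV[R]_m -> 'rV[R]_n) (Y u : 'rV[R]_m) : 'rV[R]_n :=
  'D_Y nu u + \row_k \sum_i \sum_j
    christoffel g k i j (F u) * (Y *m 'J F u) 0 i * nu u 0 j.

(* Orthogonal projection to the tangent space: the tangential part of v is
   tangential u v *m 'J F u. *)
Definition tangential (u : 'rV[R]_m) (v : 'rV[R]_n) : 'rV[R]_m :=
  v *m g (F u) *m ('J F u)^T *m invmx (pullback g F u).

Definition normal_part (u : 'rV[R]_m) (v : 'rV[R]_n) : 'rV[R]_n :=
  v - tangential u v *m 'J F u.

(* A^nu Y = - (nabla_Y nu)^T for nu normal at u. The result depends only on the value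
   at u of the normal field that is differentiated; the field used here has
   value nu at u. *)
Definition shape (u : 'rV[R]_m) (nu : 'rV[R]_n) (Y : 'rV[R]_m) : 'rV[R]_m :=
  - tangential u (cov_deriv (fun w => normal_part w nu) Y u).

Definition minimal_at (u : 'rV[R]_m) : Prop :=
  forall nu, is_normal u nu -> \tr (lin1_mx (shape u nu)) = 0.

(* the rows of E and eta are the e_k and the eta_j *)
Definition orthonormal_frames (u : 'rV[R]_m) (E : 'M[R]_m) (eta : 'M[R]_(n - m, n)) :
    Prop :=
  [/\ E *m pullback g F u *m E^T = 1%:M,
      forall j, is_normal u (row j eta)
    & eta *m g (F u) *m eta^T = 1%:M].

Definition shape_norm2 (u : 'rV[R]_m) (E : 'M[R]_m) (eta : 'M[R]_(n - m, n)) : R :=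
  \sum_j \sum_k
    let Z := shape u (row j eta) (row k E) in inner (pullback g F u) Z Z.

Definition sff_norm2_lt (u : 'rV[R]_m) (c : R) : Prop :=
  forall E eta, orthonormal_frames u E eta -> shape_norm2 u E eta < c.

End SecondFundamentalForm.

(* operator norm of Y |-> Y *m J, for the scalar products with Gram matrices h, h' *)
Definition opnorm (R : realType) m n (h : 'M[R]_m) (h' : 'M[R]_n) (J : 'M[R]_(m, n)) :
    R :=
  sup [set Num.sqrt (inner h' (Y *m J) (Y *m J)) | Y in [set Y | inner h Y Y = 1]].

Section SubmanifoldOfProduct.
Variables (R : realType) (m n1 n2 : nat) (N1 : riemannian R n1) (N2 : riemannian R n2).
Local Notation N := (prod_riemannian N1 N2).

(* norm at f u of the derivative of the second projection of N1 x N2, restricted to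
   the tangent space of the image of f *)
Definition norm_pi2 (i : chart_index N) (f : 'rV[R]_m -> N) (u : 'rV[R]_m) : R :=
  opnorm (pullback (metric i) (chart i \o f) u)
         (metric i.2 (chart i.2 (f u).2))
         ('J (fun w => chart i.2 (f w).2) u).

End SubmanifoldOfProduct.

Definition minimal_submanifold (R : realType) (m n : nat) (N : riemannian R n)
    (M : set N) : Prop :=
  at_all_points M (fun i (f : 'rV[R]_m -> N) u =>
    minimal_at (metric i) (chart i \o f) u).

(* Main.v *)
(* As pi_2 is small on the tangent spaces of M, M is locally the graph of a map phi from S^p
   to X_2. Let e be the trace of the metric that M inherits from X_2 with respect to the
   metric that it inherits from S^p. By compactness e attains its maximum on M at some z.
   Use stereographic coordinates of S^p centred at z, where the derivative of the round metric
   vanishes, and move the second component of z to a fixed base point of X_2 by an isometry.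
   The minimal graph equation, differentiated once and contracted with d phi, together with
   D^2 e <= 0 gives a Bochner inequality: the curvature of the sphere contributes a positive
   multiple of |d phi|^2 (this needs p >= 2) and the second derivatives contribute |D^2 phi|^2,
   while the terms due to the metric of X_2 are O(|d phi| (|d phi|^2 + |D^2 phi|^2)), with a
   constant that depends only on the metric near the base point. Hence d phi = 0 at z as soon
   as |d phi| is small enough there, so e vanishes on M, the second component is locally
   constant on M, and M is a slice because M and S^p are connected. *)
From HB Require Import structures.
Require Import Defs.
From mathcomp Require Import all_boot all_order all_algebra.
From mathcomp Require Import ring lra.
From mathcomp Require Import all_classical all_reals all_analysis.
Set Implicit Arguments.
Unset Strict Implicit.
Unset Printing Implicit Defensive.
Import Order.TTheory GRing.Theory Num.Theory.
Import numFieldNormedType.Exports.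
Local Open Scope classical_set_scope.
Local Open Scope ring_scope.

(** * Differential calculus *)

Section Differentiation.
Context {R : realType}.

(** The energy contains first derivatives of phi, so its Hessian contains third derivatives; the
    minimal graph equation, differentiated once, contains the same ones. Contracting the Hessian
    with the inverse X of the metric of the graph, rather than of the round metric, makes the two
    third-order expressions proportional, and they cancel. To leading order there remains 8 mu^2 (p
    - 1) |d phi|^2 + 2 mu^2 |D^2 phi|^2, with 1 / mu the round metric at the centre; the factor p -
    1 is that of the Ricci curvature of the sphere. [bochner] assumes no bound on D^2 phi, so every
    error has to be at most a multiple of s (s^2 + H^2), where s and H measure the first and second
    derivatives. The delicate error is the second form of the graph times the derivative of X:
    contraction with d phi puts a factor s into the former, and the latter comes from an expression
    quadratic in d phi, so both are O(s^3 + s H) and their product is small enough. All constants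
    come from the 2-jet of the metric of X_2 at one point, and homogeneity makes this point the same
    for all M, so that Lambda can be fixed before M. *)

Lemma near_differentiable (V W : normedModType R) (f g : V -> W) x :
  (\near x, f x = g x) -> differentiable f x -> differentiable g x.
Proof.
move=> fg df.
have fgx : f x = g x by exact: nbhs_singleton fg.
have gE : g \o shift x = cst (g x) + 'd f x +o_ (0 : V) id.
  apply/eqaddoP => e e0.
  have /eqaddoP/(_ e e0) fe : f \o shift x = cst (f x) + 'd f x +o_ (0 : V) id.
    exact: diff_locally.
  have fg0 : \forall h \near (0 : V), f (h + x) = g (h + x).
    by move: fg; rewrite {1}(near_shift 0) subr0.
  near=> h.
  have <- : (f \o shift x - (cst (f x) + 'd f x)) h =
            (g \o shift x - (cst (g x) + 'd f x)) h.
    rewrite !fctE /= fgx; congr (_ - _); by near: h.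
  by near: h.
have dE : 'd g x = 'd f x :> (V -> W) by apply: diff_unique => //; exact: diff_continuous.
by apply/diff_locallyP; rewrite dE; split => //; exact: diff_continuous.
Unshelve. all: by end_near. Qed.

Lemma derive_comp (U V W : normedModType R) (f : U -> V) (g : V -> W) x v :
  differentiable f x -> differentiable g (f x) ->
  'D_v (g \o f) x = 'D_('D_v f x) g (f x).
Proof.
move=> df dg; rewrite !deriveE //; last exact: differentiable_comp.
by rewrite diff_comp.
Qed.

Lemma derive_linear (U V W : normedModType R) (f : U -> V) (L : {linear V -> W}) x v :
  continuous L -> differentiable f x -> 'D_v (L \o f) x = L ('D_v f x).
Proof.
move=> cL df; rewrite derive_comp //; last exact: linear_differentiable.
by rewrite deriveE ?diff_lin //; exact: linear_differentiable.
Qed.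

Lemma differentiable_bilinear (U V V' W : normedModType R)
    (B : {bilinear V -> V' -> W}) (f : U -> V) (g : U -> V') x :
  continuous (fun p => B p.1 p.2) -> differentiable f x -> differentiable g x ->
  differentiable (fun y => B (f y) (g y)) x.
Proof.
move=> cB df dg.
apply: (@differentiable_comp _ _ _ _ (fun y => (f y, g y)) (fun p => B p.1 p.2)).
  exact: differentiable_pair.
exact: differentiable_bilin.
Qed.

Lemma derive_bilinear (U V V' W : normedModType R)
    (B : {bilinear V -> V' -> W}) (f : U -> V) (g : U -> V') x v :
  continuous (fun p => B p.1 p.2) -> differentiable f x -> differentiable g x ->
  'D_v (fun y => B (f y) (g y)) x = B ('D_v f x) (g x) + B (f x) ('D_v g x).
Proof.
move=> cB df dg.
have dp : differentiable (fun y => (f y, g y)) x by exact: differentiable_pair.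
rewrite (@derive_comp _ _ _ (fun y => (f y, g y)) (fun p => B p.1 p.2)) //; last first.
  exact: differentiable_bilin.
rewrite deriveE /=; last exact: differentiable_bilin.
by rewrite diff_bilin //= !deriveE // diff_pair //= addrC.
Qed.

(** Registers scaling as a bilinear map, so that the product rules for continuous bilinear maps
    cover a scalar function times a vector function. *)
Lemma scale_is_bilinear (V : normedModType R) :
  bilinear_for (GRing.Scale.Law.clone _ _ *:%R _) (GRing.Scale.Law.clone _ _ *:%R _)
    ( *:%R : R -> V -> V).
Proof.
split=> [u'|u] a x y /=; first by rewrite scalerDl -scalerA.
by rewrite scalerDr !scalerA mulrC.
Qed.

HB.instance Definition _ (V : normedModType R) :=
  bilinear_isBilinear.Build R R V V _ _ ( *:%R : R -> V -> V) (scale_is_bilinear V).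

Lemma differentiable_mx (V : normedModType R) m n (A : V -> 'M[R]_(m, n)) x :
  (forall i j, differentiable (fun y => A y i j) x) -> differentiable A x.
Proof.
move=> dA.
have -> : A = \sum_i \sum_j (fun y => A y i j *: delta_mx i j).
  apply/funext => y; rewrite [LHS]matrix_sum_delta fct_sumE; apply: eq_bigr => i _.
  by rewrite fct_sumE.
by apply: differentiable_sum => i; apply: differentiable_sum => j; exact: differentiableZl.
Qed.

Lemma differentiable_entry (V : normedModType R) m n (A : V -> 'M[R]_(m, n)) x i j :
  differentiable A x -> differentiable (fun y => A y i j) x.
Proof.
move=> dA; apply: (@differentiable_comp _ _ _ _ A (fun B => B i j)) => //.
exact: differentiable_coord.
Qed.

Lemma derive_entry (V : normedModType R) m n (A : V -> 'M[R]_(m, n)) x i j v :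
  differentiable A x -> 'D_v (fun y => A y i j) x = 'D_v A x i j.
Proof. by move=> dA; rewrite derive_mx ?mxE //; exact: diff_derivable. Qed.

Lemma continuous_mx (T : topologicalType) m n (A : T -> 'M[R]_(m, n)) x :
  (forall i j, {for x, continuous (fun y => A y i j)}) -> {for x, continuous A}.
Proof.
move=> cA B [P PN PB]; apply: filterS PB _ => /=.
have : \forall y \near x, forall i j, P i j (A y i j).
  apply: filter_forall => i; apply: filter_forall => j; exact: cA (PN i j).
by apply: filterS => y /= yP i j; exact: yP.
Qed.

Lemma continuous_entry (T : topologicalType) m n (A : T -> 'M[R]_(m, n)) x i j :
  {for x, continuous A} -> {for x, continuous (fun y => A y i j)}.
Proof.
by move=> cA; apply: (@continuous_comp _ _ _ A (fun B => B i j)) => //; exact: coord_continuous.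
Qed.

Lemma mulmx_continuous m n q :
  continuous (fun p : 'M[R]_(m, n) * 'M[R]_(n, q) => p.1 *m p.2).
Proof.
move=> p; apply: continuous_mx => i j.
rewrite (_ : (fun _ => _) = \sum_k (fun y : 'M[R]_(m, n) * 'M[R]_(n, q) => y.1 i k * y.2 k j)); last first.
  by apply/funext => y; rewrite fct_sumE mxE.
apply: (big_ind (fun f => {for p, continuous f})); first exact: cst_continuous.
  by move=> f g cf cg; exact: continuousD.
move=> k _; apply: continuousM.
  exact: continuous_entry cvg_fst.
exact: continuous_entry cvg_snd.
Qed.

Lemma differentiable_mulmx (U : normedModType R) m n q (A : U -> 'M[R]_(m, n))
    (B : U -> 'M[R]_(n, q)) x :
  differentiable A x -> differentiable B x -> differentiable (fun y => A y *m B y) x.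
Proof.
exact: (differentiable_bilinear (B := (@mulmx R m n q : {bilinear _ -> _ -> _})) (@mulmx_continuous m n q)).
Qed.

Lemma derive_mulmx (U : normedModType R) m n q (A : U -> 'M[R]_(m, n))
    (B : U -> 'M[R]_(n, q)) x v :
  differentiable A x -> differentiable B x ->
  'D_v (fun y => A y *m B y) x = 'D_v A x *m B x + A x *m 'D_v B x.
Proof.
exact: (derive_bilinear (B := (@mulmx R m n q : {bilinear _ -> _ -> _})) _ (@mulmx_continuous m n q)).
Qed.

End Differentiation.

(** * Calculus of C^k maps on open sets *)

Section Ck_calculus.
Context {R : realType}.

Lemma near_open (T : topologicalType) (U : set T) (P : T -> Prop) x :
  open U -> U x -> (forall y, U y -> P y) -> \near x, P x.
Proof.
by move=> oU Ux UP; apply: filterS UP _; exact: open_nbhs_nbhs.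
Qed.

Lemma Ck_subset k (V W : normedModType R) (U U' : set V) (f : V -> W) :
  U' `<=` U -> Ck k U f -> Ck k U' f.
Proof.
move=> UU; elim: k f => [|k IH] f /=; first by move=> cf x /UU; exact: cf.
by move=> [df Df]; split=> [x /UU|v]; [exact: df|exact: IH].
Qed.

(** Needed because charts, local inverses and matrix inverses are total functions, with arbitrary
    values outside the sets where they are meaningful. *)
Lemma eq_Ck k (V W : normedModType R) (U : set V) (f g : V -> W) :
  open U -> (forall x, U x -> f x = g x) -> Ck k U f -> Ck k U g.
Proof.
move=> oU; elim: k f g => [|k IH] f g fg /=.
  move=> cf x Ux; rewrite /prop_for /continuous_at -(fg x Ux).
  apply: cvg_trans (cf x Ux); apply: near_eq_cvg; apply: (near_open oU Ux) => y Uy; exact: fg.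
move=> [df Df]; split=> [x Ux|v].
  by apply: near_differentiable (df x Ux); exact: (near_open oU Ux).
apply: IH (Df v) => x Ux; apply: near_eq_derive; exact: (near_open oU Ux).
Qed.

Lemma Ck_continuous k (V W : normedModType R) (U : set V) (f : V -> W) x :
  Ck k U f -> U x -> {for x, continuous f}.
Proof.
case: k => [|k] /=; first by move=> cf; exact: cf.
by move=> [df _] Ux; apply: differentiable_continuous; exact: df.
Qed.

Lemma CkS k (V W : normedModType R) (U : set V) (f : V -> W) :
  Ck k.+1 U f -> Ck k U f.
Proof.
elim: k f => [|k IH] f; first by move=> cf x; exact: Ck_continuous cf.
move=> [df Df]; split => // v; exact/IH/Df.
Qed.

Lemma Ck_differentiable k (V W : normedModType R) (U : set V) (f : V -> W) x :
  Ck k.+1 U f -> U x -> differentiable f x.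
Proof. by move=> [df _]; exact: df. Qed.

Lemma Ck_cst k (V W : normedModType R) (U : set V) (a : W) : Ck k U (cst a : V -> W).
Proof.
elim: k a => [|k IH] a /=; first by move=> x _; exact: cst_continuous.
split=> // v; rewrite (_ : (fun _ => _) = cst 0); first exact: IH.
by apply/funext => x; rewrite derive_cst.
Qed.

Lemma Ck_id k (V : normedModType R) (U : set V) : Ck k U (id : V -> V).
Proof.
case: k => [|k] /=; first by move=> x _.
split=> [//|v]; rewrite (_ : (fun _ => _) = cst v); first exact: Ck_cst.
by apply/funext => x; rewrite derive_id.
Qed.

Lemma Ck_linear_comp k (V W W' : normedModType R) (U : set V) (f : V -> W)
    (L : {linear W -> W'}) :
  open U -> continuous L -> Ck k U f -> Ck k U (L \o f).
Proof.
move=> oU cL; elim: k f => [|k IH] f /=.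
  by move=> cf x Ux; apply: continuous_comp; [exact: cf|exact: cL].
move=> [df Df]; split=> [x Ux|v].
  by apply: differentiable_comp; [exact: df|exact: linear_differentiable].
apply: eq_Ck (IH _ (Df v)) => // x Ux.
by rewrite /= derive_linear //; exact: df.
Qed.

Lemma CkD k (V W : normedModType R) (U : set V) (f g : V -> W) :
  open U -> Ck k U f -> Ck k U g -> Ck k U (fun x => f x + g x).
Proof.
move=> oU; elim: k f g => [|k IH] f g /=.
  by move=> cf cg x Ux; apply: continuousD; [exact: cf|exact: cg].
move=> [df Df] [dg Dg]; split=> [x Ux|v].
  by apply: differentiableD; [exact: df|exact: dg].
apply: eq_Ck (IH _ _ (Df v) (Dg v)) => // x Ux.
by rewrite [RHS](@deriveD _ _ _ f g) //; apply: diff_derivable; [exact: df|exact: dg].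
Qed.

Lemma CkN k (V W : normedModType R) (U : set V) (f : V -> W) :
  open U -> Ck k U f -> Ck k U (fun x => - f x).
Proof.
move=> oU; elim: k f => [|k IH] f /=.
  by move=> cf x Ux; apply: continuousN; exact: cf.
move=> [df Df]; split=> [x Ux|v]; first by apply: differentiableN; exact: df.
apply: eq_Ck (IH _ (Df v)) => // x Ux.
by rewrite [RHS](@deriveN _ _ _ f) //; apply: diff_derivable; exact: df.
Qed.

Lemma Ck_sum k (V W : normedModType R) (U : set V) I (r : seq I) (P : pred I)
    (f : I -> V -> W) :
  open U -> (forall i, P i -> Ck k U (f i)) ->
  Ck k U (fun x => \sum_(i <- r | P i) f i x).
Proof.
move=> oU cf; rewrite (_ : (fun _ => _) = \sum_(i <- r | P i) f i); last first.
  by apply/funext => x; rewrite fct_sumE.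
apply: (big_ind (fun g => Ck k U g)) => //; first exact: Ck_cst.
move=> g h cg ch; exact: CkD.
Qed.

Lemma Ck_bilinear k (V V1 V2 W : normedModType R) (U : set V)
    (B : {bilinear V1 -> V2 -> W}) (f : V -> V1) (g : V -> V2) :
  open U -> continuous (fun p => B p.1 p.2) -> Ck k U f -> Ck k U g ->
  Ck k U (fun x => B (f x) (g x)).
Proof.
move=> oU cB; elim: k f g => [|k IH] f g.
  move=> /= cf cg x Ux.
  apply: (@continuous_comp _ _ _ (fun y => (f y, g y)) (fun p => B p.1 p.2)); last exact: cB.
  by apply: cvg_pair; [exact: cf|exact: cg].
move=> Cf Cg; have [df Df] := Cf; have [dg Dg] := Cg; split=> [x Ux|v].
  by apply: differentiable_bilinear => //; [exact: df|exact: dg].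
apply: (@eq_Ck _ _ _ _ (fun x => B ('D_v f x) (g x) + B (f x) ('D_v g x))) => //.
  by move=> x Ux; rewrite derive_bilinear //; [exact: df|exact: dg].
by apply: CkD => //; apply: IH; [exact: Df|exact: CkS|exact: CkS|exact: Dg].
Qed.

Lemma CkZ k (V W : normedModType R) (U : set V) (f : V -> R) (g : V -> W) :
  open U -> Ck k U f -> Ck k U g -> Ck k U (fun x => f x *: g x).
Proof.
move=> oU; apply: (Ck_bilinear (B := ( *:%R : {bilinear R -> W -> W}))) => //.
exact: scale_continuous.
Qed.

Lemma CkM k (V : normedModType R) (U : set V) (f g : V -> R) :
  open U -> Ck k U f -> Ck k U g -> Ck k U (fun x => f x * g x).
Proof. exact: CkZ. Qed.

Lemma Ck_prod k (V : normedModType R) (U : set V) I (r : seq I) (P : pred I)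
    (f : I -> V -> R) :
  open U -> (forall i, P i -> Ck k U (f i)) ->
  Ck k U (fun x => \prod_(i <- r | P i) f i x).
Proof.
move=> oU cf; elim: r => [|i r IH].
  by under eq_fun do rewrite big_nil; exact: Ck_cst.
under eq_fun do rewrite big_cons; case: (boolP (P i)) => Pi //.
by apply: CkM => //; exact: cf.
Qed.

Lemma Ck_mulmx k (V : normedModType R) (U : set V) m n q (A : V -> 'M[R]_(m, n))
    (B : V -> 'M[R]_(n, q)) :
  open U -> Ck k U A -> Ck k U B -> Ck k U (fun x => A x *m B x).
Proof.
move=> oU; apply: (Ck_bilinear (B := (@mulmx R m n q : {bilinear _ -> _ -> _}))) => //.
exact: mulmx_continuous.
Qed.

Lemma CkV k (V : normedModType R) (U : set V) (f : V -> R) :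
  open U -> (forall x, U x -> f x != 0) -> Ck k U f -> Ck k U (fun x => (f x)^-1).
Proof.
move=> oU f0; elim: k => [|k IH].
  by move=> cf x Ux; apply: continuousV; [exact: f0|exact: cf].
move=> Cf; have [df Df] := Cf; split=> [x Ux|v].
  by apply: differentiableV; [exact: df|exact: f0].
(* The derivative of 1/f is - f^-2 Df, a product of functions that are C^k by induction. *)
have CV := IH (CkS Cf).
apply: (@eq_Ck _ _ _ _ (fun x => - ((f x)^-1 * (f x)^-1 * 'D_v f x))) => //.
  move=> x Ux; rewrite deriveV; [|exact: f0|apply: diff_derivable; exact: df].
  by rewrite scaleNr /= -exprVn.
by apply: CkN => //; apply: CkM => //; [exact: CkM|exact: Df].
Qed.

Lemma Ck_mx k (V : normedModType R) (U : set V) m n (A : V -> 'M[R]_(m, n)) :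
  open U -> (forall i j, Ck k U (fun x => A x i j)) -> Ck k U A.
Proof.
move=> oU cA; have -> : A = fun x => \sum_i \sum_j A x i j *: delta_mx i j.
  by apply/funext => x; exact: matrix_sum_delta.
apply: Ck_sum => // i _; apply: Ck_sum => // j _; apply: CkZ => //; exact: Ck_cst.
Qed.

Lemma Ck_entry k (V : normedModType R) (U : set V) m n (A : V -> 'M[R]_(m, n)) i j :
  open U -> Ck k U A -> Ck k U (fun x => A x i j).
Proof.
move=> oU cA.
have l : linear (fun B : 'M[R]_(m, n) => B i j : R^o).
  by move=> a B C; rewrite !mxE.
pose lM := GRing.isLinear.Build _ _ _ _ _ l.
pose L : {linear 'M[R]_(m, n) -> R^o} := HB.pack (fun B : 'M[R]_(m, n) => B i j : R^o) lM.
apply: (@Ck_linear_comp _ _ _ R^o _ A L) => //.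
exact: coord_continuous.
Qed.

Lemma Ck_det k (V : normedModType R) (U : set V) n (A : V -> 'M[R]_n) :
  open U -> Ck k U A -> Ck k U (fun x => \det (A x)).
Proof.
move=> oU cA; rewrite /determinant; apply: Ck_sum => // s _.
apply: CkM => //; first exact: Ck_cst.
apply: Ck_prod => // i _; exact: Ck_entry.
Qed.

(** Cramer's rule: the adjugate and the determinant are polynomial in the entries. *)
Lemma Ck_invmx k (V : normedModType R) (U : set V) n (A : V -> 'M[R]_n) :
  open U -> (forall x, U x -> A x \in unitmx) -> Ck k U A ->
  Ck k U (fun x => invmx (A x)).
Proof.
move=> oU uA cA.
apply: (@eq_Ck _ _ _ _ (fun x => (\det (A x))^-1 *: \adj (A x))) => //.
  by move=> x Ux; rewrite /invmx uA.
apply: CkZ => //.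
  apply: CkV => //; first by move=> x /uA; rewrite unitmxE unitfE.
  exact: Ck_det.
apply: Ck_mx => // i j; under eq_fun do rewrite mxE /cofactor.
apply: CkM => //; first exact: Ck_cst.
apply: Ck_det => //; apply: Ck_mx => // i' j'.
under eq_fun do rewrite !mxE; exact: Ck_entry.
Qed.

Lemma Ck_trmx k (V : normedModType R) (U : set V) m n (A : V -> 'M[R]_(m, n)) :
  open U -> Ck k U A -> Ck k U (fun x => (A x)^T).
Proof.
move=> oU cA; apply: Ck_mx => // i j; under eq_fun do rewrite mxE; exact: Ck_entry.
Qed.

Lemma derive_sum_delta (W : normedModType R) n (f : 'rV[R]_n -> W) x v :
  differentiable f x -> 'D_v f x = \sum_i v 0 i *: 'D_(delta_mx 0 i) f x.
Proof.
move=> df; rewrite deriveE // {1}[v]row_sum_delta linear_sum; apply: eq_bigr => i _.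
by rewrite linearZ /= deriveE.
Qed.

(** The intermediate space consists of rows, so the chain rule is a finite sum of products of a
    coordinate of D_v f with a partial derivative of g composed with f, and the induction on k
    applies to each factor. *)
Lemma Ck_comp k (V W : normedModType R) n (U : set V) (U' : set 'rV[R]_n)
    (f : V -> 'rV[R]_n) (g : 'rV[R]_n -> W) :
  open U -> (forall x, U x -> U' (f x)) -> Ck k U f -> Ck k U' g ->
  Ck k U (g \o f).
Proof.
move=> oU UU; elim: k f g UU => [|k IH] f g UU.
  move=> cf cg x Ux; apply: continuous_comp; [exact: cf|exact/cg/UU].
move=> Cf Cg; have [df Df] := Cf; have [dg Dg] := Cg; split=> [x Ux|v].
  by apply: differentiable_comp; [exact: df|exact/dg/UU].
apply: (@eq_Ck _ _ _ _
  (fun x => \sum_i 'D_v f x 0 i *: ('D_(delta_mx 0 i) g \o f) x)) => //.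
  move=> x Ux; rewrite [RHS](@derive_comp _ _ _ _ f g); [|exact: df|exact/dg/UU].
  by rewrite [RHS]derive_sum_delta //; exact/dg/UU.
apply: Ck_sum => // i _; apply: CkZ => //; first by apply: Ck_entry => //; exact: Df.
by apply: IH => //; [exact: CkS|exact: Dg].
Qed.

Lemma Ck_derive k (V W : normedModType R) (U : set V) (f : V -> W) v :
  Ck k.+1 U f -> Ck k U ('D_v f).
Proof. by move=> [_ Df]; exact: Df. Qed.

Lemma jacobian_row m n (f : 'rV[R]_m -> 'rV[R]_n) u i :
  differentiable f u -> row i ('J f u) = 'D_(delta_mx 0 i) f u.
Proof. by move=> df; rewrite derivemxE // -rowE. Qed.


Lemma jacobianE m n (f : 'rV[R]_m -> 'rV[R]_n) u i j :
  differentiable f u -> 'J f u i j = 'D_(delta_mx 0 i) f u 0 j.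
Proof. by move=> df; rewrite -(jacobian_row i df) [RHS]mxE. Qed.

Lemma Ck_jacobian k m n (U : set 'rV[R]_m) (f : 'rV[R]_m -> 'rV[R]_n) :
  open U -> Ck k.+1 U f -> Ck k U (fun u => 'J f u).
Proof.
move=> oU Cf; apply: Ck_mx => // i j.
apply: (@eq_Ck _ _ _ _ (fun u => 'D_(delta_mx 0 i) f u 0 j)) => //.
  by move=> u Uu; rewrite jacobianE //; exact: Ck_differentiable Cf Uu.
by apply: Ck_entry => //; exact: Ck_derive.
Qed.

Lemma jacobian_comp m n q (f : 'rV[R]_m -> 'rV[R]_n) (g : 'rV[R]_n -> 'rV[R]_q) u :
  differentiable f u -> differentiable g (f u) ->
  'J (g \o f) u = 'J f u *m 'J g (f u).
Proof.
move=> df dg; have dgf : differentiable (g \o f) u by exact: differentiable_comp.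
apply/row_matrixP => i; rewrite row_mul jacobian_row // derive_comp // -jacobian_row //.
by rewrite derivemxE.
Qed.

End Ck_calculus.

(** * Symmetry of second derivatives and the second derivative test *)

Section Second_order.
Context {R : realType}.

Lemma is_derive_line (V W : normedModType R) (f : V -> W) x v (s : R) :
  differentiable f (x + s *: v) ->
  is_derive s (1 : R) (fun s => f (x + s *: v)) ('D_v f (x + s *: v)).
Proof.
move=> df.
have dz : differentiable (fun s : R => s *: v) s by exact: (@differentiableZl _ _ _ id).
have dl : differentiable (fun s : R => x + s *: v) s by exact: (@differentiableD _ _ _ (cst x)).
have Dl : 'D_1 (fun s : R => x + s *: v) s = v.
  rewrite (@deriveD _ _ _ (cst x) (fun s : R => s *: v)) //; last exact: diff_derivable.
  by rewrite derive_cst add0r deriveE // (@diffZl _ _ _ id) //= -deriveE // derive_id scale1r.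
have dc : differentiable (f \o (fun s : R => x + s *: v)) s by exact: differentiable_comp.
split; first exact: diff_derivable.
by have := @derive_comp _ _ _ _ (fun s : R => x + s *: v) f s 1 dl df; rewrite Dl.
Qed.

Lemma mvt_line (V : normedModType R) (f : V -> R) x v t :
  0 < t -> (forall s, 0 <= s <= t -> differentiable f (x + s *: v)) ->
  exists2 s, 0 < s < t & f (x + t *: v) - f x = t * 'D_v f (x + s *: v).
Proof.
move=> t0 df.
have [||s] := @MVT _ (fun s => f (x + s *: v)) (fun s => 'D_v f (x + s *: v)) 0 t t0.
- by move=> s; rewrite in_itv /= => /andP[s0 st]; apply: is_derive_line; apply: df; rewrite !ltW.
- apply: derivable_within_continuous => s; rewrite in_itv /= => st.
  by have [] := is_derive_line (df s st).
- rewrite in_itv /= => st; rewrite scale0r addr0 subr0 mulrC => ->; by exists s.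
Qed.

Lemma near_line (V : normedModType R) (P : V -> Prop) x v :
  (\near x, P x) -> exists2 t : R, 0 < t & forall s, `|s| <= t -> P (x + s *: v).
Proof.
move=> Px.
have cl : {for (0 : R), continuous (fun s : R => x + s *: v)}.
  apply: (@continuousD _ _ _ (cst x)); first exact: cst_continuous.
  exact: scalel_continuous.
have : \forall s \near (0 : R), P (x + s *: v).
  by apply: cl; rewrite /= scale0r addr0.
case/nbhs_ballP => e /= e0 eP; exists (e / 2); first exact: divr_gt0.
move=> s se; apply: eP; rewrite /ball /= sub0r normrN.
by apply: le_lt_trans se _; rewrite ltr_pdivrMr // ltr_pMr // ltr1n.
Qed.

(* Two applications of the mean value theorem to the second difference
   f (x + t v + t w) - f (x + t v) - f (x + t w) + f x. *)
Lemma second_difference (V : normedModType R) (U : set V) (f : V -> R) x v w e :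
  open U -> U x -> Ck 2 U f -> 0 < e ->
  \forall t \near (0 : R)^'+,
    `|f (x + t *: v + t *: w) - f (x + t *: v) - (f (x + t *: w) - f x)
      - t ^+ 2 * 'D_w ('D_v f) x| <= t ^+ 2 * e.
Proof.
move=> oU Ux Cf e0.
have CD : Ck 1 U ('D_v f) by exact: Ck_derive Cf.
have CDD : Ck 0 U ('D_w ('D_v f)) by exact: Ck_derive CD.
have near0 : \forall y \near x, U y /\ `|'D_w ('D_v f) y - 'D_w ('D_v f) x| < e.
  near=> y; split; first by near: y; exact: open_nbhs_nbhs.
  rewrite distrC; near: y.
  by have /cvgrPdist_lt := CDD x Ux; apply.
case/nbhs_ballP: near0 => d /= d0 dP.
(* For t < d / K the parallelogram spanned by t v and t w at x stays in the ball of radius d; the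
   summand 1 keeps K positive when v = w = 0. *)
pose K : R := `|v| + `|w| + 1.
have K0 : 0 < K by rewrite ltr_wpDl // addr_ge0.
have Pin (a b t : R) : 0 < t < d / K -> 0 <= a <= t -> 0 <= b <= t ->
   U (x + a *: v + b *: w) /\ `|'D_w ('D_v f) (x + a *: v + b *: w) - 'D_w ('D_v f) x| < e.
  move=> /andP[t0 tK] /andP[a0 at_] /andP[b0 bt]; apply: dP; rewrite -ball_normE /=.
  rewrite opprD addrA opprD addrA subrr sub0r -opprD normrN.
  apply: (@le_lt_trans _ _ (t * K)); last by rewrite -ltr_pdivlMr.
  rewrite (le_trans (ler_normD _ _)) // !normrZ !ger0_norm // /K !mulrDr mulr1.
  rewrite -[leLHS]addr0 lerD ?(ltW t0) // lerD //; apply: ler_wpM2r => //.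
near=> t.
have t0 : 0 < t by [].
have tK : t < d / K by near: t; apply: nbhs_right_lt; exact: divr_gt0.
have tt : 0 < t < d / K by rewrite t0.
pose g y := f (y + t *: w) - f y.
have [|s /andP[s0 st]] := @mvt_line _ g x v t t0.
  move=> s st; have [U1 _] := Pin s t t tt st ltac:(by rewrite lexx ltW).
  have [U0 _] := Pin s 0 t tt st ltac:(by rewrite lexx ltW).
  rewrite scale0r addr0 in U0.
  apply: (@differentiableB _ _ _ (fun y => f (y + t *: w)) f); last exact: Ck_differentiable Cf U0.
  apply: (@differentiable_comp _ _ _ _ (fun y => y + t *: w) f).
    exact: (@differentiableD _ _ _ id (cst (t *: w))).
  exact: Ck_differentiable Cf U1.
rewrite /g => E1.
have ss : 0 <= s <= t by rewrite !ltW.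
have Dg : 'D_v g (x + s *: v) = 'D_v f (x + s *: v + t *: w) - 'D_v f (x + s *: v).
  have [U1 _] := Pin s t t tt ss ltac:(by rewrite lexx ltW).
  have [U0 _] := Pin s 0 t tt ss ltac:(by rewrite lexx ltW).
  rewrite scale0r addr0 in U0.
  have d1 : differentiable f (x + s *: v + t *: w) by exact: Ck_differentiable Cf U1.
  have dT : differentiable (fun y => y + t *: w) (x + s *: v).
    exact: (@differentiableD _ _ _ id (cst (t *: w))).
  have dc : differentiable (f \o (fun y => y + t *: w)) (x + s *: v).
    exact: differentiable_comp.
  rewrite (@deriveB _ _ _ (f \o (fun y => y + t *: w)) f); last 2 first.
  - exact: diff_derivable.
  - by apply: diff_derivable; exact: Ck_differentiable Cf U0.
  congr (_ - _); apply: etrans (derive_comp v dT d1) _; congr ('D_ _ f _).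
  by rewrite (@deriveD _ _ _ id (cst (t *: w))) // derive_id derive_cst addr0.
rewrite [X in `|X - _|](_ : _ = t * ('D_v f (x + s *: v + t *: w) - 'D_v f (x + s *: v))); last first.
  by rewrite -Dg -E1; move: (f _) (f _) (f _) (f _) => a b c a'; ring.
have [|r /andP[r0 rt] ->] := @mvt_line _ ('D_v f) (x + s *: v) w t t0.
  move=> r rt; have [U1 _] := Pin s r t tt ss rt; exact: Ck_differentiable CD U1.
have [_ H] := Pin s r t tt ss ltac:(by rewrite !ltW).
rewrite mulrA -expr2 -mulrBr normrM ger0_norm ?sqr_ge0 // ler_wpM2l ?sqr_ge0 //.
exact: ltW.
Unshelve. all: by end_near. Qed.

Lemma near_right_ex2 (P Q : R -> Prop) :
  (\forall t \near (0 : R)^'+, P t) -> (\forall t \near (0 : R)^'+, Q t) ->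
  exists t, [/\ 0 < t, P t & Q t].
Proof.
move=> HP HQ; apply: (@filter_ex _ (0 : R)^'+); near=> t; split => //; near: t.
  exact: HP.
exact: HQ.
Unshelve. all: by end_near. Qed.

(** The second difference is symmetric in v and w, and after division by t^2 it approximates either
    mixed derivative. *)
Lemma schwarz_real (V : normedModType R) (U : set V) (f : V -> R) x v w :
  open U -> U x -> Ck 2 U f -> 'D_w ('D_v f) x = 'D_v ('D_w f) x.
Proof.
move=> oU Ux Cf; apply/eqP; rewrite -subr_eq0 -normr_le0; apply/ler_addgt0Pr => e e0.
rewrite add0r; have e2 : 0 < e / 2 by exact: divr_gt0.
have [t [tp A B]] := near_right_ex2 (second_difference v w oU Ux Cf e2)
  (second_difference w v oU Ux Cf e2).
have E : f (x + t *: w + t *: v) - f (x + t *: w) - (f (x + t *: v) - f x) =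
  f (x + t *: v + t *: w) - f (x + t *: v) - (f (x + t *: w) - f x).
  rewrite [x + t *: w + t *: v]addrAC.
  move: (f (x + t *: v + t *: w)) (f (x + t *: v)) (f (x + t *: w)) (f x) => a b c a'; ring.
rewrite {}E distrC in B.
have := le_trans (ler_normD _ _) (lerD A B).
move: (f (_ + _ + _) - _ - _) => X.
move: ('D_v ('D_w f) x) ('D_w ('D_v f) x) => a b.
rewrite (_ : X - _ + _ = t ^+ 2 * (a - b)); last by ring.
rewrite -mulrDr -splitr normrM ger0_norm ?sqr_ge0 // ler_pM2l ?exprn_gt0 //.
by rewrite distrC.
Qed.

Lemma schwarz (V : normedModType R) m n (U : set V) (f : V -> 'M[R]_(m, n)) x v w :
  open U -> U x -> Ck 2 U f -> 'D_w ('D_v f) x = 'D_v ('D_w f) x.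
Proof.
move=> oU Ux Cf; apply/matrixP => i j.
have H u : forall y, U y -> 'D_u (fun y => f y i j) y = 'D_u f y i j.
  by move=> y Uy; rewrite derive_entry //; exact: Ck_differentiable Cf Uy.
have H2 u u' : 'D_u ('D_u' (fun y => f y i j)) x = 'D_u ('D_u' f) x i j.
  rewrite -derive_entry; last exact: Ck_differentiable (Ck_derive u' Cf) Ux.
  by apply: near_eq_derive; exact: (near_open oU Ux (H u')).
apply: etrans (esym (H2 w v)) (etrans _ (H2 v w)).
exact: schwarz_real oU Ux (Ck_entry i j oU Cf).
Qed.

(** If the second derivative were positive, then, after a change of sign of v making D_v f
    nonnegative at x, D_v f would be positive along the ray from x and f would increase strictly
    along it. *)
Lemma second_derivative_at_max (V : normedModType R) (U : set V) (f : V -> R) x v :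
  open U -> U x -> Ck 2 U f -> (\forall y \near x, f y <= f x) ->
  'D_v ('D_v f) x <= 0.
Proof.
move=> oU Ux Cf fmax; rewrite leNgt; apply/negP => DD0.
wlog D0 : v DD0 / 0 <= 'D_v f x.
  have [D0 wl|D0] := leP 0 ('D_v f x); first exact: wl DD0 D0.
  have DN : forall y, U y -> 'D_(- v) f y = - 'D_v f y.
    by move=> y Uy; have df := Ck_differentiable Cf Uy; rewrite !deriveE // linearN.
  have dD : differentiable ('D_v f) x by exact: Ck_differentiable (Ck_derive v Cf) Ux.
  move=> wl; apply: (wl (- v)); last by rewrite DN // oppr_ge0 ltW.
  rewrite (_ : 'D_(- v) ('D_(- v) f) x = 'D_(- v) (- ('D_v f)) x); last first.
    by apply: near_eq_derive; exact: (near_open oU Ux DN).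
  by rewrite deriveN ?deriveE ?linearN ?opprK // -?deriveE //; exact: diff_derivable.
have CD : Ck 1 U ('D_v f) by exact: Ck_derive Cf.
have : \forall y \near x, [/\ U y, f y <= f x & 0 < 'D_v ('D_v f) y].
  near=> y; split; near: y => //; first exact: open_nbhs_nbhs.
  have CDD : Ck 0 U ('D_v ('D_v f)) by exact: Ck_derive CD.
  have := CDD x Ux; move=> /cvgr_gt; exact.
case/(near_line v) => t t0 tP.
have [|s /andP[s0 st]] := @mvt_line _ f x v t t0.
  move=> s /andP[s0 st]; have [|Us _ _] := tP s; first by rewrite ger0_norm.
  exact: Ck_differentiable Cf Us.
have [|r /andP[r0 rs]] := @mvt_line _ ('D_v f) x v s s0.
  move=> r /andP[r0 rs]; have [|Us _ _] := tP r; first by rewrite ger0_norm // (le_trans rs) // ltW.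
  exact: Ck_differentiable CD Us.
move=> E2 E1.
have [|_ F _] := tP t; first by rewrite ger0_norm // ltW.
have [|_ _ G] := tP r; first by rewrite ger0_norm ?ltW // (lt_trans rs).
move: F; rewrite -subr_le0 E1 leNgt => /negP; apply.
rewrite mulr_gt0 //; apply: le_lt_trans D0 _; rewrite -subr_gt0 E2.
exact: mulr_gt0.
Unshelve. all: by end_near. Qed.

End Second_order.

(** * The inverse function theorem *)

Definition complete_rV (R : realType) n : completeNormedModType R :=
  HB.pack 'rV[R]_n (NormedModule.on 'rV[R]_n) (Complete.on 'rV[R]_n).

Section Inverse_function.
Context {R : realType}.

Lemma differential_of_bound (V W : normedModType R) (f : V -> W) (L : {linear V -> W}) x :
  continuous L ->
  (forall e, 0 < e -> \forall h \near (0 : V), `|f (h + x) - f x - L h| <= e * `|h|) ->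
  differentiable f x /\ forall v, 'D_v f x = L v.
Proof.
move=> cL fL.
have fE : f \o shift x = cst (f x) + L +o_ (0 : V) id.
  apply/eqaddoP => e e0; apply: filterS (fL e e0) => h.
  by rewrite !fctE /= opprD addrA.
have dE : 'd f x = L :> (V -> W) by exact: diff_unique.
have df : differentiable f x by apply/diff_locallyP; rewrite dE.
by split=> // v; rewrite deriveE // dE.
Qed.

Lemma differential_bound (V W : normedModType R) (f : V -> W) x e :
  differentiable f x -> 0 < e ->
  \forall h \near (0 : V), `|f (h + x) - f x - 'D_h f x| <= e * `|h|.
Proof.
move=> df e0.
have /eqaddoP/(_ e e0) fe : f \o shift x = cst (f x) + 'd f x +o_ (0 : V) id.
  exact: diff_locally.
by apply: filterS fe => h; rewrite !fctE /= opprD addrA deriveE.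
Qed.

Lemma mx_norm_le m n (A : 'M[R]_(m, n)) c :
  0 <= c -> (forall i j, `|A i j| <= c) -> `|A| <= c.
Proof.
by move=> c0 Ac; rewrite [leLHS]/Num.Def.normr /= mx_normrE (bigmax_le _ c0).
Qed.

Lemma mx_entry_le m n (A : 'M[R]_(m, n)) i j : `|A i j| <= `|A|.
Proof.
rewrite [leRHS]/Num.Def.normr /= mx_normrE; exact: (le_bigmax _ _ (i, j)).
Qed.

(** Continuity makes the partial derivatives small near u0, and the mean value theorem along
    segments, applied to one entry at a time, turns this into a Lipschitz bound for the maximum
    norm. *)
Lemma strict_derivative m n (U : set 'rV[R]_m) (G : 'rV[R]_m -> 'rV[R]_n) u0 e :
  open U -> U u0 -> Ck 1 U G -> (forall v, 'D_v G u0 = 0) -> 0 < e ->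
  exists2 d, 0 < d & forall u, ball u0 d u -> [/\ U u,
    forall v, `|'D_v G u| <= e * `|v| &
    forall u', ball u0 d u' -> `|G u' - G u| <= e * `|u' - u|].
Proof.
move=> oU Uu0 CG D0 e0.
(* D_v G is a combination of m partial derivatives with coefficients at most |v|; m + 1 avoids a
   division by zero for m = 0. *)
pose c := e / (m%:R + 1).
have m0 : 0 < m%:R + 1 :> R by rewrite ltr_wpDl.
have c0 : 0 < c by exact: divr_gt0.
have : \forall u \near u0, U u /\ forall i : 'I_m, `|'D_(delta_mx 0 i) G u| <= c.
  near=> u; split; first by near: u; exact: open_nbhs_nbhs.
  near: u; apply: filter_forall => i.
  have /cvgrPdist_le/(_ c c0) : {for u0, continuous ('D_(delta_mx 0 i) G)}.
    by apply: (Ck_continuous (k := 0) (U := U)) => //; exact: Ck_derive.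
  by apply: filterS => u; rewrite D0 sub0r normrN.
case/nbhs_ballP => d /= d0 dP; exists d => //.
have Dle u v : ball u0 d u -> `|'D_v G u| <= e * `|v|.
  move=> /dP[Uu Du]; rewrite derive_sum_delta; last exact: Ck_differentiable CG Uu.
  apply: (@le_trans _ _ (\sum_(i < m) c * `|v|)).
    apply: le_trans (ler_norm_sum _ _ _) _; apply: ler_sum => i _.
    by rewrite normrZ mulrC ler_pM // mx_entry_le.
  rewrite sumr_const card_ord -mulr_natr mulrAC ler_wpM2r //.
  by rewrite /c mulrAC ler_pdivrMr // ler_wpM2l ?lerDl // ltW.
move=> u Bu; split=> [|v|u' Bu']; [by have [] := dP u Bu|exact: Dle|].
have Bs s : 0 <= s <= 1 -> ball u0 d (u + s *: (u' - u)).
  move=> /andP[s0 s1]; move: Bu Bu'; rewrite -ball_normE /= => Bu Bu'.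
  rewrite (_ : u0 - _ = (1 - s) *: (u0 - u) + s *: (u0 - u')); last first.
    apply/rowP => i; rewrite !mxE; ring.
  apply: le_lt_trans (ler_normD _ _) _; rewrite !normrZ !ger0_norm ?subr_ge0 //.
  have [->|sn0] := eqVneq s 0; first by rewrite subr0 mul0r mul1r addr0.
  have sp : 0 < s by rewrite lt_neqAle eq_sym sn0.
  rewrite (_ : d = (1 - s) * d + s * d); last by ring.
  by rewrite ler_ltD ?ltr_pM2l // ler_wpM2l ?subr_ge0 // ltW.
apply: mx_norm_le; first by rewrite mulr_ge0 // ltW.
move=> i j; rewrite [i]ord1.
have [|s /andP[s0 s1]] := @mvt_line _ _ (fun u => G u 0 j) u (u' - u) 1 ltr01.
  move=> s /Bs/dP[Us _]; apply: differentiable_entry; exact: Ck_differentiable CG Us.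
have ss : 0 <= s <= 1 by rewrite !ltW.
have [Us _] := dP _ (Bs s ss).
rewrite scale1r mul1r [u + (u' - u)]addrC subrK => E.
rewrite [(G u' - G u) _ _]mxE [(- G u) _ _]mxE E.
rewrite derive_entry; last exact: Ck_differentiable CG Us.
by apply: le_trans (mx_entry_le _ _ _) _; exact: Dle (Bs s ss).
Unshelve. all: by end_near. Qed.

Lemma mulmx_const_continuous m n q (A : 'M[R]_(n, q)) :
  continuous (fun B : 'M[R]_(m, n) => B *m A).
Proof.
move=> B; apply: differentiable_continuous.
exact: (differentiable_mulmx (A := id) (B := cst A)).
Qed.

Lemma unitmx_of_inj n (A : 'M[R]_n) :
  (forall v : 'rV_n, v *m A = 0 -> v = 0) -> A \in unitmx.
Proof.
move=> inj; rewrite -row_free_unit -kermx_eq0; apply/eqP/row_matrixP => i.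
by rewrite row0; apply: inj; rewrite -row_mul mulmx_ker row0.
Qed.

(** Newton iteration with the derivative frozen at u0: u solves f u = y exactly when it is fixed by
    u |-> u - (f u - y) A. The last clause, that k is a left inverse near u0, is what allows
    different parametrizations of a submanifold to be compared. *)
Lemma inverse_function n (U : set 'rV[R]_n) (f : 'rV[R]_n -> 'rV[R]_n) u0 :
  open U -> U u0 -> smooth_on U f -> 'J f u0 \in unitmx ->
  exists (V : set 'rV[R]_n) (k : 'rV[R]_n -> 'rV[R]_n),
  [/\ open V /\ smooth_on V k, V (f u0) /\ k (f u0) = u0,
      forall y, V y -> [/\ U (k y), f (k y) = y & 'J f (k y) \in unitmx]
    & \forall u \near u0, V (f u) /\ k (f u) = u].
Proof.
move=> oU Uu0 Sf uJ; set A := invmx ('J f u0).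
have df u : U u -> differentiable f u by move=> Uu; exact: Ck_differentiable (Sf 1%N) Uu.
pose G u := u - f u *m A.
have CG k : Ck k U G.
  apply: CkD => //; first exact: Ck_id.
  by apply: CkN => //; apply: (Ck_mulmx oU (Sf k)); exact: Ck_cst.
have DG u v : U u -> 'D_v G u = v - v *m 'J f u *m A.
  move=> Uu; rewrite (@deriveB _ _ _ id (fun u => f u *m A)); last 2 first.
  - by [].
  - by apply: diff_derivable; apply: differentiable_mulmx => //; exact: df.
  rewrite derive_id derive_mulmx //; last exact: df.
  by rewrite derive_cst mulmx0 addr0 derivemxE //; exact: df.
have [||d d0 dP] := @strict_derivative _ _ U G u0 (1 / 2) oU Uu0 (CG 1%N).
- by move=> v; rewrite DG // mulmxK // subrr.
- by rewrite divr_gt0.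
have B0 : ball u0 d u0 by exact: ballxx.
pose r := d / 2.
have r0 : 0 < r by rewrite divr_gt0.
have rd u : `|u - u0| <= r -> ball u0 d u.
  rewrite -ball_normE /= distrC => /le_lt_trans; apply.
  by rewrite /r ltr_pdivrMr // ltr_pMr // ltr1n.
(* If v is killed by the Jacobian at u, then D_v G u = v, whereas |D_v G u| is at most |v| / 2. *)
have uf u : ball u0 d u -> 'J f u \in unitmx.
  move=> /dP[Uu Du _]; apply: unitmx_of_inj => v vJ.
  have := Du v; rewrite DG // vJ mul0mx subr0 -subr_ge0 -{2}[`|v|]mul1r -mulrBl.
  by rewrite (_ : _ - 1 = - (1 / 2)) ?mulNr ?oppr_ge0 ?pmulr_rle0 ?normr_le0 //; [move/eqP|field].
have fGE u u' : u' - u = (G u' - G u) + (f u' - f u) *m A.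
  by rewrite /G mulmxBl; apply/rowP => i; rewrite !mxE; ring.
have inv_lip u u' : ball u0 d u -> ball u0 d u' -> `|u' - u| <= 2 * `|(f u' - f u) *m A|.
  move=> Bu Bu'; have [_ _ /(_ u' Bu') Gu] := dP u Bu.
  have : `|u' - u| <= 1 / 2 * `|u' - u| + `|(f u' - f u) *m A|.
    by rewrite [in leLHS]fGE (le_trans (ler_normD _ _)) // lerD2r.
  lra.
(* For these y the iteration preserves the closed ball of radius r: the Lipschitz bound of G
   contributes r / 2 and the term in y another r / 2. *)
pose V : set 'rV[R]_n := [set y | `|(y - f u0) *m A| < r / 2].
have oV : open V.
  have c : continuous (fun y : 'rV[R]_n => `|(y - f u0) *m A|).
    move=> y; have dB : differentiable (fun y => y - f u0) y.
      exact: (@differentiableB _ _ _ id (cst (f u0))).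
    have dm := differentiable_mulmx dB (differentiable_cst A y).
    exact: (continuous_comp (differentiable_continuous dm) (@norm_continuous _ _ _)).
  by have /continuousP/(_ _ (@open_lt _ (r / 2))) := c.
have ex y : V y -> exists2 u, `|u - u0| <= r & f u = y.
  move=> Vy; pose C : set 'rV[R]_n := [set u | `|u - u0| <= r].
  have cC : closed C.
    have c : continuous (fun y : 'rV[R]_n => `|y - u0|).
      move=> z; have dB : differentiable (fun y => y - u0) z.
        exact: (@differentiableB _ _ _ id (cst u0)).
      exact: (continuous_comp (differentiable_continuous dB) (@norm_continuous _ _ _)).
    by have /continuous_closedP/(_ _ (@closed_le _ r)) := c.
  pose T u := G u + y *m A.
  have TC : set_fun C C T.
    move=> u Cu; rewrite /C /T /= (_ : _ - u0 = (G u - G u0) + (y - f u0) *m A); last first.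
      by rewrite /G mulmxBl; apply/rowP => i; rewrite !mxE; ring.
    apply: le_trans (ler_normD _ _) _; have [_ _ /(_ u (rd u Cu)) Gu] := dP u0 B0.
    rewrite [leRHS](splitr r) lerD //; last exact: ltW.
    by apply: le_trans Gu _; rewrite mul1r [leRHS]mulrC ler_wpM2l.
  pose TF : {fun C >-> C} := HB.pack T (isFun.Build _ _ C C T TC).
  have cT : is_contraction TF.
    exists (NngNum (ltW (divr_gt0 ltr01 (ltr0n R 2)))); split.
      by rewrite /= ltr_pdivrMr // mul1r ltr1n.
    move=> [u u'] [/= Cu Cu']; rewrite /T opprD addrACA subrr addr0.
    by have [_ _ ->] := dP u' (rd u' Cu'); last exact: rd.
  have [|u Cu uT] := @banach_fixed_point R (complete_rV R n) C TF cT cC; first by exists u0; rewrite /C /= subrr normr0 ltW.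
  exists u => //; have uE : u = u - f u *m A + y *m A := uT.
  have yA : (y - f u) *m A = 0.
    by apply: (addrI u); rewrite addr0 [RHS]uE mulmxBl addrA [LHS]addrAC.
  move/(congr1 (mulmx^~ ('J f u0))): yA; rewrite /= mulmxKV // mul0mx => /eqP.
  by rewrite subr_eq0 => /eqP ->.
have [k kP] : exists k : 'rV[R]_n -> 'rV[R]_n, forall y, V y -> `|k y - u0| <= r /\ f (k y) = y.
  have /choice[k kP] : forall y, exists u, V y -> `|u - u0| <= r /\ f u = y.
    move=> y; have [/ex[u ur fu]|nV] := pselect (V y); first by exists u.
    by exists 0.
  by exists k.
have kB y : V y -> ball u0 d (k y) by move=> /kP[/rd].
have inj u u' : ball u0 d u -> ball u0 d u' -> f u = f u' -> u = u'.
  move=> Bu Bu' E; have := inv_lip u u' Bu Bu'.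
  by rewrite E subrr mul0mx normr0 mulr0 normr_le0 subr_eq0 => /eqP ->.
have [C C0 AC] : exists2 C : R, 0 < C & forall y : 'rV[R]_n, `|y *m A| <= C * `|y|.
  have c : continuous (mulmxr A : 'rV[R]_n -> 'rV[R]_n) by exact: mulmx_const_continuous.
  by have [C C0 HC] := linear_lipschitz c; exists C.
have k_lip y y' : V y -> V y' -> `|k y' - k y| <= 2 * C * `|y' - y|.
  move=> Vy Vy'; apply: le_trans (inv_lip _ _ (kB _ Vy) (kB _ Vy')) _.
  by rewrite (kP y Vy).2 (kP y' Vy').2 -mulrA ler_wpM2l.
have Vf0 : V (f u0) by rewrite /V /= subrr mul0mx normr0 divr_gt0.
have kf0 : k (f u0) = u0 by apply: inj; [exact: kB|exact: B0|exact: (kP _ Vf0).2].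
have kn y e : V y -> 0 < e -> \forall y' \near y, `|k y - k y'| <= e.
  move=> Vy e0; near=> y'.
  have Vy' : V y' by near: y'; exact: open_nbhs_nbhs.
  apply: le_trans (k_lip _ _ Vy' Vy) _; rewrite -ler_pdivlMl ?mulr_gt0 //.
  near: y'; move: (@cvg_id _ (nbhs y)) => /cvgrPdist_le; apply.
  by rewrite mulr_gt0 // invr_gt0 mulr_gt0.
have kc y : V y -> k @ y --> k y.
  by move=> Vy; apply/(@cvgrPdist_le _ _ _ (nbhs y)) => e e0; exact: kn.
have kd y : V y -> differentiable k y /\ forall v, 'D_v k y = v *m invmx ('J f (k y)).
  move=> Vy; set J := 'J f (k y).
  have uJk : J \in unitmx by exact/uf/kB.
  have cL : continuous (mulmxr (invmx J) : 'rV[R]_n -> 'rV[R]_n) by exact: mulmx_const_continuous.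
  have [D D0' DP] := linear_lipschitz cL.
  apply: (differential_of_bound cL) => e e0.
  have dfk : differentiable f (k y) by apply: df; have [] := dP _ (kB _ Vy).
  (* The linearization error of f at k y is measured against |k (h + y) - k y| <= 2 C |h|, and the
     multiplication by the inverse Jacobian costs a factor D. *)
  have e1 : 0 < e / (D * (2 * C)) by rewrite divr_gt0 // !mulr_gt0.
  have fb := differential_bound dfk e1.
  have Vh : \forall h \near (0 : 'rV[R]_n), V (h + y).
    have : \forall z \near y, V z by exact: open_nbhs_nbhs.
    by rewrite {1}(near_shift 0) subr0.
  case/nbhs_ballP: fb => q /= q0 qP.
  near=> h.
  have V1 : V (h + y) by near: h.
  have := k_lip _ _ Vy V1; rewrite addrK => K.
  have hq : `|h| < q / (2 * C).
    near: h; apply/nbhs_ballP; exists (q / (2 * C)); first by rewrite /= divr_gt0 // mulr_gt0.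
    by move=> h; rewrite -ball_normE /= sub0r normrN.
  have /qP : ball (0 : 'rV[R]_n) q (k (h + y) - k y).
    rewrite -ball_normE /= sub0r normrN (le_lt_trans K) // mulrC -ltr_pdivlMr //.
    by rewrite mulr_gt0.
  rewrite subrK (kP _ V1).2 (kP _ Vy).2 derivemxE // -/J addrK => H.
  rewrite (_ : _ - _ = - mulmxr (invmx J) (h - (k (h + y) - k y) *m J)); last first.
    by rewrite /= mulmxBl mulmxK // opprB.
  rewrite normrN (le_trans (DP _)) //.
  apply: (@le_trans _ _ (D * (e / (D * (2 * C)) * (2 * C * `|h|)))).
    rewrite ler_wpM2l ?(ltW D0') // (le_trans H) // ler_wpM2l // ltW //.
  by rewrite le_eqVlt; apply/orP; left; apply/eqP; field; rewrite !gt_eqF.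
(* Bootstrapping: the derivative of k is a smooth function of k y, so that k of class C^j implies k
   of class C^(j + 1). *)
have Sk j : Ck j V k.
  elim: j => [|j IH]; first exact: kc.
  split=> [y Vy|v]; first by have [] := kd y Vy.
  apply: (@eq_Ck _ _ _ _ _ (fun y => v *m invmx ('J f (k y)))) => //.
    by move=> y /kd[_ ->].
  apply: Ck_mulmx => //; first exact: Ck_cst.
  apply: (@Ck_comp _ _ _ _ _ _ (ball u0 d) k (fun u => invmx ('J f u))) => //.
  have oB : open (ball u0 d) by exact: ball_open.
  apply: Ck_invmx => //; apply: Ck_jacobian => //.
  by apply: Ck_subset (Sf j.+1) => u /dP[].
exists V, k; split; [exact: conj oV Sk|exact: conj Vf0 kf0| |].
  move=> y Vy; have [Uk _ _] := dP _ (kB _ Vy); split; [exact: Uk|exact: (kP _ Vy).2|exact/uf/kB].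
near=> u.
have Bu : ball u0 d u by near: u; exact: nbhsx_ballx.
have Vfu : V (f u).
  near: u; apply: (differentiable_continuous (df u0 Uu0)); exact: open_nbhs_nbhs.
split; first exact: Vfu.
apply: inj; [exact: kB|exact: Bu|exact: (kP _ Vfu).2].
Unshelve. all: by end_near. Qed.

End Inverse_function.

(** * Minimal immersions in products *)

Section Inner_product.
Context {R : realType}.
Implicit Types n : nat.

Lemma innerE n (g : 'M[R]_n) (v w : 'rV_n) :
  inner g v w = \sum_i \sum_j v 0 i * g i j * w 0 j.
Proof.
rewrite /inner mxE exchange_big /=; apply: eq_bigr => j _.
by rewrite mxE mulr_suml; apply: eq_bigr => i _; rewrite mxE.
Qed.

Lemma innerDl n (g : 'M[R]_n) u v w : inner g (u + v) w = inner g u w + inner g v w.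
Proof. by rewrite /inner !mulmxDl mxE. Qed.

Lemma innerZl n (g : 'M[R]_n) a v w : inner g (a *: v) w = a * inner g v w.
Proof. by rewrite /inner -!scalemxAl mxE. Qed.

Lemma innerNl n (g : 'M[R]_n) v w : inner g (- v) w = - inner g v w.
Proof. by rewrite -scaleN1r innerZl mulN1r. Qed.

Lemma inner0l n (g : 'M[R]_n) w : inner g 0 w = 0.
Proof. by rewrite -(scale0r 0) innerZl mul0r. Qed.

Lemma innerDr n (g : 'M[R]_n) w u v : inner g w (u + v) = inner g w u + inner g w v.
Proof. by rewrite /inner linearD mulmxDr mxE. Qed.

Lemma innerZr n (g : 'M[R]_n) a w v : inner g w (a *: v) = a * inner g w v.
Proof. by rewrite /inner linearZ -scalemxAr mxE. Qed.

Lemma innerNr n (g : 'M[R]_n) w v : inner g w (- v) = - inner g w v.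
Proof. by rewrite -scaleN1r innerZr mulN1r. Qed.

Lemma inner0r n (g : 'M[R]_n) w : inner g w 0 = 0.
Proof. by rewrite -(scale0r 0) innerZr mul0r. Qed.

Lemma inner_suml n (g : 'M[R]_n) I (r : seq I) (P : pred I) (f : I -> 'rV_n) w :
  inner g (\sum_(i <- r | P i) f i) w = \sum_(i <- r | P i) inner g (f i) w.
Proof.
by apply: (big_morph (fun v => inner g v w)); [move=> u v; exact: innerDl|exact: inner0l].
Qed.

Lemma inner_sumr n (g : 'M[R]_n) I (r : seq I) (P : pred I) (f : I -> 'rV_n) w :
  inner g w (\sum_(i <- r | P i) f i) = \sum_(i <- r | P i) inner g w (f i).
Proof.
by apply: (big_morph (fun v => inner g w v)); [move=> u v; exact: innerDr|exact: inner0r].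
Qed.

Lemma inner_mxD n (g g' : 'M[R]_n) v w : inner (g + g') v w = inner g v w + inner g' v w.
Proof. by rewrite /inner mulmxDr mulmxDl mxE. Qed.

Lemma inner_mxZ n a (g : 'M[R]_n) v w : inner (a *: g) v w = a * inner g v w.
Proof. by rewrite /inner -scalemxAr -scalemxAl mxE. Qed.

Lemma inner_mx0 n v w : inner (0 : 'M[R]_n) v w = 0.
Proof. by rewrite /inner mulmx0 mul0mx mxE. Qed.

Lemma inner_mx_sum n I (r : seq I) (P : pred I) (f : I -> 'M[R]_n) v w :
  inner (\sum_(i <- r | P i) f i) v w = \sum_(i <- r | P i) inner (f i) v w.
Proof.
by apply: (big_morph (fun g => inner g v w)); [move=> u v'; exact: inner_mxD|exact: inner_mx0].
Qed.

Lemma inner_sym n (g : 'M[R]_n) v w : g^T = g -> inner g v w = inner g w v.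
Proof.
move=> gs; rewrite /inner; transitivity ((v *m g *m w^T)^T 0 0); first by rewrite [RHS]mxE.
by rewrite !trmx_mul trmxK gs mulmxA.
Qed.

Lemma inner_delta n (g : 'M[R]_n) i j : inner g (delta_mx 0 i) (delta_mx 0 j) = g i j.
Proof. by rewrite /inner -rowE trmx_delta -colE !mxE. Qed.

Lemma inner_mulmx m n (J : 'M[R]_(m, n)) (g : 'M[R]_n) v w :
  inner (J *m g *m J^T) v w = inner g (v *m J) (w *m J).
Proof. by rewrite /inner trmx_mul !mulmxA. Qed.

Lemma inner_mxE m n (A : 'M[R]_(m, n)) (g : 'M[R]_n) i j :
  (A *m g *m A^T) i j = inner g (row i A) (row j A).
Proof. by rewrite -inner_delta inner_mulmx -!rowE. Qed.

Lemma posdef_unitmx n (g : 'M[R]_n) :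
  (forall v, v != 0 -> 0 < inner g v v) -> g \in unitmx.
Proof.
move=> pg; apply: unitmx_of_inj => v vg; apply/eqP/negP => /negP /pg.
by rewrite /inner vg mul0mx mxE ltxx.
Qed.

Lemma derive_inner (V : normedModType R) n (g : V -> 'M[R]_n) (a b : V -> 'rV_n) x v :
  differentiable g x -> differentiable a x -> differentiable b x ->
  'D_v (fun y => inner (g y) (a y) (b y)) x =
  inner ('D_v g x) (a x) (b x) + inner (g x) ('D_v a x) (b x) + inner (g x) (a x) ('D_v b x).
Proof.
move=> dg da db; rewrite /inner.
have dbT : differentiable (fun y => (b y)^T) x.
  apply: differentiable_mx => i j; under eq_fun do rewrite mxE; exact: differentiable_entry.
have DbT : 'D_v (fun y => (b y)^T) x = ('D_v b x)^T.
  apply/matrixP => i j; rewrite -derive_entry // mxE -derive_entry //.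
  by congr ('D_v _ x); apply/funext => y; rewrite mxE.
have dag : differentiable (fun y => a y *m g y) x by exact: differentiable_mulmx.
rewrite derive_entry; last exact: differentiable_mulmx.
rewrite derive_mulmx // derive_mulmx // DbT mulmxDl.
by rewrite [LHS]mxE [X in X + _]mxE; ring.
Qed.

Lemma differentiable_inner (V : normedModType R) n (g : V -> 'M[R]_n) (a b : V -> 'rV_n) x :
  differentiable g x -> differentiable a x -> differentiable b x ->
  differentiable (fun y => inner (g y) (a y) (b y)) x.
Proof.
move=> dg da db; apply: differentiable_entry; apply: differentiable_mulmx.
  exact: differentiable_mulmx.
by apply: differentiable_mx => i j; under eq_fun do rewrite mxE; exact: differentiable_entry.
Qed.

Lemma Ck_inner k (V : normedModType R) (U : set V) n (g : V -> 'M[R]_n) (a b : V -> 'rV_n) :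
  open U -> Ck k U g -> Ck k U a -> Ck k U b -> Ck k U (fun y => inner (g y) (a y) (b y)).
Proof.
move=> oU Cg Ca Cb; apply: Ck_entry => //; apply: Ck_mulmx => //; first exact: Ck_mulmx.
exact: Ck_trmx.
Qed.

End Inner_product.

(** * The Koszul formula and the trace of the shape operator *)

Section Koszul.
Context {R : realType}.
Opaque derive jacobian.

(* g(nabla_a b, c) for constant vector fields a, b, c *)
Definition koszul n (g : 'rV[R]_n -> 'M[R]_n) (x a b c : 'rV[R]_n) : R :=
  2^-1 * (inner ('D_a g x) b c + inner ('D_b g x) a c - inner ('D_c g x) a b).

(** For nu normal this is the second fundamental form in the direction nu: the covariant derivative
    of d_j F along d_i, paired with nu. Arbitrary nu are allowed, since in a product the two
    components of a normal vector need not be normal separately. *)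
Definition second_form m n (g : 'rV[R]_n -> 'M[R]_n) (F : 'rV[R]_m -> 'rV[R]_n) u nu :
    'M[R]_m :=
  \matrix_(i, j) (inner (g (F u)) ('D_(delta_mx 0 i) ('D_(delta_mx 0 j) F) u) nu
    + koszul g (F u) ('D_(delta_mx 0 i) F u) ('D_(delta_mx 0 j) F u) nu).

Lemma derive_sym (V : normedModType R) n (O : set V) (g : V -> 'M[R]_n) x v :
  open O -> O x -> differentiable g x -> (forall y, O y -> (g y)^T = g y) ->
  ('D_v g x)^T = 'D_v g x.
Proof.
move=> oO Ox dg gs; apply/matrixP => i j; rewrite mxE -!derive_entry //.
apply: near_eq_derive; apply: (near_open oO Ox) => y Oy; by rewrite -[in LHS]gs // mxE.
Qed.

Lemma inner_deltar n (g : 'M[R]_n) a l :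
  inner g a (delta_mx 0 l) = \sum_j a 0 j * g j l.
Proof. by rewrite /inner trmx_delta -colE !mxE. Qed.

Lemma inner_row_sum n (g : 'M[R]_n) b c :
  inner g b c = \sum_l c 0 l * inner g b (delta_mx 0 l).
Proof.
by rewrite {1}[c]row_sum_delta inner_sumr; apply: eq_bigr => l _; rewrite innerZr.
Qed.

(** Lowering the index cancels [invmx G] in the Christoffel symbols. [T i] stands for the i-th
    partial derivative of the metric, and [w] is twice the covector that the Koszul formula attaches
    to a and b. *)
Lemma inner_christoffel_symbols n (T : 'I_n -> 'M[R]_n) (G : 'M[R]_n) (a b c : 'rV[R]_n) :
  G^T = G -> G \in unitmx ->
  inner G (\row_k \sum_i \sum_j
    2^-1 * (\sum_l invmx G k l * (T i j l + T j i l - T l i j)) * a 0 i * b 0 j) c =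
  2^-1 * (inner (\sum_k a 0 k *: T k) b c + inner (\sum_k b 0 k *: T k) a c
          - inner (\sum_k c 0 k *: T k) a b).
Proof.
move=> Gs uG.
pose w : 'rV[R]_n := \row_l (inner (\sum_k a 0 k *: T k) b (delta_mx 0 l)
  + inner (\sum_k b 0 k *: T k) a (delta_mx 0 l) - inner (T l) a b).
have wE l : w 0 l = \sum_i \sum_j (T i j l + T j i l - T l i j) * a 0 i * b 0 j.
  rewrite mxE !inner_mx_sum innerE.
  have -> : \sum_i inner (a 0 i *: T i) b (delta_mx 0 l) =
    \sum_i \sum_j a 0 i * (b 0 j * T i j l).
    by apply: eq_bigr => i _; rewrite inner_mxZ inner_deltar mulr_sumr.
  have -> : \sum_i inner (b 0 i *: T i) a (delta_mx 0 l) =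
    \sum_i \sum_j b 0 j * (a 0 i * T j i l).
    rewrite [RHS]exchange_big; apply: eq_bigr => i _.
    by rewrite inner_mxZ inner_deltar mulr_sumr.
  rewrite -sumrN -!big_split; apply: eq_bigr => i _.
  rewrite -sumrN -!big_split; apply: eq_bigr => j _ /=; ring.
have -> : \row_k (\sum_i \sum_j
    2^-1 * (\sum_l invmx G k l * (T i j l + T j i l - T l i j)) * a 0 i * b 0 j)
    = 2^-1 *: (w *m invmx G).
  apply/rowP => k; rewrite !mxE mulr_sumr.
  transitivity (\sum_l \sum_i \sum_j 2^-1 * (invmx G k l *
    ((T i j l + T j i l - T l i j) * a 0 i * b 0 j))).
    rewrite [RHS]exchange_big; apply: eq_bigr => i _; rewrite [RHS]exchange_big.
    apply: eq_bigr => j _; rewrite -!mulrA mulr_suml mulr_sumr.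
    by apply: eq_bigr => l _; ring.
  apply: eq_bigr => l _; rewrite wE mulr_suml mulr_sumr; apply: eq_bigr => i _.
  rewrite mulr_suml mulr_sumr; apply: eq_bigr => j _.
  have -> : invmx G l k = invmx G k l by rewrite -[in LHS]Gs -trmx_inv mxE.
  ring.
rewrite innerZl; congr (_ * _).
have -> : inner G (w *m invmx G) c = \sum_l c 0 l * w 0 l.
  by rewrite /inner mulmxKV // mxE; apply: eq_bigr => l _; rewrite [c^T _ _]mxE mulrC.
rewrite (inner_row_sum _ b c) (inner_row_sum _ a c) [X in _ - X]inner_mx_sum.
rewrite -sumrN -!big_split; apply: eq_bigr => l _.
by rewrite inner_mxZ mxE /=; ring.
Qed.

Lemma inner_christoffel n (g : 'rV[R]_n -> 'M[R]_n) x (a b c : 'rV[R]_n) :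
  differentiable g x -> (g x)^T = g x -> g x \in unitmx ->
  inner (g x) (\row_k \sum_i \sum_j christoffel g k i j x * a 0 i * b 0 j) c =
  koszul g x a b c.
Proof.
move=> dg gs ug; rewrite /koszul !(derive_sum_delta _ dg).
rewrite -(inner_christoffel_symbols _ _ _ _ gs ug); congr (inner _ _ _).
apply/rowP => k; rewrite !mxE; apply: eq_bigr => i _; apply: eq_bigr => j _.
congr (_ * _ * _ * _); apply: eq_bigr => l _; congr (_ * _).
by rewrite /partial !derive_entry.
Qed.

Lemma is_normalE m n (g : 'rV[R]_n -> 'M[R]_n) (F : 'rV[R]_m -> 'rV[R]_n) u nu :
  is_normal g F u nu <-> 'J F u *m g (F u) *m nu^T = 0.
Proof.
split=> [H|H Y]; last by rewrite /inner -!mulmxA (mulmxA ('J F u)) H mulmx0 mxE.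
apply/matrixP => i j; rewrite [j]ord1 [RHS]mxE -(H (delta_mx 0 i)) /inner.
by rewrite -!mulmxA -rowE [RHS]mxE.
Qed.

Lemma koszul_algebra n (G A B C : 'M[R]_n) (dn d2 x y nu : 'rV[R]_n) :
  G^T = G -> A^T = A ->
  0 = inner A nu y + inner G dn y + inner G nu d2 ->
  - (inner G dn y + 2^-1 * (inner A nu y + inner B x y - inner C x nu)) =
  inner G d2 nu + 2^-1 * (inner A y nu + inner C x nu - inner B x y).
Proof.
move=> Gs As E; rewrite (inner_sym d2 nu Gs) (inner_sym y nu As).
lra.
Qed.

(** The Weingarten equation: differentiating g(n, d_j F) = 0 along a normal field n moves the
    derivative from n to d_j F with a minus sign. Hence the shape operator has as its matrix the
    second form times the inverse of the induced metric. *)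
Lemma shape_trace m n (U : set 'rV[R]_m) (O : set 'rV[R]_n) (g : 'rV[R]_n -> 'M[R]_n)
    (F : 'rV[R]_m -> 'rV[R]_n) u nu :
  open U -> U u -> (forall w, U w -> O (F w)) -> Ck 2 U F -> Ck 1 O g ->
  open O -> (forall y, O y -> (g y)^T = g y) -> (forall y, O y -> g y \in unitmx) ->
  (forall w, U w -> pullback g F w \in unitmx) ->
  is_normal g F u nu ->
  \tr (lin1_mx (Defs.shape g F u nu)) =
  \tr (second_form g F u nu *m invmx (pullback g F u)).
Proof.
move=> oU Uu UO CF Cg oO gs ug uP /is_normalE Nnu.
have dF w : U w -> differentiable F w by exact: Ck_differentiable CF.
have dg y : O y -> differentiable g y by exact: Ck_differentiable Cg.
have OF := UO u Uu.
have dFu := dF u Uu; have dgF := dg _ OF; have gsF := gs _ OF; have ugF := ug _ OF.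
pose nn w := normal_part g F w nu.
have CgF : Ck 1 U (fun w => g (F w)) by apply: Ck_comp UO (CkS CF) Cg.
have CJ : Ck 1 U (fun w => 'J F w) by exact: Ck_jacobian.
have CJT : Ck 1 U (fun w => ('J F w)^T) by exact: Ck_trmx.
have CP : Ck 1 U (fun w => pullback g F w).
  exact: (Ck_mulmx oU (Ck_mulmx oU CJ CgF) CJT).
have Cn : Ck 1 U nn.
  have Ct : Ck 1 U (fun w => tangential g F w nu).
    have Cnug := Ck_mulmx oU (Ck_cst 1 U nu) CgF.
    exact: (Ck_mulmx oU (Ck_mulmx oU Cnug CJT) (Ck_invmx oU uP CP)).
  exact: (CkD oU (Ck_cst 1 U nu) (CkN oU (Ck_mulmx oU Ct CJ))).
have dn : differentiable nn u by exact: Ck_differentiable Cn Uu.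
have nuE : nn u = nu.
  rewrite /nn /normal_part /tangential.
  have -> : nu *m g (F u) *m ('J F u)^T = 0.
    by apply: trmx_inj; rewrite !trmx_mul trmxK gsF mulmxA Nnu trmx0.
  by rewrite !mul0mx subr0.
have inner_row w v j : inner (g (F w)) v (row j ('J F w)) = (v *m g (F w) *m ('J F w)^T) 0 j.
  by rewrite /inner rowE trmx_mul trmx_delta mulmxA -colE mxE.
have nn_normal w j : U w -> inner (g (F w)) (nn w) ('D_(delta_mx 0 j) F w) = 0.
  move=> Uw; rewrite -jacobian_row; last exact: dF.
  rewrite inner_row !mulmxBl /tangential -[_ *m 'J F w *m g (F w) *m _]mulmxA.
  rewrite -[_ *m 'J F w *m _]mulmxA [in X in _ - _ *m X]mulmxA mulmxKV ?subrr ?mxE //.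
  exact: uP.
have Dg v : ('D_v g (F u))^T = 'D_v g (F u) by exact: derive_sym oO OF dgF gs.
pose cov i := cov_deriv g F nn (delta_mx 0 i) u.
have covE i j : - inner (g (F u)) (cov i) ('D_(delta_mx 0 j) F u) = second_form g F u nu i j.
  have dD : differentiable ('D_(delta_mx 0 j) F) u.
    exact: Ck_differentiable (Ck_derive _ CF) Uu.
  have dgc : differentiable (fun w => g (F w)) u by exact: Ck_differentiable CgF Uu.
  have E := derive_inner (delta_mx 0 i) dgc dn dD.
  have E0 : 'D_(delta_mx 0 i) (fun w => inner (g (F w)) (nn w) ('D_(delta_mx 0 j) F w)) u = 0.
    rewrite -[RHS](derive_cst (0 : R) u (delta_mx 0 i)).
    by apply: near_eq_derive; apply: (near_open oU Uu) => w Uw; exact: nn_normal.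
  rewrite E0 nuE (derive_comp _ dFu dgF) in E.
  rewrite /cov /cov_deriv innerDl nuE inner_christoffel // -derivemxE // mxE /koszul.
  exact: (koszul_algebra _ _ _ gsF (Dg _) E).
have -> : lin1_mx (Defs.shape g F u nu) =
    second_form g F u nu *m invmx (pullback g F u).
  apply/row_matrixP => i; rewrite row_mul.
  have -> : row i (lin1_mx (Defs.shape g F u nu)) = Defs.shape g F u nu (delta_mx 0 i).
    by apply/rowP => j; rewrite !mxE.
  rewrite /Defs.shape /tangential -/(cov i) -mulNmx -!mulNmx; congr (_ *m _).
  by apply/rowP => j; rewrite [RHS]mxE -covE -jacobian_row // inner_row !mulNmx mxE.
by [].
Qed.

End Koszul.

(** * Behaviour of second forms under isometries and reparametrizations *)

Section Covariance.
Context {R : realType}.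
Opaque derive jacobian.

Lemma derive_sum2 (W : normedModType R) n (U : set 'rV[R]_n) (F : 'rV[R]_n -> W) u (v w : 'rV[R]_n) :
  open U -> U u -> Ck 2 U F ->
  'D_v ('D_w F) u = \sum_i \sum_j (v 0 i * w 0 j) *: 'D_(delta_mx 0 i) ('D_(delta_mx 0 j) F) u.
Proof.
move=> oU Uu CF.
have CD j : Ck 1 U ('D_(delta_mx 0 j) F) by exact: Ck_derive CF.
have E : 'D_v ('D_w F) u = 'D_v (fun y => \sum_j w 0 j *: 'D_(delta_mx 0 j) F y) u.
  apply: near_eq_derive; apply: (near_open oU Uu) => y Uy.
  by rewrite derive_sum_delta //; exact: Ck_differentiable CF Uy.
have dj j : differentiable ('D_(delta_mx 0 j) F) u by exact: Ck_differentiable (CD j) Uu.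
rewrite {}E exchange_big /=.
transitivity (\sum_j 'D_v (w 0 j *: 'D_(delta_mx 0 j) F) u).
  rewrite -derive_sum; last by move=> j; apply: derivableZ; exact: diff_derivable.
  by congr ('D_v _ u); apply/funext => y; rewrite fct_sumE.
apply: eq_bigr => j _; rewrite deriveZ; last exact: diff_derivable.
rewrite (derive_sum_delta _ (dj j)) scaler_sumr; apply: eq_bigr => i _.
by rewrite scalerA mulrC.
Qed.

Lemma derive2_comp (W : normedModType R) m n (U : set 'rV[R]_m) (O : set 'rV[R]_n)
    (F : 'rV[R]_m -> 'rV[R]_n) (G : 'rV[R]_n -> W) u v w :
  open U -> U u -> (forall w, U w -> O (F w)) -> Ck 2 U F -> open O -> Ck 2 O G ->
  'D_v ('D_w (G \o F)) u =
  'D_('D_v F u) ('D_('D_w F u) G) (F u) + 'D_('D_v ('D_w F) u) G (F u).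
Proof.
move=> oU Uu UO CF oO CG.
have dF y : U y -> differentiable F y by exact: Ck_differentiable CF.
have dG y : O y -> differentiable G y by exact: Ck_differentiable CG.
have OF := UO u Uu; have dFu := dF u Uu; have dGF := dG _ OF.
have dl l : differentiable ('D_(delta_mx 0 l) G) (F u).
  exact: Ck_differentiable (Ck_derive _ CG) OF.
have dlF l : differentiable (fun y => 'D_(delta_mx 0 l) G (F y)) u.
  exact: (differentiable_comp dFu (dl l)).
have dw : differentiable ('D_w F) u by exact: Ck_differentiable (Ck_derive w CF) Uu.
have dwl l : differentiable (fun y => 'D_w F y 0 l) u by exact: differentiable_entry.
pose f l y := 'D_w F y 0 l *: 'D_(delta_mx 0 l) G (F y).
have df l : differentiable (f l) u.
  exact: (differentiable_bilinear (B := ( *:%R : {bilinear R -> W -> W}))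
    (@scale_continuous _ W) (dwl l) (dlF l)).
have Df l : 'D_v (f l) u = 'D_v ('D_w F) u 0 l *: 'D_(delta_mx 0 l) G (F u)
    + 'D_w F u 0 l *: 'D_('D_v F u) ('D_(delta_mx 0 l) G) (F u).
  rewrite (derive_bilinear (B := ( *:%R : {bilinear R -> W -> W}))
    v (@scale_continuous _ W) (dwl l) (dlF l)) /=.
  by rewrite (derive_entry _ _ v dw) (derive_comp v dFu (dl l)).
have E : 'D_v ('D_w (G \o F)) u = 'D_v (\sum_l f l) u.
  apply: near_eq_derive; apply: (near_open oU Uu) => y Uy.
  by rewrite (derive_comp w (dF y Uy) (dG _ (UO y Uy))) (derive_sum_delta _ (dG _ (UO y Uy))) fct_sumE.
have E2 a b : 'D_b ('D_a G) (F u) = \sum_l a 0 l *: 'D_b ('D_(delta_mx 0 l) G) (F u).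
  transitivity ('D_b (\sum_l a 0 l *: 'D_(delta_mx 0 l) G) (F u)).
    apply: near_eq_derive; apply: (near_open oO OF) => y Oy.
    by rewrite (derive_sum_delta _ (dG y Oy)) fct_sumE.
  rewrite derive_sum; last by move=> l; apply: derivableZ; exact: diff_derivable.
  by apply: eq_bigr => l _; rewrite deriveZ //; exact: diff_derivable.
rewrite {}E derive_sum; last by move=> l; exact: diff_derivable.
rewrite E2 (derive_sum_delta _ dGF) -big_split; apply: eq_bigr => l _ /=.
by rewrite Df addrC.
Qed.

Lemma derive_inner_cst (V : normedModType R) n (g : V -> 'M[R]_n) x v (a b : 'rV_n) :
  differentiable g x -> 'D_v (fun y => inner (g y) a b) x = inner ('D_v g x) a b.
Proof.
move=> dg; have dc (c : 'rV[R]_n) : differentiable (cst c : V -> 'rV[R]_n) x by [].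
by rewrite (derive_inner v dg (dc a) (dc b)) !derive_cst inner0l inner0r !addr0.
Qed.

Lemma koszul_pullback_algebra n (G A B C : 'M[R]_n) (x y z xy xz yz yx zx zy : 'rV[R]_n)
    (la lb lc : R) :
  G^T = G -> yx = xy -> zx = xz -> zy = yz ->
  la = inner A y z + inner G xy z + inner G y xz ->
  lb = inner B x z + inner G yx z + inner G x yz ->
  lc = inner C x y + inner G zx y + inner G x zy ->
  2^-1 * (la + lb - lc) =
  2^-1 * (inner A y z + inner B x z - inner C x y) + inner G xy z.
Proof. by move=> Gs -> -> -> -> -> ->; rewrite (inner_sym xz y Gs); field. Qed.

(** The transformation law of the Levi-Civita connection with lowered index. Differentiating the
    pulled-back metric in three directions produces second derivatives of Phi; by their symmetry all
    but one cancel in the alternating sum. *)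
Lemma koszul_pullback n (O : set 'rV[R]_n) (g g' : 'rV[R]_n -> 'M[R]_n)
    (Phi : 'rV[R]_n -> 'rV[R]_n) x a b c :
  open O -> O x -> Ck 2 O Phi -> (forall y, O y -> g y = pullback g' Phi y) ->
  differentiable g x -> differentiable g' (Phi x) -> (g' (Phi x))^T = g' (Phi x) ->
  koszul g x a b c = koszul g' (Phi x) ('D_a Phi x) ('D_b Phi x) ('D_c Phi x)
    + inner (g' (Phi x)) ('D_a ('D_b Phi) x) ('D_c Phi x).
Proof.
move=> oO Ox CP gE dg dg' gs.
have dP y : O y -> differentiable Phi y by exact: Ck_differentiable CP.
have dPx := dP x Ox.
have dgP : differentiable (fun y => g' (Phi y)) x by exact: differentiable_comp.
have dD v : differentiable ('D_v Phi) x by exact: Ck_differentiable (Ck_derive v CP) Ox.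
have D u v w : inner ('D_u g x) v w =
    inner ('D_('D_u Phi x) g' (Phi x)) ('D_v Phi x) ('D_w Phi x)
    + inner (g' (Phi x)) ('D_u ('D_v Phi) x) ('D_w Phi x)
    + inner (g' (Phi x)) ('D_v Phi x) ('D_u ('D_w Phi) x).
  rewrite -(derive_inner_cst u v w dg).
  have E : 'D_u (fun y => inner (g y) v w) x =
     'D_u (fun y => inner (g' (Phi y)) ('D_v Phi y) ('D_w Phi y)) x.
    apply: near_eq_derive; apply: (near_open oO Ox) => y Oy.
    by rewrite gE // /pullback inner_mulmx !derivemxE //; exact: dP.
  by rewrite {}E (derive_inner u dgP (dD v) (dD w)) (derive_comp u dPx dg').
have S u v : 'D_u ('D_v Phi) x = 'D_v ('D_u Phi) x by exact: (schwarz _ _ oO Ox CP).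
exact: (koszul_pullback_algebra gs (S b a) (S c a) (S c b) (D a b c) (D b a c) (D c a b)).
Qed.

Lemma inner_sum2 n (G : 'M[R]_n) I J (r : seq I) (s : seq J) v w (a : I -> 'rV_n) (b : J -> 'rV_n) :
  inner G (\sum_(i <- r) v i *: a i) (\sum_(j <- s) w j *: b j) =
  \sum_(i <- r) \sum_(j <- s) v i * w j * inner G (a i) (b j).
Proof.
rewrite inner_suml; apply: eq_bigr => i _; rewrite innerZl inner_sumr mulr_sumr.
by apply: eq_bigr => j _; rewrite innerZr mulrA.
Qed.

Lemma inner_mx_sum2 n I J (r : seq I) (s : seq J) v w (T : I -> 'M[R]_n) (b : J -> 'rV_n) c :
  inner (\sum_(i <- r) v i *: T i) (\sum_(j <- s) w j *: b j) c =
  \sum_(i <- r) \sum_(j <- s) v i * w j * inner (T i) (b j) c.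
Proof.
rewrite inner_mx_sum; apply: eq_bigr => i _; rewrite inner_mxZ inner_suml mulr_sumr.
by apply: eq_bigr => j _; rewrite innerZl mulrA.
Qed.

Lemma derive_suml (V W : normedModType R) (f : V -> W) x I (r : seq I) v (a : I -> V) :
  differentiable f x ->
  'D_(\sum_(i <- r) v i *: a i) f x = \sum_(i <- r) v i *: 'D_(a i) f x.
Proof.
move=> df; rewrite deriveE // linear_sum; apply: eq_bigr => i _.
by rewrite linearZ /= deriveE.
Qed.

Lemma koszul_sum2_algebra n I J (r : seq I) (s : seq J) v w (T : I -> 'M[R]_n) (S : J -> 'M[R]_n)
    (C : 'M[R]_n) (a : I -> 'rV_n) (b : J -> 'rV_n) c :
  2^-1 * (inner (\sum_(i <- r) v i *: T i) (\sum_(j <- s) w j *: b j) c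
    + inner (\sum_(j <- s) w j *: S j) (\sum_(i <- r) v i *: a i) c
    - inner C (\sum_(i <- r) v i *: a i) (\sum_(j <- s) w j *: b j)) =
  \sum_(i <- r) \sum_(j <- s) v i * w j *
    (2^-1 * (inner (T i) (b j) c + inner (S j) (a i) c - inner C (a i) (b j))).
Proof.
rewrite inner_sum2 !inner_mx_sum2 [X in _ + X - _]exchange_big -sumrN -!big_split mulr_sumr.
apply: eq_bigr => i _; rewrite -sumrN -!big_split mulr_sumr; apply: eq_bigr => j _ /=; ring.
Qed.

Lemma koszul_sum2 n (g : 'rV[R]_n -> 'M[R]_n) x I J (r : seq I) (s : seq J) v w
    (a : I -> 'rV_n) (b : J -> 'rV_n) c :
  differentiable g x ->
  koszul g x (\sum_(i <- r) v i *: a i) (\sum_(j <- s) w j *: b j) c =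
  \sum_(i <- r) \sum_(j <- s) v i * w j * koszul g x (a i) (b j) c.
Proof.
move=> dg; rewrite /koszul (derive_suml _ _ a dg) (derive_suml _ _ b dg).
exact: koszul_sum2_algebra.
Qed.

Lemma second_form_inner m n (U : set 'rV[R]_m) (g : 'rV[R]_n -> 'M[R]_n)
    (F : 'rV[R]_m -> 'rV[R]_n) u nu v w :
  open U -> U u -> Ck 2 U F -> differentiable g (F u) ->
  inner (g (F u)) ('D_v ('D_w F) u) nu + koszul g (F u) ('D_v F u) ('D_w F u) nu =
  inner (second_form g F u nu) v w.
Proof.
move=> oU Uu CF dg.
have dF : differentiable F u by exact: Ck_differentiable CF Uu.
rewrite (derive_sum2 _ _ oU Uu CF) (derive_sum_delta v dF) (derive_sum_delta w dF).
rewrite (koszul_sum2 _ _ _ _ _ _ _ dg) [RHS]innerE inner_suml -big_split; apply: eq_bigr => i _ /=.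
rewrite inner_suml -big_split; apply: eq_bigr => j _ /=.
by rewrite innerZl [second_form _ _ _ _ _ _]mxE; ring.
Qed.

Lemma postcomp_algebra n (G : 'M[R]_n) (d2 X Y fi fi' fj fj' nu nu' : 'rV[R]_n) (gl kl : R)
    (kz : 'rV[R]_n -> 'rV[R]_n -> 'rV[R]_n -> R) :
  d2 = X + Y -> fi' = fi -> fj' = fj -> nu' = nu ->
  kl = kz fi fj nu + inner G X nu -> gl = inner G Y nu ->
  gl + kl = inner G d2 nu' + kz fi' fj' nu'.
Proof. by move=> -> -> -> -> -> ->; rewrite innerDl; ring. Qed.

Lemma precomp_algebra n (G : 'M[R]_n) (d2 X Y Y' fi fi' fj fj' nu : 'rV[R]_n) (s : R)
    (kz : 'rV[R]_n -> 'rV[R]_n -> 'rV[R]_n -> R) :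
  d2 = X + Y -> fi' = fi -> fj' = fj -> inner G X nu + kz fi fj nu = s -> Y = Y' ->
  inner G d2 nu + kz fi' fj' nu = s + inner G Y' nu.
Proof. by move=> -> -> -> <- ->; rewrite innerDl; ring. Qed.

(** The second derivative of Phi in the chain rule is exactly the inhomogeneous term of
    [koszul_pullback]. *)
Lemma second_form_postcomp m n (U : set 'rV[R]_m) (O : set 'rV[R]_n)
    (g g' : 'rV[R]_n -> 'M[R]_n) (F : 'rV[R]_m -> 'rV[R]_n) (Phi : 'rV[R]_n -> 'rV[R]_n) u nu :
  open U -> U u -> (forall w, U w -> O (F w)) -> Ck 2 U F -> open O -> Ck 2 O Phi ->
  (forall y, O y -> g y = pullback g' Phi y) -> differentiable g (F u) ->
  differentiable g' (Phi (F u)) -> (g' (Phi (F u)))^T = g' (Phi (F u)) ->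
  second_form g F u nu = second_form g' (Phi \o F) u (nu *m 'J Phi (F u)).
Proof.
move=> oU Uu UO CF oO CP gE dg dg' gs.
have OF := UO u Uu.
have dF : differentiable F u by exact: Ck_differentiable CF Uu.
have dP : differentiable Phi (F u) by exact: Ck_differentiable CP OF.
apply/matrixP => i j; rewrite [LHS]mxE [RHS]mxE.
pose di := 'D_(delta_mx 0 i) F u; pose dj := 'D_(delta_mx 0 j) F u.
have G : inner (g (F u)) ('D_(delta_mx 0 i) ('D_(delta_mx 0 j) F) u) nu =
  inner (g' (Phi (F u))) ('D_('D_(delta_mx 0 i) ('D_(delta_mx 0 j) F) u) Phi (F u)) ('D_nu Phi (F u)).
  by rewrite gE // /pullback inner_mulmx -(derivemxE _ dP) -(derivemxE nu dP).
exact: (postcomp_algebra (derive2_comp (delta_mx 0 i) (delta_mx 0 j) oU Uu UO CF oO CP)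
  (derive_comp (delta_mx 0 i) dF dP) (derive_comp (delta_mx 0 j) dF dP)
  (esym (derivemxE nu dP)) (koszul_pullback di dj nu oO OF CP gE dg dg' gs) G).
Qed.

(** The last matrix pairs nu with the tangent vectors that come from the second derivatives of k. It
    need not vanish in one factor; the contributions of the two factors of a product cancel when
    (nu1, nu2) is normal. *)
Lemma second_form_precomp m n (V U : set 'rV[R]_m) (g : 'rV[R]_n -> 'M[R]_n)
    (F : 'rV[R]_m -> 'rV[R]_n) (k : 'rV[R]_m -> 'rV[R]_m) y nu :
  open V -> V y -> (forall z, V z -> U (k z)) -> Ck 2 V k -> open U -> Ck 2 U F ->
  differentiable g (F (k y)) ->
  second_form g (F \o k) y nu = 'J k y *m second_form g F (k y) nu *m ('J k y)^T
   + \matrix_(i, j) inner (g (F (k y)))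
       ('D_(delta_mx 0 i) ('D_(delta_mx 0 j) k) y *m 'J F (k y)) nu.
Proof.
move=> oV Vy VU Ck' oU CF dg.
have Uk := VU y Vy.
have dF : differentiable F (k y) by exact: Ck_differentiable CF Uk.
have dk : differentiable k y by exact: Ck_differentiable Ck' Vy.
apply/matrixP => i j; rewrite [LHS]mxE [RHS]mxE inner_mxE (jacobian_row i dk) (jacobian_row j dk).
rewrite [X in _ = _ + X]mxE.
exact: (precomp_algebra (derive2_comp (delta_mx 0 i) (delta_mx 0 j) oV Vy VU Ck' oU CF)
  (derive_comp (delta_mx 0 i) dk dF) (derive_comp (delta_mx 0 j) dk dF)
  (second_form_inner nu _ _ oU Uk CF dg) (derivemxE _ dF)).
Qed.

End Covariance.

(** * Second forms in Riemannian products *)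

Section Minimal_pairs.
Context {R : realType}.
Opaque derive jacobian.

Lemma lsubmx_continuous m n1 n2 : continuous (@lsubmx R m n1 n2).
Proof.
by move=> x; apply: differentiable_continuous; exact: differentiable_lsubmx.
Qed.

Lemma rsubmx_continuous m n1 n2 : continuous (@rsubmx R m n1 n2).
Proof.
by move=> x; apply: differentiable_continuous; exact: differentiable_rsubmx.
Qed.

Lemma inner_block n1 n2 (A : 'M[R]_n1) (B : 'M[R]_n2) v w :
  inner (block_mx A 0 0 B) v w =
  inner A (lsubmx v) (lsubmx w) + inner B (rsubmx v) (rsubmx w).
Proof.
rewrite /inner -{1}(hsubmxK v) -{1}(hsubmxK w) tr_row_mx mul_row_block.
by rewrite !mulmx0 addr0 add0r mul_row_col mxE.
Qed.


Lemma koszul_block_algebra (h la lb lc x1 x2 x3 y1 y2 y3 : R) :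
  la = x1 + y1 -> lb = x2 + y2 -> lc = x3 + y3 ->
  h * (la + lb - lc) = h * (x1 + x2 - x3) + h * (y1 + y2 - y3).
Proof. by move=> -> -> ->; ring. Qed.

Lemma second_form_block_algebra n1 n2 (A : 'M[R]_n1) (B : 'M[R]_n2) d2 dl dr nu (k k1 k2 : R) :
  dl = lsubmx d2 -> dr = rsubmx d2 -> k = k1 + k2 ->
  inner (block_mx A 0 0 B) d2 nu + k =
  inner A dl (lsubmx nu) + k1 + (inner B dr (rsubmx nu) + k2).
Proof. by move=> -> -> ->; rewrite inner_block addrACA. Qed.

Section Block.
Variables (n1 n2 : nat) (g1 : 'rV[R]_n1 -> 'M[R]_n1) (g2 : 'rV[R]_n2 -> 'M[R]_n2).
Let g (y : 'rV[R]_(n1 + n2)) : 'M[R]_(n1 + n2) :=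
  block_mx (g1 (lsubmx y)) 0 0 (g2 (rsubmx y)).

Lemma derive_lsubmx (V : normedModType R) m (F : V -> 'M[R]_(m, n1 + n2)) u v :
  differentiable F u -> 'D_v (fun w => lsubmx (F w)) u = lsubmx ('D_v F u).
Proof. by move=> dF; exact: (derive_linear (L := lsubmx) v (@lsubmx_continuous _ _ _) dF). Qed.

Lemma derive_rsubmx (V : normedModType R) m (F : V -> 'M[R]_(m, n1 + n2)) u v :
  differentiable F u -> 'D_v (fun w => rsubmx (F w)) u = rsubmx ('D_v F u).
Proof. by move=> dF; exact: (derive_linear (L := rsubmx) v (@rsubmx_continuous _ _ _) dF). Qed.

Lemma differentiable_block x : differentiable g1 (lsubmx x) -> differentiable g2 (rsubmx x) ->
  differentiable g x.
Proof.
move=> dg1 dg2; apply: differentiable_mx => i j.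
have d1 : differentiable (fun y : 'rV_(n1 + n2) => g1 (lsubmx y)) x.
  by apply: (@differentiable_comp _ _ _ _ lsubmx) => //; exact: differentiable_lsubmx.
have d2 : differentiable (fun y : 'rV_(n1 + n2) => g2 (rsubmx y)) x.
  by apply: (@differentiable_comp _ _ _ _ rsubmx) => //; exact: differentiable_rsubmx.
rewrite /g /block_mx; under eq_fun do rewrite mxE.
case: (fintype.split i) => i'; under eq_fun do rewrite mxE; case: (fintype.split j) => j'.
- exact: differentiable_entry.
- by under eq_fun do rewrite mxE.
- by under eq_fun do rewrite mxE.
- exact: differentiable_entry.
Qed.

(** Each block of the metric depends on its own coordinates only, so no mixed terms arise. *)
Lemma koszul_block x a b c : differentiable g1 (lsubmx x) -> differentiable g2 (rsubmx x) ->
  koszul g x a b c = koszul g1 (lsubmx x) (lsubmx a) (lsubmx b) (lsubmx c)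
    + koszul g2 (rsubmx x) (rsubmx a) (rsubmx b) (rsubmx c).
Proof.
move=> dg1 dg2; have dg := differentiable_block dg1 dg2.
have dl : differentiable lsubmx x by exact: differentiable_lsubmx.
have dr : differentiable rsubmx x by exact: differentiable_rsubmx.
have d1 : differentiable (fun y : 'rV_(n1 + n2) => g1 (lsubmx y)) x by exact: differentiable_comp.
have d2 : differentiable (fun y : 'rV_(n1 + n2) => g2 (rsubmx y)) x by exact: differentiable_comp.
have D u v w : inner ('D_u g x) v w =
    inner ('D_(lsubmx u) g1 (lsubmx x)) (lsubmx v) (lsubmx w) +
    inner ('D_(rsubmx u) g2 (rsubmx x)) (rsubmx v) (rsubmx w).
  rewrite -(derive_inner_cst u v w dg).
  have -> : (fun y => inner (g y) v w) = (fun y => inner (g1 (lsubmx y)) (lsubmx v) (lsubmx w))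
      + (fun y => inner (g2 (rsubmx y)) (rsubmx v) (rsubmx w)).
    by apply/funext => y; rewrite inner_block.
  rewrite deriveD; last 2 first.
  - by apply: diff_derivable; apply: differentiable_inner.
  - by apply: diff_derivable; apply: differentiable_inner.
  rewrite (derive_inner_cst u _ _ d1) (derive_inner_cst u _ _ d2).
  rewrite (derive_comp u dl dg1) (derive_comp u dr dg2).
  have -> : 'D_u lsubmx x = lsubmx u.
    by rewrite (derive_lsubmx (F := id)) // derive_id.
  have -> : 'D_u rsubmx x = rsubmx u.
    by rewrite (derive_rsubmx (F := id)) // derive_id.
  by [].
rewrite /koszul; exact: (koszul_block_algebra _ (D a b c) (D b a c) (D c a b)).
Qed.

Variables (m : nat) (U : set 'rV[R]_m) (F : 'rV[R]_m -> 'rV[R]_(n1 + n2)).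
Let F1 w := lsubmx (F w).
Let F2 w := rsubmx (F w).

Lemma second_form_block u nu : open U -> U u -> Ck 2 U F ->
  differentiable g1 (F1 u) -> differentiable g2 (F2 u) ->
  second_form g F u nu = second_form g1 F1 u (lsubmx nu) + second_form g2 F2 u (rsubmx nu).
Proof.
move=> oU Uu CF dg1 dg2.
have dF w : U w -> differentiable F w by exact: Ck_differentiable CF.
have dFu := dF u Uu.
have dD v : differentiable ('D_v F) u by exact: Ck_differentiable (Ck_derive v CF) Uu.
have L2 v w : 'D_v ('D_w F1) u = lsubmx ('D_v ('D_w F) u).
  rewrite -(derive_lsubmx v (dD w)); apply: near_eq_derive; apply: (near_open oU Uu) => y Uy.
  exact: derive_lsubmx w (dF y Uy).
have R2 v w : 'D_v ('D_w F2) u = rsubmx ('D_v ('D_w F) u).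
  rewrite -(derive_rsubmx v (dD w)); apply: near_eq_derive; apply: (near_open oU Uu) => y Uy.
  exact: derive_rsubmx w (dF y Uy).
apply/matrixP => i j; rewrite [LHS]mxE [RHS]mxE [X in _ = X + _]mxE [X in _ = _ + X]mxE.
have K : koszul g (F u) ('D_(delta_mx 0 i) F u) ('D_(delta_mx 0 j) F u) nu =
    koszul g1 (F1 u) ('D_(delta_mx 0 i) F1 u) ('D_(delta_mx 0 j) F1 u) (lsubmx nu) +
    koszul g2 (F2 u) ('D_(delta_mx 0 i) F2 u) ('D_(delta_mx 0 j) F2 u) (rsubmx nu).
  apply: etrans (koszul_block _ _ _ dg1 dg2) _.
  rewrite -(derive_lsubmx (delta_mx 0 i) dFu) -(derive_lsubmx (delta_mx 0 j) dFu).
  by rewrite -(derive_rsubmx (delta_mx 0 i) dFu) -(derive_rsubmx (delta_mx 0 j) dFu).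
exact: (second_form_block_algebra _ _ _ (L2 (delta_mx 0 i) (delta_mx 0 j))
  (R2 (delta_mx 0 i) (delta_mx 0 j)) K).
Qed.

Lemma jacobian_lsubmx u : differentiable F u -> 'J F1 u = lsubmx ('J F u).
Proof.
move=> dF; have dF1 : differentiable F1 u.
  by apply: (@differentiable_comp _ _ _ _ F) => //; exact: differentiable_lsubmx.
apply/row_matrixP => i; rewrite jacobian_row // (derive_lsubmx _ dF) -jacobian_row //.
by apply/rowP => j; rewrite !mxE.
Qed.

Lemma jacobian_rsubmx u : differentiable F u -> 'J F2 u = rsubmx ('J F u).
Proof.
move=> dF; have dF2 : differentiable F2 u.
  by apply: (@differentiable_comp _ _ _ _ F) => //; exact: differentiable_rsubmx.
apply/row_matrixP => i; rewrite jacobian_row // (derive_rsubmx _ dF) -jacobian_row //.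
by apply/rowP => j; rewrite !mxE.
Qed.

Lemma pullback_block u : differentiable F u ->
  pullback g F u = pullback g1 F1 u + pullback g2 F2 u.
Proof.
move=> dF; rewrite /pullback jacobian_lsubmx // jacobian_rsubmx // /g -/(F1 u) -/(F2 u).
rewrite -{1 2}(hsubmxK ('J F u)) tr_row_mx mul_row_block.
by rewrite !mulmx0 addr0 add0r mul_row_col.
Qed.

End Block.

End Minimal_pairs.

(** * Minimality in a product and its invariance *)

Section Minimal_pair.
Context {R : realType}.
Opaque derive jacobian.

(* Minimality of the image of u |-> (F1 u, F2 u) in the Riemannian product of g1 and g2,
   the vector (nu1, nu2) being normal to it. *)
Definition minimal_pair m n1 n2 (g1 : 'rV[R]_n1 -> 'M[R]_n1) (F1 : 'rV[R]_m -> 'rV[R]_n1)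
    (g2 : 'rV[R]_n2 -> 'M[R]_n2) (F2 : 'rV[R]_m -> 'rV[R]_n2) (u : 'rV[R]_m) : Prop :=
  forall nu1 nu2,
    'J F1 u *m g1 (F1 u) *m nu1^T + 'J F2 u *m g2 (F2 u) *m nu2^T = 0 ->
    \tr ((second_form g1 F1 u nu1 + second_form g2 F2 u nu2)
         *m invmx (pullback g1 F1 u + pullback g2 F2 u)) = 0.

Lemma pullback_inner m n (g : 'rV[R]_n -> 'M[R]_n) (F : 'rV[R]_m -> 'rV[R]_n) u v w :
  inner (pullback g F u) v w = inner (g (F u)) (v *m 'J F u) (w *m 'J F u).
Proof. exact: inner_mulmx. Qed.

Lemma pullback_comp m n q (g : 'rV[R]_q -> 'M[R]_q) (F : 'rV[R]_m -> 'rV[R]_n)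
    (G : 'rV[R]_n -> 'rV[R]_q) u :
  differentiable F u -> differentiable G (F u) ->
  pullback g (G \o F) u = 'J F u *m pullback g G (F u) *m ('J F u)^T.
Proof. by move=> dF dG; rewrite /pullback jacobian_comp // trmx_mul !mulmxA. Qed.

Lemma pullback_posdef m n (g : 'rV[R]_n -> 'M[R]_n) (F : 'rV[R]_m -> 'rV[R]_n) u :
  (forall v, v != 0 -> 0 < inner (g (F u)) v v) -> \rank ('J F u) = m ->
  forall v, v != 0 -> 0 < inner (pullback g F u) v v.
Proof.
move=> gp rk v v0; rewrite pullback_inner; apply: gp; apply: contra_neq v0 => vJ.
have rf : row_free ('J F u) by rewrite /row_free rk.
by apply: (row_free_inj rf); rewrite /= vJ mul0mx.
Qed.

(** Passes from traces of shape operators to traces of second forms, in which the two factors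
    separate and can be put in new coordinates independently. *)
Lemma minimal_at_pair m n1 n2 (U : set 'rV[R]_m) (O1 : set 'rV[R]_n1) (O2 : set 'rV[R]_n2)
    (g1 : 'rV[R]_n1 -> 'M[R]_n1) (g2 : 'rV[R]_n2 -> 'M[R]_n2)
    (F : 'rV[R]_m -> 'rV[R]_(n1 + n2)) u :
  open U -> U u -> (forall w, U w -> O1 (lsubmx (F w)) /\ O2 (rsubmx (F w))) ->
  Ck 2 U F -> open O1 -> open O2 -> Ck 1 O1 g1 -> Ck 1 O2 g2 ->
  (forall y, O1 y -> (g1 y)^T = g1 y) -> (forall y, O2 y -> (g2 y)^T = g2 y) ->
  (forall y, O1 y -> forall v, v != 0 -> 0 < inner (g1 y) v v) ->
  (forall y, O2 y -> forall v, v != 0 -> 0 < inner (g2 y) v v) ->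
  (forall w, U w -> \rank ('J F w) = m) ->
  minimal_at (fun y => block_mx (g1 (lsubmx y)) 0 0 (g2 (rsubmx y))) F u ->
  minimal_pair g1 (fun w => lsubmx (F w)) g2 (fun w => rsubmx (F w)) u.
Proof.
move=> oU Uu UO CF oO1 oO2 Cg1 Cg2 gs1 gs2 gp1 gp2 rk Hmin nu1 nu2 Hnu.
set g := fun y : 'rV[R]_(n1 + n2) => block_mx (g1 (lsubmx y)) 0 0 (g2 (rsubmx y)).
pose O : set 'rV[R]_(n1 + n2) := [set y | O1 (lsubmx y) /\ O2 (rsubmx y)].
have oO : open O.
  apply: (@openI _ (lsubmx @^-1` O1) (rsubmx @^-1` O2)).
    by have /continuousP := @lsubmx_continuous R 1 n1 n2; apply.
  by have /continuousP := @rsubmx_continuous R 1 n1 n2; apply.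
have Cl : Ck 1 O (lsubmx : 'rV[R]_(n1 + n2) -> _).
  exact: (Ck_linear_comp (L := lsubmx) oO (@lsubmx_continuous R 1 n1 n2) (Ck_id 1 O)).
have Cr : Ck 1 O (rsubmx : 'rV[R]_(n1 + n2) -> _).
  exact: (Ck_linear_comp (L := rsubmx) oO (@rsubmx_continuous R 1 n1 n2) (Ck_id 1 O)).
have C1 : Ck 1 O (fun y => g1 (lsubmx y)).
  by apply: (@Ck_comp _ _ _ _ _ O O1 lsubmx g1) => // y [].
have C2 : Ck 1 O (fun y => g2 (rsubmx y)).
  by apply: (@Ck_comp _ _ _ _ _ O O2 rsubmx g2) => // y [].
have Cg : Ck 1 O g.
  apply: (Ck_mx oO) => i j; rewrite /g /block_mx; under eq_fun do rewrite mxE.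
  case: (fintype.split i) => i'; under eq_fun do rewrite mxE; case: (fintype.split j) => j'.
  - exact: (Ck_entry _ _ oO C1).
  - by under eq_fun do rewrite mxE; exact: Ck_cst.
  - by under eq_fun do rewrite mxE; exact: Ck_cst.
  - exact: (Ck_entry _ _ oO C2).
have gs y : O y -> (g y)^T = g y.
  by move=> [y1 y2]; rewrite /g tr_block_mx !trmx0 gs1 // gs2.
have gp y : O y -> forall v, v != 0 -> 0 < inner (g y) v v.
  move=> [y1 y2] v v0; rewrite /g inner_block.
  have ge n (h : 'M[R]_n) (w : 'rV_n) : (forall v, v != 0 -> 0 < inner h v v) -> 0 <= inner h w w.
    by move=> hp; have [->|/hp/ltW//] := eqVneq w 0; rewrite inner0l.
  have [l0|l0] := eqVneq (lsubmx v) 0; last by rewrite ltr_pwDl ?gp1 ?ge //; exact: gp2.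
  have [r0|r0] := eqVneq (rsubmx v) 0; last by rewrite ltr_wpDl ?gp2 ?ge //; exact: gp1.
  by move: v0; rewrite -(hsubmxK v) l0 r0 row_mx0 eqxx.
have dF w : U w -> differentiable F w by exact: Ck_differentiable CF.
have dFu := dF u Uu.
have [Ou1 Ou2] := UO u Uu.
have dg1 : differentiable g1 (lsubmx (F u)) by exact: Ck_differentiable Cg1 Ou1.
have dg2 : differentiable g2 (rsubmx (F u)) by exact: Ck_differentiable Cg2 Ou2.
pose nu := row_mx nu1 nu2.
have Nnu : is_normal g F u nu.
  apply/is_normalE; rewrite -(hsubmxK ('J F u)) /g mul_row_block !mulmx0 addr0 add0r.
  by rewrite /nu tr_row_mx mul_row_col -jacobian_lsubmx // -jacobian_rsubmx.
have := Hmin nu Nnu.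
rewrite (shape_trace oU Uu UO CF Cg oO gs _ _ Nnu); last 2 first.
- by move=> y Oy; apply: posdef_unitmx; exact: gp.
- move=> w Uw; apply: posdef_unitmx; apply: pullback_posdef; last exact: rk.
  exact/gp/UO.
have E : second_form g F u nu = second_form g1 (fun w => lsubmx (F w)) u nu1
    + second_form g2 (fun w => rsubmx (F w)) u nu2.
  have := second_form_block nu oU Uu CF dg1 dg2.
  by rewrite {2 3}/nu row_mxKl row_mxKr.
have E2 : pullback g F u = pullback g1 (fun w => lsubmx (F w)) u
    + pullback g2 (fun w => rsubmx (F w)) u.
  exact: pullback_block.
by rewrite E E2.
Qed.

Lemma precomp_normal_algebra m n1 n2 (K : 'M[R]_m) (J1 : 'M[R]_(m, n1)) (G1 : 'M[R]_n1)
    (J2 : 'M[R]_(m, n2)) (G2 : 'M[R]_n2) (nu1 : 'rV_n1) (nu2 : 'rV_n2) :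
  K \in unitmx -> K *m J1 *m G1 *m nu1^T + K *m J2 *m G2 *m nu2^T = 0 ->
  J1 *m G1 *m nu1^T + J2 *m G2 *m nu2^T = 0.
Proof.
move=> uK; rewrite -!mulmxA -mulmxDr => /(congr1 (mulmx (invmx K))).
by rewrite mulKmx // mulmx0.
Qed.

Lemma precomp_tangent_algebra m n1 n2 (v : 'rV[R]_m) (J1 : 'M[R]_(m, n1)) (G1 : 'M[R]_n1)
    (J2 : 'M[R]_(m, n2)) (G2 : 'M[R]_n2) (nu1 : 'rV_n1) (nu2 : 'rV_n2) :
  J1 *m G1 *m nu1^T + J2 *m G2 *m nu2^T = 0 ->
  inner G1 (v *m J1) nu1 + inner G2 (v *m J2) nu2 = 0.
Proof.
move=> N; rewrite /inner -!mulmxA; move: N; rewrite -!mulmxA => N.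
by have := congr1 (fun A => (v *m A) 0 0) N; rewrite mulmxDr mulmx0 !mxE.
Qed.

(** The trace of one form relative to another does not depend on the basis. This carries both
    minimality and the energy from one parametrization to another. *)
Lemma mxtrace_congruence n (K S P : 'M[R]_n) :
  K \in unitmx -> P \in unitmx ->
  \tr (K *m S *m K^T *m invmx (K *m P *m K^T)) = \tr (S *m invmx P).
Proof.
move=> uK uP; have uX : K *m P *m K^T \in unitmx by rewrite !unitmx_mul uK uP unitmx_tr.
have E : K^T *m invmx (K *m P *m K^T) = invmx P *m invmx K.
  have := mulmxV uX; rewrite -!mulmxA => /(congr1 (mulmx (invmx K))).
  by rewrite mulKmx // mulmx1 => /(congr1 (mulmx (invmx P))); rewrite mulKmx.
by rewrite -(mulmxA _ K^T) E mxtrace_mulC -mulmxA mulKmx // mxtrace_mulC.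
Qed.

Lemma minimal_pair_precomp m n1 n2 (V U : set 'rV[R]_m)
    (g1 : 'rV[R]_n1 -> 'M[R]_n1) (F1 : 'rV[R]_m -> 'rV[R]_n1)
    (g2 : 'rV[R]_n2 -> 'M[R]_n2) (F2 : 'rV[R]_m -> 'rV[R]_n2) (k : 'rV[R]_m -> 'rV[R]_m) y :
  open V -> V y -> (forall z, V z -> U (k z)) -> Ck 2 V k -> open U -> Ck 2 U F1 -> Ck 2 U F2 ->
  differentiable g1 (F1 (k y)) -> differentiable g2 (F2 (k y)) ->
  'J k y \in unitmx -> pullback g1 F1 (k y) + pullback g2 F2 (k y) \in unitmx ->
  minimal_pair g1 F1 g2 F2 (k y) -> minimal_pair g1 (F1 \o k) g2 (F2 \o k) y.
Proof.
move=> oV Vy VU Ck' oU CF1 CF2 dg1 dg2 uK uP Hmin nu1 nu2.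
have Uk := VU y Vy.
have dF1 : differentiable F1 (k y) by exact: Ck_differentiable CF1 Uk.
have dF2 : differentiable F2 (k y) by exact: Ck_differentiable CF2 Uk.
have dk : differentiable k y by exact: Ck_differentiable Ck' Vy.
rewrite (jacobian_comp dk dF1) (jacobian_comp dk dF2).
rewrite (pullback_comp g1 dk dF1) (pullback_comp g2 dk dF2).
rewrite (second_form_precomp _ oV Vy VU Ck' oU CF1 dg1).
rewrite (second_form_precomp _ oV Vy VU Ck' oU CF2 dg2).
move=> /(precomp_normal_algebra uK) N.
set D1 := \matrix_(i, j) _; set D2 := \matrix_(i, j) _.
(* Together, the second derivatives of k give vectors tangent to the submanifold of the product,
   which are orthogonal to (nu1, nu2). *)
have D0 : D1 + D2 = 0.
  apply/matrixP => i j; rewrite [LHS]mxE [D1 i j]mxE [D2 i j]mxE [RHS]mxE.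
  exact: precomp_tangent_algebra.
rewrite addrACA D0 addr0 -!mulmxDl -!mulmxDr.
by rewrite mxtrace_congruence //; exact: Hmin.
Qed.

Lemma minimal_pair_postcomp m n1 n2 (U : set 'rV[R]_m) (O1 : set 'rV[R]_n1) (O2 : set 'rV[R]_n2)
    (g1 g1' : 'rV[R]_n1 -> 'M[R]_n1) (F1 : 'rV[R]_m -> 'rV[R]_n1) (Phi1 : 'rV[R]_n1 -> 'rV[R]_n1)
    (g2 g2' : 'rV[R]_n2 -> 'M[R]_n2) (F2 : 'rV[R]_m -> 'rV[R]_n2) (Phi2 : 'rV[R]_n2 -> 'rV[R]_n2) u :
  open U -> U u -> (forall w, U w -> O1 (F1 w)) -> (forall w, U w -> O2 (F2 w)) ->
  Ck 2 U F1 -> Ck 2 U F2 -> open O1 -> open O2 -> Ck 2 O1 Phi1 -> Ck 2 O2 Phi2 ->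
  (forall y, O1 y -> g1 y = pullback g1' Phi1 y) ->
  (forall y, O2 y -> g2 y = pullback g2' Phi2 y) ->
  differentiable g1 (F1 u) -> differentiable g2 (F2 u) ->
  differentiable g1' (Phi1 (F1 u)) -> differentiable g2' (Phi2 (F2 u)) ->
  (g1' (Phi1 (F1 u)))^T = g1' (Phi1 (F1 u)) -> (g2' (Phi2 (F2 u)))^T = g2' (Phi2 (F2 u)) ->
  'J Phi1 (F1 u) \in unitmx -> 'J Phi2 (F2 u) \in unitmx ->
  minimal_pair g1 F1 g2 F2 u -> minimal_pair g1' (Phi1 \o F1) g2' (Phi2 \o F2) u.
Proof.
move=> oU Uu UO1 UO2 CF1 CF2 oO1 oO2 CP1 CP2 gE1 gE2 dg1 dg2 dg1' dg2' gs1 gs2 uJ1 uJ2 Hmin.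
move=> nu1 nu2.
have O1u := UO1 u Uu; have O2u := UO2 u Uu.
have dF1 : differentiable F1 u by exact: Ck_differentiable CF1 Uu.
have dF2 : differentiable F2 u by exact: Ck_differentiable CF2 Uu.
have dP1 : differentiable Phi1 (F1 u) by exact: Ck_differentiable CP1 O1u.
have dP2 : differentiable Phi2 (F2 u) by exact: Ck_differentiable CP2 O2u.
(* Since Phi1 and Phi2 have invertible Jacobians, every normal vector of the new pair comes from one
   of the old pair. *)
have [mu1 ->] : exists mu, nu1 = mu *m 'J Phi1 (F1 u).
  by exists (nu1 *m invmx ('J Phi1 (F1 u))); rewrite mulmxKV.
have [mu2 ->] : exists mu, nu2 = mu *m 'J Phi2 (F2 u).
  by exists (nu2 *m invmx ('J Phi2 (F2 u))); rewrite mulmxKV.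
rewrite (jacobian_comp dF1 dP1) (jacobian_comp dF2 dP2).
rewrite (pullback_comp g1' dF1 dP1) (pullback_comp g2' dF2 dP2) -(gE1 _ O1u) -(gE2 _ O2u).
rewrite -(second_form_postcomp _ oU Uu UO1 CF1 oO1 CP1 gE1 dg1 dg1' gs1).
rewrite -(second_form_postcomp _ oU Uu UO2 CF2 oO2 CP2 gE2 dg2 dg2' gs2).
move=> N; apply: Hmin; rewrite (gE1 _ O1u) (gE2 _ O2u) /pullback -[RHS]N.
by rewrite !trmx_mul !mulmxA.
Qed.

End Minimal_pair.

(** * Bochner inequality for minimal graphs *)

Section Bochner_algebra.
Context {R : realType}.

Lemma norm_sum_le (I : finType) (F : I -> R) c :
  (forall i, `|F i| <= c) -> `|\sum_i F i| <= #|I|%:R * c.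
Proof.
move=> Fc; apply: le_trans (ler_norm_sum _ _ _) _.
by rewrite mulr_natl -sumr_const; exact: ler_sum.
Qed.

Lemma norm_sum_ord_le n (F : 'I_n -> R) c :
  (forall i, `|F i| <= c) -> `|\sum_i F i| <= n%:R * c.
Proof. by move=> /norm_sum_le; rewrite card_ord. Qed.

Lemma ler_sum1 (I : finType) (F : I -> R) i : (forall j, 0 <= F j) -> F i <= \sum_j F j.
Proof. by move=> F0; rewrite (bigD1 i) //= lerDl sumr_ge0. Qed.

(** Cholesky decomposition: [L] clears the first row and column and leaves the Schur complement
    [c'], which is positive definite again. The rows of E are an orthonormal basis for h. *)
Lemma posdef_frame n (h : 'M[R]_n) :
  h^T = h -> (forall v, v != 0 -> 0 < inner h v v) -> exists E : 'M[R]_n, E *m h *m E^T = 1%:M.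
Proof.
elim: n h => [|n IH] h hs hp.
  by exists 1%:M; apply/matrixP => -[].
pose a : R := (ulsubmx (h : 'M[R]_(1 + n))) 0 0; pose b := ursubmx (h : 'M[R]_(1 + n)).
pose c := drsubmx (h : 'M[R]_(1 + n)).
have hE : (h : 'M[R]_(1 + n)) = block_mx a%:M b b^T c.
  rewrite -[LHS](@submxK R 1 n 1 n); congr block_mx; first by rewrite [LHS]mx11_scalar.
  by rewrite /b trmx_ursub hs.
have a0 : 0 < a.
  pose o : 'I_(1 + n) := lshift n 0.
  have := hp (delta_mx 0 o) _; rewrite inner_delta /a !mxE => -> //.
  by apply/eqP => /matrixP/(_ 0 o)/eqP; rewrite !mxE !eqxx oner_eq0.
pose v := - a^-1 *: b^T.
pose L : 'M[R]_(1 + n) := block_mx 1%:M 0 v 1%:M.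
pose c' := c - a^-1 *: (b^T *m b).
have LE : L *m block_mx a%:M b b^T c *m L^T = block_mx a%:M 0 0 c'.
  rewrite /L tr_block_mx !mulmx_block !trmx1 !trmx0 !mul1mx !mul0mx !mulmx1 !mulmx0 !addr0 /v.
  rewrite mul_mx_scalar scalerA mulrN mulfV ?gt_eqF // scaleN1r addNr mul0mx add0r.
  rewrite linearZ /= trmxK mul_scalar_mx scalerA mulrN mulfV ?gt_eqF // scaleN1r addNr.
  by rewrite -scalemxAl scaleNr /c' addrC.
have uL : L \in unitmx by rewrite unitmxE det_lblock !det1 mulr1 unitr1.
have cs : c'^T = c'.
  have cT : c^T = c by rewrite /c trmx_drsub hs.
  by rewrite /c' linearB linearZ /= trmx_mul trmxK cT.
have cp w : w != 0 -> 0 < inner c' w w.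
  move=> w0; have H : row_mx 0 w *m L != 0.
    apply: contra_neq w0 => wL; have : row_mx (0 : 'M[R]_1) w = 0 by rewrite -(mulmxK uL (row_mx (0 : 'M[R]_1) w)) wL mul0mx.
    by move/(congr1 rsubmx); rewrite row_mxKr linear0.
  by have := hp _ H; rewrite hE -inner_mulmx LE inner_block row_mxKl row_mxKr inner0l add0r.
have [E' E'P] := IH c' cs cp.
pose D : 'M[R]_(1 + n) := block_mx (Num.sqrt a)^-1%:M 0 0 E'.
have DE : D *m block_mx a%:M 0 0 c' *m D^T = 1%:M.
  rewrite /D tr_block_mx !trmx0 tr_scalar_mx.
  rewrite !mulmx_block !mul0mx !mulmx0 !addr0 !add0r E'P -!scalar_mxM.
  have -> : (Num.sqrt a)^-1 * a * (Num.sqrt a)^-1 = 1; last by rewrite !mul0mx -scalar_mx_block.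
  transitivity ((Num.sqrt a)^-1 * (Num.sqrt a) ^+ 2 * (Num.sqrt a)^-1).
    by rewrite sqr_sqrtr // ltW.
  by field; rewrite gt_eqF // sqrtr_gt0.
exists (D *m L); rewrite hE trmx_mul !mulmxA -(mulmxA D L) -(mulmxA D (L *m _)) LE.
exact: DE.
Qed.

Lemma sum4 p (a b c d : 'I_p -> 'I_p -> R) :
  \sum_i \sum_j (a i j - b i j + c i j + d i j) =
  \sum_i \sum_j a i j - \sum_i \sum_j b i j + \sum_i \sum_j c i j + \sum_i \sum_j d i j.
Proof.
by rewrite -sumrN -!big_split; apply: eq_bigr => i _; rewrite -sumrN -!big_split.
Qed.

(* The intended values are those at the centre of the coordinates: b, f and t for the first
   three derivatives of the map (t being contracted with b), X for the inverse of the metric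
   of its graph. The last two hypotheses are the second derivative test for the energy and
   the differentiated equation of minimal graphs; t is eliminated between them. *)
Lemma bochner_algebra p d (mu c K : R) (hp : (2 <= p)%N) :
  0 < mu -> 0 < c -> 1 <= K ->
  exists2 eps, 0 < eps & forall (G : 'M[R]_d) (X : 'M[R]_p) (b : 'I_p -> 'rV[R]_d)
    (f : 'I_p -> 'I_p -> 'rV[R]_d) (t e1 e2 : 'I_p -> 'I_p -> 'I_p -> R) (e3 : 'I_p -> R)
    (s H : R),
  let P := \matrix_(i, j) inner G (b i) (b j) in
  let T := s * (s ^+ 2 + H ^+ 2) in
  0 <= s <= eps -> s <= 1 -> s ^+ 2 = \sum_k `|b k| ^+ 2 ->
  H ^+ 2 = \sum_i \sum_j `|f i j| ^+ 2 ->
  G^T = G -> (forall v, c * `|v| ^+ 2 <= inner G v v) ->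
  (forall v w, `|inner G v w| <= K * (`|v| * `|w|)) ->
  (forall i j, `|X i j| <= K) -> X = mu *: (1%:M - X *m P) ->
  (forall i j k, `|e1 i j k| <= K * T) -> (forall i j k, `|e2 i j k| <= K * T) ->
  (forall k, `|e3 k| <= K * T) ->
  \sum_i \sum_j X i j * (4 * mu * (i == j)%:R * \tr P
     + mu * \sum_k (2 * t i j k + 2 * inner G (f i k) (f j k) + e1 i j k)) <= 0 ->
  (forall k, \sum_i \sum_j X i j *
     (2 * ((i == k)%:R * P k j + (j == k)%:R * P k i - (i == j)%:R * P k k)
      + t i j k + e2 i j k) + e3 k = 0) ->
  s = 0.
Proof.
move=> mu0 c0 K1.
have K0 : 0 < K by exact: lt_le_trans K1.
pose n : R := p%:R; pose A := n * K * K.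
(* Collects the constants of the bounds [r1S], [r2S], [r3S], [e1S], [e2S] and [e3S], with their
   coefficients in [key]. *)
pose C : R := 8 * mu * (mu * (n * A * (n * K)) + mu * (n * (n * (A * K))))
  + 2 * mu * (mu * (n * (n * (A * (n * K))))) + mu * (n * (n * (K * (n * K))))
  + 2 * mu * (n * (n * (K * (n * K))) + n * K).
have n0 : 0 <= n by [].
have A0 : 0 <= A by rewrite !mulr_ge0 // ltW.
have C0 : 0 <= C.
  by rewrite /C; have := ltW mu0; have := ltW K0 => ? ?; do ![apply: addr_ge0 | apply: mulr_ge0 => //].
(* The left side of [key2] is at least g (s^2 + H^2) and its right side is C s (s^2 + H^2); eps is
   the size of s up to which the error is absorbed. *)
pose g := 2 * mu * mu * c.
have g0 : 0 < g by rewrite !mulr_gt0.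
exists (g / (C + 1)) => [|G X b f t e1 e2 e3 s H P T /andP[s0 sE] s1 sb Hf Gs Gc GK XK XE b1 b2 b3 test eqn].
  by rewrite divr_gt0 // ltr_wpDl.
pose S := \tr P; pose W := \sum_i \sum_j X i j * P i j.
pose Q := \sum_i \sum_j X i j * \sum_k inner G (f i k) (f j k).
have T0 : 0 <= T by rewrite mulr_ge0 // addr_ge0 // sqr_ge0.
have bs k : `|b k| <= s.
  rewrite -(ler_sqr (normr_ge0 _) s0) sb.
  by apply: (ler_sum1 (F := fun k => `|b k| ^+ 2)) => i; exact: sqr_ge0.
have fH i k : `|f i k| ^+ 2 <= H ^+ 2.
  rewrite Hf; apply: le_trans (ler_sum1 (F := fun k => `|f i k| ^+ 2) k _) _ => [j|].
    exact: sqr_ge0.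
  apply: (ler_sum1 (F := fun i => \sum_k `|f i k| ^+ 2)) => j.
  by apply: sumr_ge0 => l _; exact: sqr_ge0.
have PK i j : `|P i j| <= K * s ^+ 2.
  rewrite mxE (le_trans (GK _ _)) // ler_wpM2l ?(ltW K0) // expr2 ler_pM //.
have Psym i j : P j i = P i j by rewrite !mxE inner_sym.
have XPK i j : `|(X *m P) i j| <= A * s ^+ 2.
  rewrite mxE (le_trans (norm_sum_ord_le (c := K * (K * s ^+ 2)) _)) //.
    by move=> k; rewrite normrM ler_pM.
  by rewrite le_eqVlt; apply/orP; left; apply/eqP; rewrite /A /n; ring.
have XPE i j : X i j = mu * ((i == j)%:R - (X *m P) i j) by rewrite {1}XE !mxE.
have Sge : c * s ^+ 2 <= S.
  rewrite sb mulr_sumr; apply: ler_sum => k _; by rewrite mxE.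
have S_le : S <= p%:R * (K * s ^+ 2).
  by apply: le_trans (ler_norm _) (norm_sum_ord_le _) => k; exact: PK.
have S0 : 0 <= S by apply: le_trans Sge; rewrite mulr_ge0 ?(ltW c0) ?sqr_ge0.
have SE : \sum_k P k k = S by [].
rewrite -/S in test; clearbody S.
(* [r1], [r2] and [r3] are the corrections to the trace of X, to W and to Q when X is replaced by
   its leading part mu times the identity; by [XPK] they carry an additional factor s^2. *)
pose r1 := \sum_i (X *m P) i i.
pose r2 := \sum_i \sum_j (X *m P) i j * P i j.
pose r3 := \sum_i \sum_j (X *m P) i j * \sum_k inner G (f i k) (f j k).
pose q := \sum_i \sum_k inner G (f i k) (f i k).
have trE : \sum_i X i i = mu * (n - r1).
  rewrite /r1 /n -[p in p%:R]card_ord -sum1_card natr_sum -sumrB mulr_sumr.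
  by apply: eq_bigr => i _; rewrite XPE eqxx.
have XFE (F : 'I_p -> 'I_p -> R) : \sum_i \sum_j X i j * F i j =
    mu * \sum_i F i i - mu * \sum_i \sum_j (X *m P) i j * F i j.
  rewrite !mulr_sumr -sumrB; apply: eq_bigr => i _.
  rewrite mulr_sumr (bigD1 i) //= [in RHS](bigD1 i) //= XPE eqxx opprD addrA.
  congr (_ + _); first by rewrite /=; ring.
  rewrite -sumrN; apply: eq_bigr => j ji.
  by rewrite XPE eq_sym (negbTE ji) /=; ring.
have WE : W = mu * S - mu * r2 by rewrite -SE; exact: XFE.
have QE : Q = mu * q - mu * r3 by exact: (XFE (fun i j => \sum_k inner G (f i k) (f j k))).
pose E1 := \sum_i \sum_j X i j * \sum_k e1 i j k.
pose E2 := \sum_i \sum_j X i j * \sum_k e2 i j k.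
pose E3 := \sum_k e3 k.
pose tau := \sum_i \sum_j X i j * \sum_k t i j k.
have testE : 4 * mu * S * (\sum_i X i i) + 2 * mu * tau + 2 * mu * Q + mu * E1 <= 0.
  apply: le_trans test; rewrite le_eqVlt; apply/orP; left; apply/eqP.
  rewrite /tau /Q /E1 !mulr_sumr -!big_split; apply: eq_bigr => i _ /=.
  rewrite !mulr_sumr.
  rewrite (_ : 4 * mu * S * X i i = \sum_j X i j * (4 * mu * (i == j)%:R * S)); last first.
    rewrite (bigD1 i) //= eqxx big1 ?addr0; first by rewrite /=; ring.
    by move=> j ji; rewrite eq_sym (negbTE ji) /=; ring.
  rewrite -!big_split; apply: eq_bigr => j _ /=.
  rewrite !big_split /= -!mulr_sumr -/S; ring.
have eqE : 4 * W - 2 * (\sum_i X i i) * S + tau + E2 + E3 = 0.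
  have : \sum_k (\sum_i \sum_j X i j *
     (2 * ((i == k)%:R * P k j + (j == k)%:R * P k i - (i == j)%:R * P k k)
      + t i j k + e2 i j k) + e3 k) = 0.
    by rewrite big1.
  move=> E; rewrite -[RHS]E big_split /=; congr (_ + _).
  have dk (F : 'I_p -> R) i : \sum_k (i == k)%:R * F k = F i.
    rewrite (bigD1 i) //= eqxx mul1r big1 ?addr0 // => k ki.
    by rewrite eq_sym (negbTE ki) mul0r.
  rewrite exchange_big /= /tau /E2 /W.
  transitivity (\sum_i \sum_j (X i j * (4 * P i j) - X i j * ((i == j)%:R * (2 * S))
      + X i j * (\sum_k t i j k) + X i j * \sum_k e2 i j k)); last first.
    apply: eq_bigr => i _; rewrite exchange_big /=; apply: eq_bigr => j _.
    rewrite -mulr_sumr !big_split /= -mulr_sumr big_split /= sumrN -mulr_sumr SE.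
    by rewrite big_split /= dk dk Psym; ring.
  rewrite (sum4 (fun i j => X i j * (4 * P i j)) (fun i j => X i j * ((i == j)%:R * (2 * S)))
    (fun i j => X i j * (\sum_k t i j k)) (fun i j => X i j * \sum_k e2 i j k)).
  have -> : 4 * (\sum_i \sum_j X i j * P i j) = \sum_i \sum_j X i j * (4 * P i j).
    by rewrite mulr_sumr; apply: eq_bigr => i _; rewrite mulr_sumr; apply: eq_bigr => j _; ring.
  suff -> : 2 * (\sum_i X i i) * S = \sum_i \sum_j X i j * ((i == j)%:R * (2 * S)) by [].
  rewrite -mulrA mulr_suml mulr_sumr; apply: eq_bigr => i _.
  transitivity (\sum_j (i == j)%:R * (X i j * (2 * S))).
    by rewrite (dk (fun j => X i j * (2 * S))); ring.
  by apply: eq_bigr => j _; ring.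
have r1b : `|r1| <= n * (A * s ^+ 2) by apply: norm_sum_ord_le => i; exact: XPK.
have r2b : `|r2| <= n * (n * (A * s ^+ 2 * (K * s ^+ 2))).
  apply: norm_sum_ord_le => i; apply: norm_sum_ord_le => j; rewrite normrM.
  exact: ler_pM.
have Gf i j k : `|inner G (f i k) (f j k)| <= K * H ^+ 2.
  apply: le_trans (GK _ _) _; rewrite ler_wpM2l ?(ltW K0) //.
  have := fH i k; have := fH j k; have := sqr_ge0 (`|f i k| - `|f j k|); nra.
have r3b : `|r3| <= n * (n * (A * s ^+ 2 * (n * (K * H ^+ 2)))).
  apply: norm_sum_ord_le => i; apply: norm_sum_ord_le => j; rewrite normrM.
  by apply: ler_pM => //; apply: norm_sum_ord_le => k.
have sum_b (e : 'I_p -> 'I_p -> 'I_p -> R) : (forall i j k, `|e i j k| <= K * T) ->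
    `|\sum_i \sum_j X i j * \sum_k e i j k| <= n * (n * (K * (n * (K * T)))).
  move=> eb; apply: norm_sum_ord_le => i; apply: norm_sum_ord_le => j; rewrite normrM.
  by apply: ler_pM => //; apply: norm_sum_ord_le => k.
have E1b : `|E1| <= n * (n * (K * (n * (K * T)))) by exact: sum_b.
have E2b : `|E2| <= n * (n * (K * (n * (K * T)))) by exact: sum_b.
have E3b : `|E3| <= n * (K * T) by exact: norm_sum_ord_le.
have qge : c * H ^+ 2 <= q.
  rewrite Hf mulr_sumr; apply: ler_sum => i _; rewrite mulr_sumr; apply: ler_sum => k _.
  exact: Gc.
clearbody W Q r1 r2 r3 q E1 E2 E3 tau.
(* The differentiated graph equation determines the third-order sum [tau], which is then eliminated
   from the second derivative test. *)
have tauE : tau = 2 * (mu * (n - r1)) * S - 4 * (mu * S - mu * r2) - E2 - E3.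
  by rewrite -trE -WE; move: eqE; lra.
have key : 8 * mu * (mu * (n - r1) * S - (mu * S - mu * r2)) + 2 * mu * (mu * q - mu * r3)
    <= 2 * mu * (E2 + E3) - mu * E1.
  by move: testE; rewrite tauE QE trE; lra.
have T4 : s ^+ 2 * s ^+ 2 <= T.
  rewrite /T; have := sqr_ge0 s; have := mulr_ge0 s0 (sqr_ge0 H).
  have : s ^+ 2 * s ^+ 2 <= s * s ^+ 2.
    by rewrite ler_wpM2r ?sqr_ge0 // expr2 -[leRHS]mulr1 ler_wpM2l.
  lra.
have TH : s ^+ 2 * H ^+ 2 <= T.
  rewrite /T; have : s ^+ 2 * H ^+ 2 <= s * H ^+ 2.
    by rewrite ler_wpM2r ?sqr_ge0 // expr2 -[leRHS]mulr1 ler_wpM2l.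
  have := mulr_ge0 s0 (sqr_ge0 s); lra.
(* The curvature of the sphere has produced a multiple of (n - 1) S; p >= 2 makes it at least the
   same multiple of S. *)
have Sn : 2 * S <= n * S by rewrite ler_wpM2r // /n ler_nat.
have r1S : r1 * S <= n * A * (n * K) * T.
  apply: (@le_trans _ _ (n * (A * s ^+ 2) * (n * (K * s ^+ 2)))).
    by apply: le_trans (ler_norm _) _; rewrite normrM ler_pM // ger0_norm.
  have : 0 <= n * A * (n * K) by rewrite !mulr_ge0 // ltW.
  move: T4; set u := n * A * (n * K) => T4 u0.
  rewrite (_ : _ * _ = u * (s ^+ 2 * s ^+ 2)); last by rewrite /u; ring.
  exact: ler_wpM2l.
have r2S : - r2 <= n * (n * (A * K)) * T.
  apply: (@le_trans _ _ (n * (n * (A * s ^+ 2 * (K * s ^+ 2))))).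
    by apply: le_trans (ler_norm _) _; rewrite normrN.
  have : 0 <= n * (n * (A * K)) by rewrite !mulr_ge0 // ltW.
  move: T4; set u := n * (n * (A * K)) => T4 u0.
  rewrite (_ : n * (n * (A * s ^+ 2 * (K * s ^+ 2))) = u * (s ^+ 2 * s ^+ 2)); last by rewrite /u; ring.
  exact: ler_wpM2l.
have r3S : r3 <= n * (n * (A * (n * K))) * T.
  apply: le_trans (le_trans (ler_norm _) r3b) _.
  have : 0 <= n * (n * (A * (n * K))) by rewrite !mulr_ge0 // ltW.
  move: TH; set u := n * (n * (A * (n * K))) => TH u0.
  rewrite (_ : n * (n * (A * s ^+ 2 * (n * (K * H ^+ 2)))) = u * (s ^+ 2 * H ^+ 2)); last by rewrite /u; ring.
  exact: ler_wpM2l.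
have e1S : - E1 <= n * (n * (K * (n * K))) * T.
  apply: (le_trans (ler_norm _)); rewrite normrN (le_trans E1b) //.
  by rewrite le_eqVlt; apply/orP; left; apply/eqP; ring.
have e2S : E2 <= n * (n * (K * (n * K))) * T.
  apply: le_trans (le_trans (ler_norm _) E2b) _.
  by rewrite le_eqVlt; apply/orP; left; apply/eqP; ring.
have e3S : E3 <= n * K * T by rewrite -mulrA; exact: le_trans (ler_norm _) E3b.
have key2 : 8 * mu * (mu * S) + 2 * mu * (mu * q) <= C * T.
  have m8 : 0 <= 8 * mu * mu by rewrite !mulr_ge0 // ltW.
  have m2 : 0 <= 2 * mu * mu by rewrite !mulr_ge0 // ltW.
  have m1 : 0 <= 2 * mu by rewrite mulr_ge0 // ltW.
  have := ler_wpM2l m8 r1S; have := ler_wpM2l m8 r2S; have := ler_wpM2l m2 r3S.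
  have := ler_wpM2l (ltW mu0) e1S; have := ler_wpM2l m1 e2S; have := ler_wpM2l m1 e3S.
  have := ler_wpM2l m8 Sn; move: key; rewrite /C; clear.
  move: (n * (n * (K * (n * K)))) (n * (n * (A * (n * K)))) (n * (n * (A * K))) (n * A * (n * K)).
  move=> c1 c2 c3 c4; lra.
have Y0 : 0 <= s ^+ 2 + H ^+ 2 by rewrite addr_ge0 // sqr_ge0.
have gC : 0 < g - C * s.
  have C1 : 0 < C + 1 by rewrite ltr_wpDl.
  have : s * (C + 1) <= g by rewrite -ler_pdivlMr.
  have [->|sn0] := eqVneq s 0; first by rewrite mulr0 subr0.
  have : 0 < s by rewrite lt_neqAle eq_sym sn0.
  lra.
have gY : (g - C * s) * (s ^+ 2 + H ^+ 2) <= 0.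
  have m2 : 0 <= 2 * mu * mu by rewrite !mulr_ge0 // ltW.
  have S2 := ler_wpM2l m2 Sge; have q2 := ler_wpM2l m2 qge.
  have S6 : 0 <= mu * mu * S by rewrite !mulr_ge0 // ltW.
  by move: key2; rewrite /T /g; lra.
have Y : s ^+ 2 + H ^+ 2 <= 0 by rewrite -(pmulr_rle0 _ gC).
by apply/eqP; rewrite -sqrf_eq0 eq_le sqr_ge0 andbT; have := sqr_ge0 H; lra.
Qed.

End Bochner_algebra.

Section Real_derivatives.
Context {R : realType} {V : normedModType R}.
Implicit Types (f g : V -> R) (x v : V).

Lemma derive_add_fun f g x v : differentiable f x -> differentiable g x ->
  'D_v (fun y => f y + g y) x = 'D_v f x + 'D_v g x.
Proof. by move=> df dg; exact: (@deriveD _ _ _ f g x v (diff_derivable df) (diff_derivable dg)). Qed.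

Lemma derive_sub_fun f g x v : differentiable f x -> differentiable g x ->
  'D_v (fun y => f y - g y) x = 'D_v f x - 'D_v g x.
Proof. by move=> df dg; exact: (@deriveB _ _ _ f g x v (diff_derivable df) (diff_derivable dg)). Qed.

Lemma derive_mul_fun f g x v : differentiable f x -> differentiable g x ->
  'D_v (fun y => f y * g y) x = 'D_v f x * g x + f x * 'D_v g x.
Proof.
move=> df dg.
rewrite (@deriveM _ _ f g x v (diff_derivable df) (diff_derivable dg)).
by rewrite addrC /= mulrC.
Qed.

Lemma derive_cmul_fun (a : R) f x v : differentiable f x ->
  'D_v (fun y => a * f y) x = a * 'D_v f x.
Proof.
move=> df; rewrite (@derive_mul_fun (cst a)) //.
by rewrite derive_cst mul0r add0r.
Qed.

Lemma derive_bigsum_fun n (f : 'I_n -> V -> R) x v : (forall i, differentiable (f i) x) ->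
  'D_v (fun y => \sum_i f i y) x = \sum_i 'D_v (f i) x.
Proof.
move=> df; rewrite (_ : (fun _ => _) = \sum_i f i); last first.
  by apply/funext => y; rewrite fct_sumE.
by rewrite derive_sum // => i; exact: diff_derivable.
Qed.

Lemma differentiable_bigsum n (f : 'I_n -> V -> R) x : (forall i, differentiable (f i) x) ->
  differentiable (fun y => \sum_i f i y) x.
Proof.
move=> df; rewrite (_ : (fun _ => _) = \sum_i f i); first exact: differentiable_sum.
by apply/funext => y; rewrite fct_sumE.
Qed.

Lemma derive_inv_fun f x v : differentiable f x -> f x != 0 ->
  'D_v (fun y => (f y)^-1) x = - (f x) ^- 2 * 'D_v f x.
Proof. by move=> df fx; rewrite deriveV //; exact: diff_derivable. Qed.

End Real_derivatives.

(** * The round metric as a conformal factor *)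

Section Conformal_factor.
Context {R : realType} {p : nat}.
Variable r : R.
Hypothesis r0 : 0 < r.
Opaque derive jacobian.
Implicit Types y v : 'rV[R]_p.

Definition dot y v : R := (y *m v^T) 0 0.

Lemma dotE y v : dot y v = \sum_i y 0 i * v 0 i.
Proof. by rewrite /dot mxE; apply: eq_bigr => i _; rewrite mxE. Qed.

Lemma dotC y v : dot y v = dot v y.
Proof. by rewrite !dotE; apply: eq_bigr => i _; rewrite mulrC. Qed.

Lemma dot_delta y i : dot y (delta_mx 0 i) = y 0 i.
Proof. by rewrite /dot trmx_delta -colE mxE. Qed.

(* The round metric of radius r is conformal_factor times the Euclidean one in
   stereographic coordinates. *)
Definition conformal_factor y : R := 4 * r ^+ 2 * (1 + norm2 y) ^- 2.
Definition conformal_inv y : R := (4 * r ^+ 2)^-1 * (1 + norm2 y) ^+ 2.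

Lemma norm2D1_gt0 y : 0 < 1 + norm2 y.
Proof. by rewrite ltr_wpDr // norm2_ge0. Qed.

Lemma norm2_0 : norm2 (0 : 'rV[R]_p) = 0.
Proof. by rewrite /norm2 mul0mx mxE. Qed.

Lemma conformal_factor_gt0 y : 0 < conformal_factor y.
Proof. by rewrite /conformal_factor divr_gt0 ?mulr_gt0 ?exprn_gt0 // norm2D1_gt0. Qed.

Lemma conformal_factorK y : conformal_inv y * conformal_factor y = 1.
Proof.
rewrite /conformal_inv /conformal_factor; field.
by rewrite !gt_eqF ?norm2D1_gt0.
Qed.

Lemma Ck_norm2 k (U : set 'rV[R]_p) : open U -> Ck k U (norm2 (n := p) : 'rV[R]_p -> R).
Proof.
move=> oU; apply: (Ck_entry 0 0 oU); apply: (Ck_mulmx oU); first exact: Ck_id.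
by apply: (Ck_trmx oU); exact: Ck_id.
Qed.

Lemma derive_norm2 y v : 'D_v (norm2 (n := p) : 'rV[R]_p -> R) y = 2 * dot y v.
Proof.
have di : differentiable (id : 'rV[R]_p -> _) y by [].
have -> : (norm2 (n := p) : 'rV[R]_p -> R) = fun y => inner (1%:M : 'M[R]_p) y y.
  by apply/funext => z; rewrite /inner mulmx1.
rewrite (derive_inner (g := cst 1%:M) v (differentiable_cst _ _) di di) derive_cst inner_mx0 derive_id.
by rewrite add0r (inner_sym v) ?trmx1 // /inner mulmx1 -/(dot y v); ring.
Qed.

Lemma Ck_conformal_factor k (U : set 'rV[R]_p) : open U -> Ck k U conformal_factor.
Proof.
move=> oU; have C1 : Ck k U (fun y : 'rV[R]_p => 1 + norm2 y).
  by apply: (CkD oU); [exact: Ck_cst|exact: Ck_norm2].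
apply: (CkM oU); first exact: Ck_cst.
apply: (CkV oU); first by move=> y _; rewrite expf_neq0 // gt_eqF // norm2D1_gt0.
exact: (CkM oU C1 C1).
Qed.

Lemma Ck_conformal_inv k (U : set 'rV[R]_p) : open U -> Ck k U conformal_inv.
Proof.
move=> oU; have C1 : Ck k U (fun y : 'rV[R]_p => 1 + norm2 y).
  by apply: (CkD oU); [exact: Ck_cst|exact: Ck_norm2].
by apply: (CkM oU (Ck_cst _ _ _)); exact: (CkM oU C1 C1).
Qed.

Lemma differentiable_norm2D1 y : differentiable (fun y : 'rV[R]_p => 1 + norm2 y) y.
Proof.
apply: (Ck_differentiable (k := 0) (U := setT)) => //.
by apply: (CkD openT); [exact: Ck_cst|exact: (Ck_norm2 1 openT)].
Qed.

Lemma derive_norm2D1 y v : 'D_v (fun y : 'rV[R]_p => 1 + norm2 y) y = 2 * dot y v.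
Proof.
have dn : differentiable (norm2 (n := p) : 'rV[R]_p -> R) y.
  by apply: (Ck_differentiable (k := 0) (U := setT)) => //; exact: (Ck_norm2 1 openT).
by rewrite (derive_add_fun (f := cst 1) v (differentiable_cst _ _) dn) derive_cst derive_norm2 add0r.
Qed.

(** The derivative of the conformal factor with respect to |y|^2 / 2. The differential is this times
    [dot y v], hence zero at the centre. *)
Definition conformal_slope y : R := - 16 * r ^+ 2 * (1 + norm2 y) ^- 3.

Lemma derive_conformal_factor y v :
  'D_v conformal_factor y = conformal_slope y * dot y v.
Proof.
have dn := differentiable_norm2D1 y.
have n0 : 1 + norm2 y != 0 by rewrite gt_eqF // norm2D1_gt0.
have d2 : differentiable (fun y : 'rV[R]_p => (1 + norm2 y) ^+ 2) y.
  exact: (differentiableM dn dn).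
have D2 : 'D_v (fun y : 'rV[R]_p => (1 + norm2 y) ^+ 2) y = 4 * (1 + norm2 y) * dot y v.
  by rewrite (derive_mul_fun v dn dn) derive_norm2D1; ring.
have n2 : (1 + norm2 y) ^+ 2 != 0 by rewrite expf_neq0.
have di : differentiable (fun y : 'rV[R]_p => (1 + norm2 y) ^- 2) y by exact: differentiableV.
rewrite (derive_cmul_fun _ v di) (derive_inv_fun v d2 n2) D2 /conformal_slope.
by field.
Qed.

Lemma differentiable_conformal_slope y : differentiable conformal_slope y.
Proof.
have oU := @openT 'rV[R]_p.
have C1 : Ck 1 setT (fun y : 'rV[R]_p => 1 + norm2 y).
  by apply: (CkD oU); [exact: Ck_cst|exact: Ck_norm2].
have C3 : Ck 1 setT (fun y : 'rV[R]_p => (1 + norm2 y) ^- 3).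
  apply: (CkV oU); first by move=> z _; rewrite expf_neq0 // gt_eqF // norm2D1_gt0.
  exact: (CkM oU C1 (CkM oU C1 C1)).
exact: (Ck_differentiable (CkM oU (Ck_cst 1 setT (- 16 * r ^+ 2)) C3) I).
Qed.

Lemma derive_conformal_inv y v :
  'D_v conformal_inv y = (4 * r ^+ 2)^-1 * (4 * (1 + norm2 y) * dot y v).
Proof.
have dn := differentiable_norm2D1 y.
rewrite (derive_cmul_fun _ v (differentiableM dn dn)) (derive_mul_fun v dn dn).
by rewrite derive_norm2D1; congr (_ * _); ring.
Qed.

(** In these coordinates the round metric is flat to first order at the centre, so its curvature
    shows only in second derivatives such as this one, which gives the term with [4 * mu] in
    [bochner_algebra]. *)
Lemma derive2_conformal_inv v w :
  'D_v ('D_w conformal_inv) 0 = (4 * r ^+ 2)^-1 * (4 * dot v w).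
Proof.
have dd : differentiable (fun y => dot y w) 0.
  apply: differentiable_entry; apply: differentiable_mulmx => //.
have Dd : 'D_v (fun y => dot y w) 0 = dot v w.
  rewrite derive_entry; last exact: differentiable_mulmx.
  by rewrite derive_mulmx // derive_id derive_cst mulmx0 addr0.
have -> : 'D_w conformal_inv = fun y => (4 * r ^+ 2)^-1 * 4 * ((1 + norm2 y) * dot y w).
  by apply/funext => y; rewrite derive_conformal_inv -!mulrA.
have dn := differentiable_norm2D1 0.
rewrite (derive_cmul_fun _ v (differentiableM dn dd)) (derive_mul_fun v dn dd) Dd.
have d0 : dot 0 v = 0 by rewrite /dot mul0mx mxE.
by rewrite derive_norm2D1 norm2_0 d0; ring.
Qed.

End Conformal_factor.

(** * The equation of minimal graphs over the sphere *)

Lemma slope_algebra (R : realType) p (y n m : 'I_p -> R) (c e a : R) i j :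
  (forall l, m l = - c * n l) ->
  y i * (- (2^-1 * e) * c * n j) + y j * (- (2^-1 * e) * c * n i)
    - a * (\sum_l y l * (- (2^-1 * e) * c * n l)) =
  2^-1 * e * (y i * m j + y j * m i - a * (\sum_l y l * m l)).
Proof.
move=> mE; rewrite !mE.
have -> : \sum_l y l * (- (2^-1 * e) * c * n l) = 2^-1 * e * \sum_l y l * m l.
  by rewrite mulr_sumr; apply: eq_bigr => l _; rewrite mE; ring.
ring.
Qed.

Section Minimal_graph.
Context {R : realType} {p d : nat}.
Variables (r : R) (r0 : 0 < r).
Variables (O : set 'rV[R]_d) (g : 'rV[R]_d -> 'M[R]_d).
Hypotheses (oO : open O) (Cg : Ck 2 O g) (gs : forall y, O y -> (g y)^T = g y).
Hypothesis gp : forall y, O y -> forall v, v != 0 -> 0 < inner (g y) v v.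
Variables (V : set 'rV[R]_p) (phi : 'rV[R]_p -> 'rV[R]_d).
Hypotheses (oV : open V) (Cphi : Ck 3 V phi) (VO : forall y, V y -> O (phi y)).
Opaque derive jacobian.

Let beta i y := 'D_(delta_mx 0 i) phi y.
Let gam y := g (phi y).
Let h y : 'M[R]_p := (conformal_factor r y)%:M + pullback g phi y.
Let X y := invmx (h y).

(** The entries of [second_form g phi y nu], with the derivatives of g along d phi replaced by those
    of g composed with phi, so as to be differentiated in y for fixed nu. *)
Definition graph_second_form (nu : 'rV[R]_d) i j y : R :=
  inner (gam y) ('D_(delta_mx 0 i) (beta j) y) nu
  + 2^-1 * (inner ('D_(delta_mx 0 i) gam y) (beta j y) nu
      + inner ('D_(delta_mx 0 j) gam y) (beta i y) nu
      - inner ('D_nu g (phi y)) (beta i y) (beta j y)).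

(** Half the slope of the conformal factor times the l-th sphere component of the normal vector
    whose component in X_2 is nu; that component is [nu1] in the proof of [graph_equation]. *)
Definition graph_slope (nu : 'rV[R]_d) l y : R :=
  - (2^-1 * conformal_slope r y) * conformal_inv r y * inner (gam y) nu (beta l y).

Let dphi y : V y -> differentiable phi y.
Proof. by move=> Vy; exact: Ck_differentiable Cphi Vy. Qed.
Let dg y : O y -> differentiable g y.
Proof. by move=> Oy; exact: Ck_differentiable Cg Oy. Qed.

Lemma pullback_entry y i j : V y -> pullback g phi y i j = inner (gam y) (beta i y) (beta j y).
Proof.
by move=> Vy; rewrite inner_mxE (jacobian_row i (dphi Vy)) (jacobian_row j (dphi Vy)).
Qed.

Lemma pullback_sym y : V y -> (pullback g phi y)^T = pullback g phi y.
Proof. by move=> Vy; rewrite /pullback !trmx_mul trmxK gs ?mulmxA //; exact: VO. Qed.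

Lemma graph_metric_sym y : V y -> (h y)^T = h y.
Proof. by move=> Vy; rewrite /h linearD /= tr_scalar_mx pullback_sym. Qed.

(** The second factor only enlarges the metric. This bounds the inverse metric independently of
    phi. *)
Lemma graph_metric_ge y v : V y -> conformal_factor r y * dot v v <= inner (h y) v v.
Proof.
move=> Vy; rewrite /h inner_mxD {1}/inner mul_mx_scalar -scalemxAl mxE -/(dot v v) lerDl.
rewrite pullback_inner; have [->|v0] := eqVneq (v *m 'J phi y) 0; first by rewrite inner0l.
by apply: ltW; apply: gp => //; exact: VO.
Qed.

Lemma dot_gt0 n (v : 'rV[R]_n) : v != 0 -> 0 < dot v v.
Proof.
move=> v0; rewrite lt_neqAle norm2_ge0 andbT eq_sym.
apply: contra v0 => /eqP; rewrite dotE => /psumr_eq0P H.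
apply/eqP/rowP => i; rewrite mxE; apply/eqP; rewrite -sqrf_eq0 expr2.
by rewrite H // => j _; rewrite -expr2 sqr_ge0.
Qed.

Lemma graph_metric_pos y v : V y -> v != 0 -> 0 < inner (h y) v v.
Proof.
move=> Vy v0; apply: lt_le_trans (graph_metric_ge _ Vy).
by rewrite mulr_gt0 ?conformal_factor_gt0 // dot_gt0.
Qed.

Lemma graph_metric_unit y : V y -> h y \in unitmx.
Proof. by move=> Vy; apply: posdef_unitmx => v; exact: graph_metric_pos. Qed.

Lemma graph_metric_inv_sym y i j : V y -> X y i j = X y j i.
Proof. by move=> Vy; rewrite /X -{1}(graph_metric_sym Vy) -trmx_inv mxE. Qed.

Lemma graph_second_formE y nu i j : V y ->
  second_form g phi y nu i j = graph_second_form nu i j y.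
Proof.
move=> Vy; rewrite mxE /graph_second_form /koszul.
have H i' : 'D_(beta i' y) g (phi y) = 'D_(delta_mx 0 i') gam y.
  by rewrite (derive_comp (g := g) _ (dphi Vy) (dg (VO Vy))).
by rewrite -(H i) -(H j).
Qed.

(** The identity has no second derivatives, so what is left are the Christoffel symbols of a
    conformally flat metric, paired with nu. *)
Lemma second_form_conformal y nu i j :
  second_form (fun z => (conformal_factor r z)%:M) (id : 'rV[R]_p -> _) y nu i j =
  2^-1 * conformal_slope r y * (y 0 i * nu 0 j + y 0 j * nu 0 i - (i == j)%:R * dot y nu).
Proof.
have dc : differentiable (conformal_factor r : 'rV[R]_p -> R) y.
  exact: (Ck_differentiable (Ck_conformal_factor r 1 openT) I).
have dM : differentiable (fun z : 'rV[R]_p => (conformal_factor r z)%:M : 'M[R]_p) y.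
  by apply: differentiable_mx => i' j'; under eq_fun do rewrite mxE; case: (i' == j');
     under eq_fun do rewrite ?mulr1n ?mulr0n.
have DM v a b : inner ('D_v (fun z : 'rV[R]_p => (conformal_factor r z)%:M : 'M[R]_p) y) a b =
    conformal_slope r y * dot y v * dot a b.
  rewrite -(derive_inner_cst v a b dM).
  have -> : (fun z : 'rV[R]_p => inner ((conformal_factor r z)%:M : 'M[R]_p) a b) =
      fun z => dot a b * conformal_factor r z.
    by apply/funext => z; rewrite /inner mul_mx_scalar -scalemxAl mxE mulrC.
  by rewrite (derive_cmul_fun _ _ dc) derive_conformal_factor // mulrC.
have I v : 'D_v (id : 'rV[R]_p -> _) y = v by exact: derive_id.
have E0 : 'D_(delta_mx 0 i) ('D_(delta_mx 0 j) (id : 'rV[R]_p -> _)) y = 0.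
  rewrite (_ : 'D_(delta_mx 0 j) _ = cst (delta_mx 0 j)) ?derive_cst //.
  by apply/funext => z; exact: derive_id.
rewrite mxE /koszul.
transitivity (0 + 2^-1 * (conformal_slope r y * dot y (delta_mx 0 i) * dot (delta_mx 0 j) nu
  + conformal_slope r y * dot y (delta_mx 0 j) * dot (delta_mx 0 i) nu
  - conformal_slope r y * dot y nu * dot (delta_mx 0 i) (delta_mx 0 j))).
  congr (_ + _ * (_ + _ - _)).
  - by rewrite E0 inner0l.
  - by rewrite (I (delta_mx 0 i)) (I (delta_mx 0 j)); exact: DM.
  - by rewrite (I (delta_mx 0 i)) (I (delta_mx 0 j)); exact: DM.
  - by rewrite (I (delta_mx 0 i)) (I (delta_mx 0 j)); exact: DM.
rewrite [dot (delta_mx 0 j) nu]dotC [dot (delta_mx 0 i) nu]dotC !dot_delta mxE eqxx /=.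
by rewrite [j == i]eq_sym; ring.
Qed.

(** Every nu extends to a normal vector (nu1, nu), nu1 being minus the adjoint of d phi applied to
    nu. The sphere terms carry a factor y: they vanish at the centre, but not after one
    differentiation. *)
Lemma graph_equation y nu : V y ->
  minimal_pair (fun z => (conformal_factor r z)%:M) (id : 'rV[R]_p -> _) g phi y ->
  \sum_i \sum_j (y 0 i * graph_slope nu j y + y 0 j * graph_slope nu i y
      - (i == j)%:R * (\sum_l y 0 l * graph_slope nu l y)
      + graph_second_form nu i j y) * X y i j = 0.
Proof.
move=> Vy Hmin.
pose nu1 : 'rV[R]_p := - conformal_inv r y *: (nu *m g (phi y) *m ('J phi y)^T).
have J1 : 'J (id : 'rV[R]_p -> _) y = 1%:M.
  by apply/row_matrixP => i; rewrite jacobian_row // derive_id row1.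
have nu1E j : nu1 0 j = - conformal_inv r y * inner (gam y) nu (beta j y).
  by rewrite mxE /beta -(jacobian_row j (dphi Vy)) /inner rowE trmx_mul trmx_delta mulmxA -colE [in RHS]mxE.
have N : 'J (id : 'rV[R]_p -> _) y *m (conformal_factor r y)%:M *m nu1^T
    + 'J phi y *m g (phi y) *m nu^T = 0.
  rewrite J1 mul1mx mul_scalar_mx /nu1 linearZ /= !trmx_mul trmxK gs; last exact: VO.
  by rewrite scalerA mulrN mulrC conformal_factorK // scaleN1r mulmxA addNr.
have := Hmin nu1 nu N.
have P1 : pullback (fun z => (conformal_factor r z)%:M) (id : 'rV[R]_p -> _) y = (conformal_factor r y)%:M.
  by rewrite /pullback J1 mul1mx trmx1 mulmx1.
rewrite P1 -/(h y) -/(X y) => E.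
rewrite -[RHS]E /mxtrace; apply: eq_bigr => i _; rewrite [RHS]mxE; apply: eq_bigr => j _.
rewrite (graph_metric_inv_sym j i Vy); set A := second_form _ _ _ nu1; set B := second_form _ _ _ nu.
have -> : (A + B) i j = A i j + B i j by rewrite mxE.
rewrite /A second_form_conformal /B (graph_second_formE nu i j Vy).
congr ((_ + _) * _); rewrite dotE.
exact: (slope_algebra _ _ _ _ _ nu1E).
Qed.

End Minimal_graph.

(** * The graph equation differentiated at the centre *)

Lemma derive_inner_cstr (R : realType) (V : normedModType R) n (g : V -> 'M[R]_n)
    (a : V -> 'rV_n) (w : 'rV_n) x v :
  differentiable g x -> differentiable a x ->
  'D_v (fun y => inner (g y) (a y) w) x = inner ('D_v g x) (a x) w + inner (g x) ('D_v a x) w.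
Proof.
move=> dg da; rewrite (derive_inner (b := cst w) v dg da (differentiable_cst _ _)).
by rewrite derive_cst inner0r addr0.
Qed.

Lemma derive_second_form_expr (R : realType) (V : normedModType R) n
    (g gi gj N : V -> 'M[R]_n) (a bi bj : V -> 'rV_n) (w : 'rV_n) x v :
  differentiable g x -> differentiable gi x -> differentiable gj x -> differentiable N x ->
  differentiable a x -> differentiable bi x -> differentiable bj x ->
  'D_v (fun y => inner (g y) (a y) w + 2^-1 * (inner (gi y) (bj y) w + inner (gj y) (bi y) w
    - inner (N y) (bi y) (bj y))) x =
  inner (g x) ('D_v a x) w + inner ('D_v g x) (a x) w
  + 2^-1 * (inner ('D_v gi x) (bj x) w + inner (gi x) ('D_v bj x) w
    + (inner ('D_v gj x) (bi x) w + inner (gj x) ('D_v bi x) w)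
    - (inner ('D_v N x) (bi x) (bj x)
       + inner (N x) ('D_v bi x) (bj x) + inner (N x) (bi x) ('D_v bj x))).
Proof.
move=> dg dgi dgj dN da dbi dbj.
have dw : differentiable (cst w : V -> 'rV_n) x by [].
have d1 := differentiable_inner dg da dw.
have d2 := differentiable_inner dgi dbj dw.
have d3 := differentiable_inner dgj dbi dw.
have d4 := differentiable_inner dN dbi dbj.
have dc := differentiableB (differentiableD d2 d3) d4.
have d5 := differentiableM (differentiable_cst (2^-1 : R) x) dc.
apply: etrans (derive_add_fun v d1 d5) _; congr (_ + _).
  by rewrite (derive_inner_cstr w v dg da) addrC.
apply: etrans (derive_cmul_fun _ v dc) _; congr (_ * _).
apply: etrans (derive_sub_fun v (differentiableD d2 d3) d4) _.
congr (_ - _); last exact: (derive_inner v dN dbi dbj).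
apply: etrans (derive_add_fun v d2 d3) _.
by rewrite (derive_inner_cstr w v dgi dbj) (derive_inner_cstr w v dgj dbi).
Qed.

Lemma mulr2_combination (R : realType) (a b c x y z : R) :
  a * (2 * x) + b * (2 * y) - c * (2 * z) = 2 * (a * x + b * y - c * z).
Proof. ring. Qed.

Section Bochner_derivatives.
Context {R : realType} {p d : nat}.
Variables (r : R) (r0 : 0 < r).
Variables (O : set 'rV[R]_d) (g : 'rV[R]_d -> 'M[R]_d).
Hypotheses (oO : open O) (Cg : Ck 2 O g) (gs : forall y, O y -> (g y)^T = g y).
Hypothesis gp : forall y, O y -> forall v, v != 0 -> 0 < inner (g y) v v.
Variables (V : set 'rV[R]_p) (phi : 'rV[R]_p -> 'rV[R]_d).
Hypotheses (oV : open V) (Cphi : Ck 3 V phi) (VO : forall y, V y -> O (phi y)) (V0 : V 0).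
Opaque derive jacobian.

Let beta i y := 'D_(delta_mx 0 i) phi y.
Let gam y := g (phi y).
Let h y : 'M[R]_p := (conformal_factor r y)%:M + pullback g phi y.
Let X y := invmx (h y).
Let E k : 'rV[R]_p := delta_mx 0 k.

Let Cbeta i : Ck 2 V (beta i). Proof. exact: Ck_derive Cphi. Qed.
Let Cgam : Ck 2 V gam.
Proof. exact: (Ck_comp oV VO (CkS Cphi) Cg). Qed.
Let CNgam nu : Ck 1 V (fun y => 'D_nu g (phi y)).
Proof. exact: (Ck_comp oV VO (CkS (CkS Cphi)) (Ck_derive nu Cg)). Qed.
Let dbeta i : differentiable (beta i) 0. Proof. exact: Ck_differentiable (Cbeta i) V0. Qed.
Let dDbeta i j : differentiable ('D_(E i) (beta j)) 0.
Proof. exact: Ck_differentiable (Ck_derive (E i) (Cbeta j)) V0. Qed.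
Let dgam : differentiable gam 0. Proof. exact: Ck_differentiable Cgam V0. Qed.
Let dDgam i : differentiable ('D_(E i) gam) 0.
Proof. exact: Ck_differentiable (Ck_derive (E i) Cgam) V0. Qed.
Let dNgam nu : differentiable (fun y => 'D_nu g (phi y)) 0.
Proof. exact: Ck_differentiable (CNgam nu) V0. Qed.

Lemma differentiable_graph_second_form nu i j : differentiable (graph_second_form g phi nu i j) 0.
Proof.
have dnu : differentiable (cst nu : 'rV[R]_p -> 'rV[R]_d) 0 by [].
have d1 := differentiable_inner dgam (dDbeta i j) dnu.
have d2 := differentiable_inner (dDgam i) (dbeta j) dnu.
have d3 := differentiable_inner (dDgam j) (dbeta i) dnu.
have d4 := differentiable_inner (dNgam nu) (dbeta i) (dbeta j).
have dc := differentiableM (differentiable_cst (2^-1 : R) (0 : 'rV[R]_p)) (differentiableB (differentiableD d2 d3) d4).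
have := differentiableD d1 dc; rewrite /graph_second_form; exact.
Qed.

Lemma derive_graph_second_form nu i j k :
  'D_(E k) (graph_second_form g phi nu i j) 0 =
  inner (gam 0) ('D_(E k) ('D_(E i) (beta j)) 0) nu + inner ('D_(E k) gam 0) ('D_(E i) (beta j) 0) nu
  + 2^-1 * (inner ('D_(E k) ('D_(E i) gam) 0) (beta j 0) nu + inner ('D_(E i) gam 0) ('D_(E k) (beta j) 0) nu
    + (inner ('D_(E k) ('D_(E j) gam) 0) (beta i 0) nu + inner ('D_(E j) gam 0) ('D_(E k) (beta i) 0) nu)
    - (inner ('D_(E k) (fun y => 'D_nu g (phi y)) 0) (beta i 0) (beta j 0)
       + inner ('D_nu g (phi 0)) ('D_(E k) (beta i) 0) (beta j 0) + inner ('D_nu g (phi 0)) (beta i 0) ('D_(E k) (beta j) 0))).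
Proof.
exact: (derive_second_form_expr nu (E k) dgam (dDgam i) (dDgam j) (dNgam nu)
  (dDbeta i j) (dbeta i) (dbeta j)).
Qed.

Lemma differentiable_graph_slope nu l : differentiable (graph_slope r g phi nu l) 0.
Proof.
have dnu : differentiable (cst nu : 'rV[R]_p -> 'rV[R]_d) 0 by [].
have d1 := differentiable_inner dgam dnu (dbeta l).
have d2 := differentiable_conformal_slope r (0 : 'rV[R]_p).
have d3 : differentiable (conformal_inv r : 'rV[R]_p -> R) 0.
  exact: (Ck_differentiable (Ck_conformal_inv r 1 openT) I).
have d4 := differentiableM (differentiable_cst (2^-1 : R) (0 : 'rV[R]_p)) d2.
exact: (differentiableM (differentiableM (differentiableN d4) d3) d1).
Qed.

Lemma graph_slope0 nu l : graph_slope r g phi nu l 0 = 2 * inner (gam 0) nu (beta l 0).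
Proof.
rewrite /graph_slope; congr (_ * _); rewrite /conformal_slope /conformal_inv norm2_0.
by field; rewrite gt_eqF.
Qed.

Lemma derive_coord_mul (q : 'rV[R]_p -> R) i k : differentiable q 0 ->
  'D_(E k) (fun y : 'rV[R]_p => y 0 i * q y) 0 = (i == k)%:R * q 0.
Proof.
move=> dq; have dy : differentiable (fun y : 'rV[R]_p => y 0 i) 0 by exact: differentiable_coord.
apply: etrans (derive_mul_fun (E k) dy dq) _.
rewrite [X in _ + X * _]mxE mul0r addr0; congr (_ * _).
by rewrite (derive_entry 0 i (E k) (A := id)) // derive_id mxE eqxx.
Qed.

Lemma differentiable_coord_mul (q : 'rV[R]_p -> R) i : differentiable q 0 ->
  differentiable (fun y : 'rV[R]_p => y 0 i * q y) 0.
Proof. by move=> dq; apply: differentiableM => //; exact: differentiable_coord. Qed.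

Let CP : Ck 1 V (fun y => pullback g phi y).
Proof.
have CJ : Ck 1 V (fun y => 'J phi y) by exact: (Ck_jacobian oV (CkS Cphi)).
exact: (Ck_mulmx oV (Ck_mulmx oV CJ (CkS Cgam)) (Ck_trmx oV CJ)).
Qed.

Let Cconf : Ck 1 V (fun y : 'rV[R]_p => (conformal_factor r y)%:M : 'M[R]_p).
Proof.
apply: (Ck_mx oV) => i' j'; under eq_fun do rewrite mxE.
by case: (i' == j'); under eq_fun do rewrite ?mulr1n ?mulr0n;
  [exact: Ck_conformal_factor|exact: Ck_cst].
Qed.

Let Ch : Ck 1 V h. Proof. exact: (CkD oV Cconf CP). Qed.
Let dh : differentiable h 0. Proof. exact: Ck_differentiable Ch V0. Qed.

Let hunit y : V y -> h y \in unitmx.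
Proof. exact: (graph_metric_unit r0 gp VO). Qed.

Let CX : Ck 1 V X. Proof. exact: (Ck_invmx oV hunit Ch). Qed.
Let dX : differentiable X 0. Proof. exact: Ck_differentiable CX V0. Qed.

(** The round part contributes nothing, since its first derivatives vanish at the centre. *)
Lemma derive_graph_metric k i j :
  'D_(E k) h 0 i j = inner ('D_(E k) gam 0) (beta i 0) (beta j 0)
    + inner (gam 0) ('D_(E k) (beta i) 0) (beta j 0)
    + inner (gam 0) (beta i 0) ('D_(E k) (beta j) 0).
Proof.
have d1 := differentiable_inner dgam (dbeta i) (dbeta j).
have d0 : differentiable (fun y : 'rV[R]_p => (i == j)%:R * conformal_factor r y) 0.
  exact: (differentiableM (differentiable_cst ((i == j)%:R : R) (0 : 'rV[R]_p))
    (Ck_differentiable (Ck_conformal_factor r 1 openT) I)).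
rewrite -(derive_entry i j (E k) dh).
transitivity ('D_(E k) (fun y => (i == j)%:R * conformal_factor r y
   + inner (gam y) (beta i y) (beta j y)) 0).
  apply: near_eq_derive; apply: (near_open oV V0) => y Vy.
  rewrite /h [LHS]mxE [X in X + _]mxE (pullback_entry g Cphi i j Vy) mulr_natl.
  by [].
apply: etrans (derive_add_fun (E k) d0 d1) _.
rewrite (derive_cmul_fun _ (E k) (Ck_differentiable (Ck_conformal_factor r 1 openT) I)).
rewrite derive_conformal_factor // {1}/dot mul0mx mxE !mulr0 add0r.
exact: (derive_inner (E k) dgam (dbeta i) (dbeta j)).
Qed.

(** Obtained by differentiating h X = 1. *)
Lemma derive_graph_metric_inv k :
  'D_(E k) X 0 = - (X 0 *m 'D_(E k) h 0 *m X 0).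
Proof.
have E0 : 'D_(E k) (fun y => h y *m X y) 0 = 0.
  rewrite -[RHS](derive_cst (1%:M : 'M[R]_p) 0 (E k)).
  apply: near_eq_derive; apply: (near_open oV V0) => y Vy.
  by rewrite /X mulmxV // hunit.
rewrite (derive_mulmx (E k) dh dX) in E0.
have := congr1 (mulmx (X 0)) E0; rewrite mulmxDr mulmx0 mulKmx; last exact: hunit.
by move/eqP; rewrite addrC addr_eq0 mulmxA => /eqP.
Qed.

Lemma derive_slope_part (q : 'I_p -> 'rV[R]_p -> R) i j k : (forall l, differentiable (q l) 0) ->
  let A := fun y : 'rV[R]_p => y 0 i * q j y + y 0 j * q i y - (i == j)%:R * (\sum_l y 0 l * q l y) in
  [/\ differentiable A 0,
  'D_(E k) A 0 = (i == k)%:R * q j 0 + (j == k)%:R * q i 0 - (i == j)%:R * q k 0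
  & A 0 = 0].
Proof.
move=> dq A.
have d1 := differentiable_coord_mul i (dq j).
have d2 := differentiable_coord_mul j (dq i).
have d3 : differentiable (fun y : 'rV[R]_p => \sum_l y 0 l * q l y) 0.
  by apply: differentiable_bigsum => l; exact: differentiable_coord_mul.
have d4 := differentiableM (differentiable_cst ((i == j)%:R : R) (0 : 'rV[R]_p)) d3.
split; first exact: (differentiableB (differentiableD d1 d2) d4).
  2: by rewrite /A !mxE !mul0r big1 ?mulr0 ?subr0 ?addr0 // => l _; rewrite mxE mul0r.
apply: etrans (derive_sub_fun (E k) (differentiableD d1 d2) d4) _; congr (_ - _).
  by apply: etrans (derive_add_fun (E k) d1 d2) _; rewrite !derive_coord_mul.
apply: etrans (derive_cmul_fun _ (E k) d3) _; congr (_ * _).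
rewrite derive_bigsum_fun; last by move=> l; exact: differentiable_coord_mul.
rewrite (bigD1 k) //= derive_coord_mul // eqxx mul1r big1 ?addr0 // => l lk.
by rewrite derive_coord_mul // (negbTE lk) mul0r.
Qed.

(** The graph equation holds at every y for every nu, so nu is kept constant while differentiating.
    The terms with Kronecker symbols come from the factors y of the sphere part. *)
Lemma derive_graph_equation nu k :
  (forall y, V y -> minimal_pair (fun z => (conformal_factor r z)%:M) (id : 'rV[R]_p -> _) g phi y) ->
  \sum_i \sum_j ((2 * ((i == k)%:R * inner (gam 0) nu (beta j 0)
      + (j == k)%:R * inner (gam 0) nu (beta i 0)
      - (i == j)%:R * inner (gam 0) nu (beta k 0))
      + 'D_(E k) (graph_second_form g phi nu i j) 0) * X 0 i j
    + graph_second_form g phi nu i j 0 * 'D_(E k) X 0 i j) = 0.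
Proof.
move=> Hmin.
pose A i j := fun y : 'rV[R]_p => y 0 i * graph_slope r g phi nu j y
  + y 0 j * graph_slope r g phi nu i y - (i == j)%:R * (\sum_l y 0 l * graph_slope r g phi nu l y).
have dA i j : differentiable (A i j) 0.
  by have [dA _ _] := derive_slope_part i j k (differentiable_graph_slope nu); exact: dA.
have DA i j : 'D_(E k) (A i j) 0 = 2 * ((i == k)%:R * inner (gam 0) nu (beta j 0)
      + (j == k)%:R * inner (gam 0) nu (beta i 0) - (i == j)%:R * inner (gam 0) nu (beta k 0)).
  have [_ -> _] := derive_slope_part i j k (differentiable_graph_slope nu).
  rewrite (graph_slope0 nu j) (graph_slope0 nu i) (graph_slope0 nu k); exact: mulr2_combination.
have A0 i j : A i j 0 = 0.
  by have [_ _ A0] := derive_slope_part i j k (differentiable_graph_slope nu); exact: A0.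
have dD i j := differentiable_graph_second_form nu i j.
have dXe i j : differentiable (fun y => X y i j) 0 by exact: differentiable_entry.
pose Z i j y := (A i j y + graph_second_form g phi nu i j y) * X y i j.
have dZ i j : differentiable (Z i j) 0.
  exact: (differentiableM (differentiableD (dA i j) (dD i j)) (dXe i j)).
have E0 : 'D_(E k) (fun y => \sum_i \sum_j Z i j y) 0 = 0.
  rewrite -[RHS](derive_cst (0 : R) (0 : 'rV[R]_p) (E k)).
  apply: near_eq_derive; apply: (near_open oV V0) => y Vy.
  have := graph_equation r0 Cg gs Cphi VO nu Vy (Hmin y Vy); rewrite /Z /A; exact.
rewrite -[RHS]E0 derive_bigsum_fun; last by move=> i; exact: differentiable_bigsum.
apply: eq_bigr => i _; rewrite derive_bigsum_fun //; apply: eq_bigr => j _.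
apply: esym; apply: etrans (derive_mul_fun (E k) (differentiableD (dA i j) (dD i j)) (dXe i j)) _.
have -> : 'D_(E k) (A i j + graph_second_form g phi nu i j) 0 =
   'D_(E k) (A i j) 0 + 'D_(E k) (graph_second_form g phi nu i j) 0.
  exact: (derive_add_fun (E k) (dA i j) (dD i j)).
rewrite DA (derive_entry i j (E k) dX) fctE A0 add0r.
by [].
Qed.

End Bochner_derivatives.

(** * Hessians of energies and the maximum principle *)

Section Energy.
Context {R : realType}.
Opaque derive jacobian.

Lemma derive2_inner (V : normedModType R) n (U : set V) (g : V -> 'M[R]_n) (b : V -> 'rV_n) x v w :
  open U -> U x -> Ck 2 U g -> Ck 2 U b ->
  'D_v ('D_w (fun y => inner (g y) (b y) (b y))) x =
  inner ('D_v ('D_w g) x) (b x) (b x) + inner ('D_w g x) ('D_v b x) (b x)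
    + inner ('D_w g x) (b x) ('D_v b x)
  + (inner ('D_v g x) ('D_w b x) (b x) + inner (g x) ('D_v ('D_w b) x) (b x)
    + inner (g x) ('D_w b x) ('D_v b x))
  + (inner ('D_v g x) (b x) ('D_w b x) + inner (g x) ('D_v b x) ('D_w b x)
    + inner (g x) (b x) ('D_v ('D_w b) x)).
Proof.
move=> oU Ux Cg Cb.
have dg y : U y -> differentiable g y by exact: Ck_differentiable Cg.
have db y : U y -> differentiable b y by exact: Ck_differentiable Cb.
have dDg : differentiable ('D_w g) x by exact: Ck_differentiable (Ck_derive w Cg) Ux.
have dDb : differentiable ('D_w b) x by exact: Ck_differentiable (Ck_derive w Cb) Ux.
have dgx := dg x Ux; have dbx := db x Ux.
have d1 := differentiable_inner dDg dbx dbx.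
have d2 := differentiable_inner dgx dDb dbx.
have d3 := differentiable_inner dgx dbx dDb.
transitivity ('D_v (fun y => inner ('D_w g y) (b y) (b y) + inner (g y) ('D_w b y) (b y)
   + inner (g y) (b y) ('D_w b y)) x).
  apply: near_eq_derive; apply: (near_open oU Ux) => y Uy.
  exact: (derive_inner _ (dg y Uy) (db y Uy) (db y Uy)).
apply: etrans (derive_add_fun v (differentiableD d1 d2) d3) _.
congr (_ + _); last exact: (derive_inner _ dgx dbx dDb).
apply: etrans (derive_add_fun v d1 d2) _.
by congr (_ + _); [exact: (derive_inner _ dDg dbx dbx)|exact: (derive_inner _ dgx dDb dbx)].
Qed.

Lemma derive2_mul (V : normedModType R) (U : set V) (m A : V -> R) x v w :
  open U -> U x -> Ck 2 U m -> Ck 2 U A -> (forall u, 'D_u m x = 0) ->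
  'D_v ('D_w (fun y => m y * A y)) x =
  'D_v ('D_w m) x * A x + m x * 'D_v ('D_w A) x.
Proof.
move=> oU Ux Cm CA m0.
have dm y : U y -> differentiable m y by exact: Ck_differentiable Cm.
have dA y : U y -> differentiable A y by exact: Ck_differentiable CA.
have dDm : differentiable ('D_w m) x by exact: Ck_differentiable (Ck_derive w Cm) Ux.
have dDA : differentiable ('D_w A) x by exact: Ck_differentiable (Ck_derive w CA) Ux.
have dmx := dm x Ux; have dAx := dA x Ux.
transitivity ('D_v (fun y => 'D_w m y * A y + m y * 'D_w A y) x).
  apply: near_eq_derive; apply: (near_open oU Ux) => y Uy.
  exact: (derive_mul_fun _ (dm y Uy) (dA y Uy)).
apply: etrans (derive_add_fun v (differentiableM dDm dAx) (differentiableM dmx dDA)) _.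
congr (_ + _).
  by apply: etrans (derive_mul_fun v dDm dAx) _; rewrite m0 mul0r addr0.
by apply: etrans (derive_mul_fun v dmx dDA) _; rewrite m0 mul0r add0r.
Qed.

Lemma derive2_sum (V : normedModType R) (U : set V) n (A : 'I_n -> V -> R) x v w :
  open U -> U x -> (forall k, Ck 2 U (A k)) ->
  'D_v ('D_w (fun y => \sum_k A k y)) x = \sum_k 'D_v ('D_w (A k)) x.
Proof.
move=> oU Ux CA.
have dA k y : U y -> differentiable (A k) y by exact: Ck_differentiable (CA k).
transitivity ('D_v (fun y => \sum_k 'D_w (A k) y) x).
  apply: near_eq_derive; apply: (near_open oU Ux) => y Uy.
  by apply: derive_bigsum_fun => k; exact: dA.
apply: derive_bigsum_fun => k.
exact: (Ck_differentiable (Ck_derive w (CA k)) Ux).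
Qed.

(** For a frame E of h the inverse of h is E^T E, so the sum equals that of the second derivatives
    along the rows of E, none of which is positive. *)
Lemma weighted_hessian_at_max p (U : set 'rV[R]_p) (e : 'rV[R]_p -> R) x (h : 'M[R]_p) :
  open U -> U x -> Ck 2 U e -> (\forall y \near x, e y <= e x) ->
  h^T = h -> (forall v, v != 0 -> 0 < inner h v v) ->
  \sum_i \sum_j invmx h i j * 'D_(delta_mx 0 i) ('D_(delta_mx 0 j) e) x <= 0.
Proof.
move=> oU Ux Ce emax hs hp.
have [E EhE] := posdef_frame hs hp.
have uE : E \in unitmx by have [] := mulmx1_unit EhE; rewrite unitmx_mul => /andP[].
have hE : invmx h = E^T *m E.
  have uh : h \in unitmx by exact: posdef_unitmx.
  have ET : h *m E^T = invmx E.
    by have := congr1 (mulmx (invmx E)) EhE; rewrite -mulmxA mulKmx // mulmx1.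
  by rewrite -[LHS]mulmx1 -(mulVmx uE) -ET mulmxA mulKmx.
have : \sum_m 'D_(row m E) ('D_(row m E) e) x <= 0.
  by apply: sumr_le0 => m _; exact: (second_derivative_at_max _ oU Ux Ce emax).
congr (_ <= 0).
under eq_bigr do rewrite (derive_sum2 _ _ oU Ux Ce).
rewrite exchange_big; apply: eq_bigr => i _; rewrite exchange_big; apply: eq_bigr => j _.
rewrite hE mxE mulr_suml; apply: eq_bigr => m _.
by rewrite ![row m E _ _]mxE [E^T _ _]mxE.
Qed.

End Energy.

(** * Error bounds *)

Section Bounds.
Context {R : realType}.
Opaque derive jacobian.

Lemma inner_norm_le d (M : 'M[R]_d) (v w : 'rV[R]_d) m a b k :
  d%:R * d%:R <= k -> `|M| <= m -> `|v| <= a -> `|w| <= b ->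
  `|inner M v w| <= k * (m * (a * b)).
Proof.
move=> dk Mm va wb.
have m0 : 0 <= m by apply: le_trans Mm.
have a0 : 0 <= a by apply: le_trans va.
have b0 : 0 <= b by apply: le_trans wb.
apply: (@le_trans _ _ (d%:R * (d%:R * (m * (a * b))))); last first.
  by rewrite mulrA ler_wpM2r // !mulr_ge0.
rewrite innerE; apply: norm_sum_ord_le => i; apply: norm_sum_ord_le => j.
rewrite !normrM mulrAC mulrC ler_pM ?mulr_ge0 //.
  by apply: le_trans Mm; exact: mx_entry_le.
by rewrite ler_pM //; [apply: le_trans va|apply: le_trans wb]; exact: mx_entry_le.
Qed.

Lemma derive_norm_le (W : normedModType R) n (f : 'rV[R]_n -> W) x v :
  differentiable f x -> `|'D_v f x| <= (\sum_i `|'D_(delta_mx 0 i) f x|) * `|v|.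
Proof.
move=> df; rewrite derive_sum_delta // (le_trans (ler_norm_sum _ _ _)) // mulr_suml.
by apply: ler_sum => i _; rewrite normrZ mulrC ler_wpM2l // mx_entry_le.
Qed.

Lemma derive2_norm_le (W : normedModType R) n (U : set 'rV[R]_n) (f : 'rV[R]_n -> W) x u v :
  open U -> U x -> Ck 2 U f ->
  `|'D_u ('D_v f) x| <=
  (\sum_i \sum_j `|'D_(delta_mx 0 i) ('D_(delta_mx 0 j) f) x|) * (`|u| * `|v|).
Proof.
move=> oU Ux Cf; rewrite (derive_sum2 _ _ oU Ux Cf) (le_trans (ler_norm_sum _ _ _)) // mulr_suml.
apply: ler_sum => i _; rewrite (le_trans (ler_norm_sum _ _ _)) // mulr_suml.
apply: ler_sum => j _; rewrite normrZ mulrC ler_wpM2l // normrM.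
by rewrite ler_pM // mx_entry_le.
Qed.

Lemma norm_le_dot n (u : 'rV[R]_n) : `|u| ^+ 2 <= dot u u.
Proof.
have d0 : 0 <= dot u u by exact: norm2_ge0.
rewrite -[leRHS](sqr_sqrtr d0) ler_sqr ?nnegrE ?sqrtr_ge0 //.
apply: mx_norm_le; first exact: sqrtr_ge0.
move=> i j; rewrite [i]ord1 -sqrtr_sqr ler_wsqrtr // dotE.
apply: (ler_sum1 (F := fun j => u 0 j * u 0 j)) => k.
by rewrite -expr2 sqr_ge0.
Qed.

Lemma posdef_bound d (G : 'M[R]_d) : G^T = G -> (forall v, v != 0 -> 0 < inner G v v) ->
  exists2 c, 0 < c & forall v : 'rV[R]_d, c * `|v| ^+ 2 <= inner G v v.
Proof.
move=> Gs Gp; have [E EGE] := posdef_frame Gs Gp.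
have uE : E \in unitmx by have [] := mulmx1_unit EGE; rewrite unitmx_mul => /andP[].
pose k : R := d%:R * `|E| + 1.
have k0 : 0 < k by rewrite ltr_wpDl // mulr_ge0.
exists (k ^- 2) => [|v]; first by rewrite invr_gt0 exprn_gt0.
pose u := v *m invmx E.
have vE : v = u *m E by rewrite /u mulmxKV.
have -> : inner G v v = dot u u by rewrite vE -inner_mulmx EGE /inner mulmx1.
rewrite mulrC ler_pdivrMr ?exprn_gt0 // mulrC.
apply: (@le_trans _ _ (k ^+ 2 * `|u| ^+ 2)); last first.
  by rewrite ler_wpM2l ?exprn_ge0 ?(ltW k0) ?norm_le_dot.
rewrite -exprMn ler_sqr ?nnegrE ?mulr_ge0 ?(ltW k0) //.
apply: mx_norm_le; first by rewrite mulr_ge0 ?(ltW k0).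
move=> i j; rewrite [i]ord1 vE mxE.
apply: (@le_trans _ _ (d%:R * (`|u| * `|E|))).
  by apply: norm_sum_ord_le => l; rewrite normrM ler_pM // mx_entry_le.
rewrite (mulrC `|u|) mulrA ler_wpM2r // /k lerDl //.
Qed.

Lemma e1_bound (m x1 x2 x3 x4 x5 : R) :
  `|x1| <= 2 * m -> `|x2| <= m -> `|x3| <= m -> `|x4| <= m -> `|x5| <= m ->
  `|x1 + x2 + x3 + x4 + x5| <= 6 * m.
Proof.
rewrite !ler_norml => /andP[? ?] /andP[? ?] /andP[? ?] /andP[? ?] /andP[? ?].
by apply/andP; split; lra.
Qed.

Lemma e2_bound (m x1 x2 x3 x4 x5 x6 x7 x8 : R) :
  `|x1| <= m -> `|x2| <= 2 * m -> `|x3| <= m -> `|x4| <= 2 * m -> `|x5| <= m ->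
  `|x6| <= m -> `|x7| <= m -> `|x8| <= m ->
  `|x1 + 2^-1 * (x2 + x3 + (x4 + x5) - (x6 + x7 + x8))| <= 6 * m.
Proof.
rewrite !ler_norml.
move=> /andP[? ?] /andP[? ?] /andP[? ?] /andP[? ?] /andP[? ?] /andP[? ?] /andP[? ?] /andP[? ?].
by apply/andP; split; lra.
Qed.

Lemma e3_bound1 (m x1 x2 x3 x4 : R) :
  `|x1| <= m -> `|x2| <= m -> `|x3| <= m -> `|x4| <= m ->
  `|x1 + 2^-1 * (x2 + x3 - x4)| <= 3 * m.
Proof.
rewrite !ler_norml => /andP[? ?] /andP[? ?] /andP[? ?] /andP[? ?].
by apply/andP; split; lra.
Qed.

Lemma e3_bound2 (m x1 x2 x3 : R) :
  `|x1| <= m -> `|x2| <= m -> `|x3| <= m -> `|x1 + x2 + x3| <= 3 * m.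
Proof.
rewrite !ler_norml => /andP[? ?] /andP[? ?] /andP[? ?].
by apply/andP; split; lra.
Qed.

Section Monomials.
Variables s H k : R.
Hypotheses (s0 : 0 <= s) (s1 : s <= 1) (H0 : 0 <= H) (k1 : 1 <= k).
Let T := s * (s ^+ 2 + H ^+ 2).

Let k0 : 0 <= k. Proof. exact: le_trans k1. Qed.

(** T is the common scale of all errors: s H <= s^2 + H^2, and s <= 1 disposes of surplus factors
    s. *)
Lemma monomial_ssH : s * (s * H) <= T.
Proof.
rewrite ler_wpM2l //; have := sqr_ge0 (s - H); have := sqr_ge0 s; have := sqr_ge0 H.
rewrite sqrrB mulr2n; lra.
Qed.

Lemma monomial_s4 : s ^+ 2 * s ^+ 2 <= T.
Proof.
rewrite (_ : s ^+ 2 * s ^+ 2 = s * (s * s ^+ 2)); last by ring.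
rewrite ler_wpM2l // (@le_trans _ _ (1 * s ^+ 2)) ?ler_wpM2r ?sqr_ge0 // mul1r lerDl sqr_ge0 //.
Qed.

Lemma monomial_square : (s ^+ 3 + s * H) ^+ 2 <= 2 * T.
Proof.
have sq : (s ^+ 3 + s * H) ^+ 2 <= 2 * (s * (s * ((s ^+ 2) ^+ 2 + H ^+ 2))).
  have := sqr_ge0 (s ^+ 3 - s * H).
  rewrite (_ : (s ^+ 3 + s * H) ^+ 2 = 2 * (s * (s * ((s ^+ 2) ^+ 2 + H ^+ 2))) - (s ^+ 3 - s * H) ^+ 2); last by ring.
  lra.
apply: le_trans sq _; rewrite ler_wpM2l // ler_wpM2l //.
apply: (@le_trans _ _ (1 * ((s ^+ 2) ^+ 2 + H ^+ 2))).
  by rewrite ler_wpM2r // addr_ge0 // sqr_ge0.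
rewrite mul1r lerD2r expr2 -[leRHS]mulr1 ler_wpM2l ?sqr_ge0 //.
by rewrite expr2 -[leRHS]mulr1 ler_pM.
Qed.

Lemma bound_sHs : k * (k * s * (H * s)) <= k ^+ 2 * T.
Proof.
rewrite (_ : _ * _ = k ^+ 2 * (s * (s * H))); last by ring.
by rewrite ler_wpM2l ?exprn_ge0 // monomial_ssH.
Qed.

Lemma bound_ssH : k * (k * (s ^+ 2 + H) * (s * s)) <= 2 * (k ^+ 2 * T).
Proof.
rewrite (_ : _ * _ = k ^+ 2 * (s ^+ 2 * s ^+ 2 + s * (s * H))); last by ring.
rewrite [leRHS]mulrCA ler_wpM2l ?exprn_ge0 //.
have := monomial_ssH; have := monomial_s4; lra.
Qed.

Lemma bound_s4 : k * (k * s ^+ 2 * (s * s)) <= k ^+ 2 * T.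
Proof.
rewrite (_ : _ * _ = k ^+ 2 * (s ^+ 2 * s ^+ 2)); last by ring.
by rewrite ler_wpM2l ?exprn_ge0 // monomial_s4.
Qed.

End Monomials.

End Bounds.

(** * The Hessian of the energy of a graph *)

Section Bochner.
Context {R : realType} {p d : nat}.
Variables (r : R) (r0 : 0 < r) (hp : (2 <= p)%N).
Variables (O : set 'rV[R]_d) (g : 'rV[R]_d -> 'M[R]_d) (w0 : 'rV[R]_d).
Hypotheses (oO : open O) (Ow0 : O w0) (Cg : Ck 2 O g).
Hypotheses (gs : forall y, O y -> (g y)^T = g y).
Hypothesis gp : forall y, O y -> forall v, v != 0 -> 0 < inner (g y) v v.
Opaque derive jacobian.

(** The trace of the pulled-back metric relative to the round metric: the latter is a multiple of
    the Euclidean one, hence the factor [conformal_inv]. *)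
Definition graph_energy (phi : 'rV[R]_p -> 'rV[R]_d) (y : 'rV[R]_p) : R :=
  conformal_inv r y * \sum_k inner (g (phi y)) ('D_(delta_mx 0 k) phi y) ('D_(delta_mx 0 k) phi y).

Section At_graph.
Variables (V : set 'rV[R]_p) (phi : 'rV[R]_p -> 'rV[R]_d).
Hypotheses (oV : open V) (Cphi : Ck 3 V phi) (VO : forall y, V y -> O (phi y)) (V0 : V 0).
Hypothesis phi0 : phi 0 = w0.

Let E k : 'rV[R]_p := delta_mx 0 k.
Let b k := 'D_(E k) phi 0.
Let f i j := 'D_(E i) ('D_(E j) phi) 0.
Let gam y := g (phi y).
Let h y : 'M[R]_p := (conformal_factor r y)%:M + pullback g phi y.

Let Cb k : Ck 2 V ('D_(E k) phi). Proof. exact: (Ck_derive (E k) Cphi). Qed.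
Let Cgam : Ck 2 V gam.
Proof. exact: (Ck_comp oV VO (CkS Cphi) Cg). Qed.

(** Puts the third derivatives of the graph equation in the order in which they occur in the Hessian
    of the energy, so that they can be cancelled. *)
Lemma third_derivative_comm i j k :
  'D_(E k) ('D_(E i) ('D_(E j) phi)) 0 = 'D_(E i) ('D_(E j) ('D_(E k) phi)) 0.
Proof.
apply: etrans (schwarz (E i) (E k) oV V0 (Cb j)) _.
apply: near_eq_derive; apply: (near_open oV V0) => y Vy.
exact: (schwarz (E j) (E k) oV Vy (CkS Cphi)).
Qed.

Lemma derive_metric_graph i : 'D_(E i) gam 0 = 'D_(b i) g w0.
Proof.
have dg : differentiable g (phi 0) by exact: (Ck_differentiable Cg (VO V0)).
apply: etrans (derive_comp (E i) (Ck_differentiable Cphi V0) dg) _.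
by rewrite phi0.
Qed.

Lemma derive2_metric_graph i j :
  'D_(E i) ('D_(E j) gam) 0 = 'D_(b i) ('D_(b j) g) w0 + 'D_(f i j) g w0.
Proof.
apply: etrans (derive2_comp (E i) (E j) oV V0 VO (CkS Cphi) oO Cg) _.
by rewrite phi0.
Qed.

Lemma derive_dmetric_graph nu k :
  'D_(E k) (fun y => 'D_nu g (phi y)) 0 = 'D_(b k) ('D_nu g) w0.
Proof.
have dg : differentiable ('D_nu g) (phi 0).
  exact: (Ck_differentiable (Ck_derive nu Cg) (VO V0)).
apply: etrans (derive_comp (E k) (Ck_differentiable Cphi V0) dg) _.
by rewrite phi0.
Qed.

Lemma Ck_graph_energy : Ck 2 V (graph_energy phi).
Proof.
apply: (CkM oV (Ck_conformal_inv r 2 oV)).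
apply: Ck_sum; [exact: oV|move=> k _]; exact: (Ck_inner oV Cgam (Cb k) (Cb k)).
Qed.

(** The part of the Hessian that contains derivatives of the metric of X_2. *)
Definition energy_error i j k : R :=
  inner ('D_(E i) ('D_(E j) gam) 0) (b k) (b k)
  + inner ('D_(E j) gam 0) (f i k) (b k) + inner ('D_(E j) gam 0) (b k) (f i k)
  + inner ('D_(E i) gam 0) (f j k) (b k) + inner ('D_(E i) gam 0) (b k) (f j k).

Lemma energy_algebra n (Gij Gi Gj G : 'M[R]_n) (x fi fj t : 'rV[R]_n) : G^T = G ->
  inner Gij x x + inner Gj fi x + inner Gj x fi
  + (inner Gi fj x + inner G t x + inner G fj fi)
  + (inner Gi x fj + inner G fi fj + inner G x t) =
  2 * inner G t x + 2 * inner G fi fj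
    + (inner Gij x x + inner Gj fi x + inner Gj x fi + inner Gi fj x + inner Gi x fj).
Proof. by move=> Gs; rewrite (inner_sym x t Gs) (inner_sym fj fi Gs); ring. Qed.

Lemma derive2_graph_energy i j :
  'D_(E i) ('D_(E j) (graph_energy phi)) 0 =
  4 * (4 * r ^+ 2)^-1 * (i == j)%:R * (\sum_k inner (g w0) (b k) (b k))
  + (4 * r ^+ 2)^-1 * \sum_k (2 * inner (g w0) ('D_(E i) ('D_(E j) ('D_(E k) phi)) 0) (b k)
      + 2 * inner (g w0) (f i k) (f j k) + energy_error i j k).
Proof.
have Cm := Ck_conformal_inv r 2 oV.
have CA k : Ck 2 V (fun y => inner (gam y) ('D_(E k) phi y) ('D_(E k) phi y)).
  exact: (Ck_inner oV Cgam (Cb k) (Cb k)).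
have m0 u : 'D_u (conformal_inv r : 'rV[R]_p -> R) 0 = 0.
  by rewrite derive_conformal_inv /dot mul0mx mxE !mulr0.
have CS : Ck 2 V (fun y => \sum_k inner (gam y) ('D_(E k) phi y) ('D_(E k) phi y)).
  by apply: Ck_sum; [exact: oV|move=> k _; exact: CA].
apply: etrans (derive2_mul (E i) (E j) oV V0 Cm CS m0) _.
have -> : 'D_(E i) ('D_(E j) (conformal_inv r : 'rV[R]_p -> R)) 0 = (4 * r ^+ 2)^-1 * (4 * (i == j)%:R).
  by rewrite derive2_conformal_inv dot_delta mxE eqxx eq_sym.
have -> : conformal_inv r (0 : 'rV[R]_p) = (4 * r ^+ 2)^-1.
  by rewrite /conformal_inv norm2_0 addr0 expr1n mulr1.
have -> : \sum_k inner (gam 0) ('D_(E k) phi 0) ('D_(E k) phi 0) = \sum_k inner (g w0) (b k) (b k).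
  by rewrite /gam phi0.
congr (_ + _ * _).
  by move: (\sum_k _) => S; ring.
apply: etrans (derive2_sum (E i) (E j) oV V0 CA) _; apply: eq_bigr => k _.
apply: etrans (derive2_inner (E i) (E j) oV V0 Cgam (Cb k)) _.
have Gs : (gam 0)^T = gam 0 by exact: (gs (VO V0)).
by apply: etrans (energy_algebra _ _ _ _ _ _ _ Gs) _; rewrite /gam phi0.
Qed.

End At_graph.

End Bochner.

(** * The Bochner inequality at the centre *)

Section Bochner_inequality.
Context {R : realType} {p d : nat}.
Variables (r : R) (r0 : 0 < r) (hp : (2 <= p)%N).
Variables (O : set 'rV[R]_d) (g : 'rV[R]_d -> 'M[R]_d) (w0 : 'rV[R]_d).
Hypotheses (oO : open O) (Ow0 : O w0) (Cg : Ck 2 O g).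
Hypotheses (gs : forall y, O y -> (g y)^T = g y).
Hypothesis gp : forall y, O y -> forall v, v != 0 -> 0 < inner (g y) v v.
Opaque derive jacobian.

Let mu : R := (4 * r ^+ 2)^-1.
Let k1 := \sum_i `|'D_(delta_mx 0 i) g w0|.
Let k2 := \sum_i \sum_j `|'D_(delta_mx 0 i) ('D_(delta_mx 0 j) g) w0|.
(** One constant dominating all that enters the error bounds: the dimension factor of
    [inner_norm_le], the 2-jet of g at w0, and the bound p mu for the entries of the inverse metric
    of the graph. *)
Let kap : R := 1 + d%:R * d%:R + `|g w0| + k1 + k2 + p%:R * mu.

Let mu0 : 0 < mu. Proof. by rewrite invr_gt0 mulr_gt0 // exprn_gt0. Qed.
Let k1_0 : 0 <= k1. Proof. exact: sumr_ge0. Qed.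
Let k2_0 : 0 <= k2. Proof. by apply: sumr_ge0 => i _; exact: sumr_ge0. Qed.
Let dd0 : 0 <= d%:R * d%:R :> R. Proof. exact: mulr_ge0. Qed.
Let pm0 : 0 <= p%:R * mu. Proof. by rewrite mulr_ge0 // ltW. Qed.
Let kap_bounds : [/\ 1 <= kap, d%:R * d%:R <= kap, `|g w0| <= kap, k1 <= kap
  & k2 <= kap /\ p%:R * mu <= kap].
Proof.
move: dd0 pm0 k1_0 k2_0 (normr_ge0 (g w0)); rewrite /kap.
move: (d%:R * d%:R) (p%:R * mu) k1 k2 `|g w0| => ? ? ? ? ?.
by do !split; lra.
Qed.
Let kap1 : 1 <= kap. Proof. by case: kap_bounds. Qed.
Let kap0 : 0 <= kap. Proof. exact: le_trans kap1. Qed.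
Let kapd : d%:R * d%:R <= kap. Proof. by case: kap_bounds. Qed.
Let kapg : `|g w0| <= kap. Proof. by case: kap_bounds. Qed.
Let kapm : p%:R * mu <= kap. Proof. by case: kap_bounds => _ _ _ _ []. Qed.

Let Dg_le v : `|'D_v g w0| <= kap * `|v|.
Proof.
have [_ _ _ k1_le _] := kap_bounds.
apply: le_trans (derive_norm_le _ (Ck_differentiable Cg Ow0)) _.
exact: (ler_wpM2r (normr_ge0 v) k1_le).
Qed.

Let DDg_le u v : `|'D_u ('D_v g) w0| <= kap * (`|u| * `|v|).
Proof.
have [_ _ _ _ [k2_le _]] := kap_bounds.
apply: le_trans (derive2_norm_le _ _ oO Ow0 Cg) _.
exact: (ler_wpM2r (mulr_ge0 (normr_ge0 u) (normr_ge0 v)) k2_le).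
Qed.

Lemma second_form_error n (G G' : 'M[R]_n) (t t' x : 'rV[R]_n) (z a c : R) :
  t = t' -> G = G' -> z = inner G' t' x + a + c -> z - inner G t x = a + c.
Proof. by move=> -> -> ->; ring. Qed.

Section At_graph.
Variables (V : set 'rV[R]_p) (phi : 'rV[R]_p -> 'rV[R]_d).
Hypotheses (oV : open V) (Cphi : Ck 3 V phi) (VO : forall y, V y -> O (phi y)) (V0 : V 0).
Hypothesis phi0 : phi 0 = w0.

Let E k : 'rV[R]_p := delta_mx 0 k.
Let b k := 'D_(E k) phi 0.
Let f i j := 'D_(E i) ('D_(E j) phi) 0.
Let gam y := g (phi y).
Let h y : 'M[R]_p := (conformal_factor r y)%:M + pullback g phi y.
Let X y := invmx (h y).
Variables (s H : R).
Hypotheses (s0 : 0 <= s) (s1 : s <= 1) (H0 : 0 <= H).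
Hypotheses (bs : forall k, `|b k| <= s) (fH : forall i j, `|f i j| <= H).
Let T := s * (s ^+ 2 + H ^+ 2).
Let m := kap ^+ 2 * T.

Let bb_le i j : `|b i| * `|b j| <= s ^+ 2.
Proof. by rewrite expr2; apply: ler_pM (normr_ge0 _) (normr_ge0 _) (bs i) (bs j). Qed.

Let Gam_le i : `|'D_(E i) gam 0| <= kap * s.
Proof.
have -> : 'D_(E i) gam 0 = 'D_(b i) g w0 by exact: (derive_metric_graph Cg Cphi VO V0 phi0).
exact: (le_trans (Dg_le _) (ler_wpM2l kap0 (bs i))).
Qed.

Let GGam_le i j : `|'D_(E i) ('D_(E j) gam) 0| <= kap * (s ^+ 2 + H).
Proof.
have -> : 'D_(E i) ('D_(E j) gam) 0 = 'D_(b i) ('D_(b j) g) w0 + 'D_(f i j) g w0.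
  exact: (derive2_metric_graph oO Cg oV Cphi VO V0 phi0).
apply: le_trans (ler_normD _ _) _; rewrite mulrDr; apply: lerD.
  exact: (le_trans (DDg_le _ _) (ler_wpM2l kap0 (bb_le i j))).
exact: (le_trans (Dg_le _) (ler_wpM2l kap0 (fH i j))).
Qed.

Let Ngam_le k : `|'D_(b k) g (phi 0)| <= kap * s.
Proof. rewrite phi0; exact: (le_trans (Dg_le _) (ler_wpM2l kap0 (bs k))). Qed.

Let DNgam_le k l : `|'D_(E k) (fun y => 'D_(b l) g (phi y)) 0| <= kap * s ^+ 2.
Proof.
have -> : 'D_(E k) (fun y => 'D_(b l) g (phi y)) 0 = 'D_(b k) ('D_(b l) g) w0.
  exact: (derive_dmetric_graph Cg Cphi VO V0 phi0).
exact: (le_trans (DDg_le _ _) (ler_wpM2l kap0 (bb_le k l))).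
Qed.

Let gam0_le : `|gam 0| <= kap. Proof. by rewrite /gam phi0. Qed.

Lemma energy_error_le i j k : `|energy_error g phi i j k| <= 6 * m.
Proof.
have sH : kap * (kap * s * (H * s)) <= kap ^+ 2 * T by exact: bound_sHs.
have Hs : kap * (kap * s * (s * H)) <= kap ^+ 2 * T by rewrite (mulrC s H).
apply: e1_bound.
- apply: le_trans (inner_norm_le kapd (GGam_le i j) (bs k) (bs k)) _; exact: bound_ssH.
- by apply: le_trans (inner_norm_le kapd (Gam_le j) (fH i k) (bs k)) _.
- by apply: le_trans (inner_norm_le kapd (Gam_le j) (bs k) (fH i k)) _.
- by apply: le_trans (inner_norm_le kapd (Gam_le i) (fH j k) (bs k)) _.
- by apply: le_trans (inner_norm_le kapd (Gam_le i) (bs k) (fH j k)) _.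
Qed.

Lemma graph_equation_error_le i j k :
  `|'D_(E k) (graph_second_form g phi (b k) i j) 0
    - inner (g w0) ('D_(E i) ('D_(E j) ('D_(E k) phi)) 0) (b k)| <= 6 * m.
Proof.
have sH : kap * (kap * s * (H * s)) <= kap ^+ 2 * T by exact: bound_sHs.
have Hs : kap * (kap * s * (s * H)) <= kap ^+ 2 * T by rewrite (mulrC s H).
have Ss : kap * (kap * s ^+ 2 * (s * s)) <= kap ^+ 2 * T by exact: bound_s4.
have SsH : kap * (kap * (s ^+ 2 + H) * (s * s)) <= 2 * (kap ^+ 2 * T) by exact: bound_ssH.
have D : 'D_(E k) (graph_second_form g phi (b k) i j) 0 -
      inner (g w0) ('D_(E i) ('D_(E j) ('D_(E k) phi)) 0) (b k) =
  inner ('D_(E k) gam 0) (f i j) (b k)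
  + 2^-1 * (inner ('D_(E k) ('D_(E i) gam) 0) (b j) (b k) + inner ('D_(E i) gam 0) (f k j) (b k)
    + (inner ('D_(E k) ('D_(E j) gam) 0) (b i) (b k) + inner ('D_(E j) gam 0) (f k i) (b k))
    - (inner ('D_(E k) (fun y => 'D_(b k) g (phi y)) 0) (b i) (b j)
       + inner ('D_(b k) g (phi 0)) (f k i) (b j) + inner ('D_(b k) g (phi 0)) (b i) (f k j))).
  have T3 : 'D_(E i) ('D_(E j) ('D_(E k) phi)) 0 = 'D_(E k) ('D_(E i) ('D_(E j) phi)) 0.
    exact: (esym (third_derivative_comm oV Cphi V0 i j k)).
  have gE : g w0 = gam 0 by rewrite /gam phi0.
  apply: (second_form_error T3 gE).
  exact: (derive_graph_second_form Cg oV Cphi VO V0 (b k) i j k).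
rewrite D; apply: e2_bound.
- by apply: le_trans (inner_norm_le kapd (Gam_le k) (fH i j) (bs k)) _.
- by apply: le_trans (inner_norm_le kapd (GGam_le k i) (bs j) (bs k)) _.
- by apply: le_trans (inner_norm_le kapd (Gam_le i) (fH k j) (bs k)) _.
- by apply: le_trans (inner_norm_le kapd (GGam_le k j) (bs i) (bs k)) _.
- by apply: le_trans (inner_norm_le kapd (Gam_le j) (fH k i) (bs k)) _.
- by apply: le_trans (inner_norm_le kapd (DNgam_le k k) (bs i) (bs j)) _.
- by apply: le_trans (inner_norm_le kapd (Ngam_le k) (fH k i) (bs j)) _.
- by apply: le_trans (inner_norm_le kapd (Ngam_le k) (bs i) (fH k j)) _.
Qed.

(** Common size of the second form contracted with d phi and of the derivative of the metric of the
    graph; by [monomial_square] a product of two such terms is O(T). *)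
Let q := kap ^+ 2 * (s ^+ 3 + s * H).

Let sH0 : 0 <= s * H. Proof. exact: mulr_ge0. Qed.
Let s30 : 0 <= s ^+ 3. Proof. exact: exprn_ge0. Qed.
Let q0 : 0 <= q. Proof. by rewrite mulr_ge0 ?exprn_ge0 ?addr_ge0. Qed.

Let qHs : kap * (kap * (H * s)) <= q.
Proof.
rewrite (_ : kap * _ = kap ^+ 2 * (s * H)); last by ring.
by rewrite ler_wpM2l ?exprn_ge0 // lerDr.
Qed.

Let qsss : kap * (kap * s * (s * s)) <= q.
Proof.
rewrite (_ : kap * _ = kap ^+ 2 * s ^+ 3); last by ring.
by rewrite ler_wpM2l ?exprn_ge0 // lerDl.
Qed.

Lemma graph_second_form_le i j k : `|graph_second_form g phi (b k) i j 0| <= 3 * q.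
Proof.
apply: e3_bound1.
- exact: (le_trans (inner_norm_le kapd gam0_le (fH i j) (bs k)) qHs).
- exact: (le_trans (inner_norm_le kapd (Gam_le i) (bs j) (bs k)) qsss).
- by apply: le_trans (inner_norm_le kapd (Gam_le j) (bs i) (bs k)) _.
- by apply: le_trans (inner_norm_le kapd (Ngam_le k) (bs i) (bs j)) _.
Qed.

Lemma derive_graph_metric_le i j k : `|'D_(E k) h 0 i j| <= 3 * q.
Proof.
have -> : 'D_(E k) h 0 i j = inner ('D_(E k) gam 0) (b i) (b j)
    + inner (gam 0) (f k i) (b j) + inner (gam 0) (b i) (f k j).
  exact: (derive_graph_metric r Cg oV Cphi VO V0 k i j).
apply: e3_bound2.
- exact: (le_trans (inner_norm_le kapd (Gam_le k) (bs i) (bs j)) qsss).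
- exact: (le_trans (inner_norm_le kapd gam0_le (fH k i) (bs j)) qHs).
- by apply: le_trans (inner_norm_le kapd gam0_le (bs i) (fH k j)) _; rewrite (mulrC s).
Qed.

(** The rows of a frame F have length 1 for the metric of the graph, so their Euclidean length
    squared is at most mu; the inverse metric is F^T F. *)
Lemma graph_metric_inv_le i j : `|X 0 i j| <= kap.
Proof.
have hs : (h 0)^T = h 0 by exact: (graph_metric_sym r gs VO V0).
have hpos v : v != 0 -> 0 < inner (h 0) v v by exact: (graph_metric_pos r0 gp VO V0).
have [F FhF] := posdef_frame hs hpos.
have uF : F \in unitmx by have [] := mulmx1_unit FhF; rewrite unitmx_mul => /andP[].
have XE : X 0 = F^T *m F.
  have uh : h 0 \in unitmx by exact: posdef_unitmx.
  have FT : h 0 *m F^T = invmx F.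
    by have := congr1 (mulmx (invmx F)) FhF; rewrite -mulmxA mulKmx // mulmx1.
  by rewrite /X -[LHS]mulmx1 -(mulVmx uF) -FT mulmxA mulKmx.
have Fle l i' : F l i' ^+ 2 <= mu.
  have : inner (h 0) (row l F) (row l F) = 1 by rewrite -inner_mxE FhF mxE eqxx.
  have := graph_metric_ge r gp VO (row l F) V0 => /[swap] -> ge1.
  have cf : 0 < conformal_factor r (0 : 'rV[R]_p) by exact: conformal_factor_gt0.
  have dle : F l i' ^+ 2 <= dot (row l F) (row l F).
    rewrite dotE (bigD1 i') //= !mxE -expr2 lerDl sumr_ge0 // => k _.
    by rewrite -expr2 sqr_ge0.
  have muE : mu * conformal_factor r (0 : 'rV[R]_p) = 1.
    rewrite -(conformal_factorK r0 (0 : 'rV[R]_p)); congr (_ * _).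
    by rewrite /conformal_inv norm2_0 addr0 expr1n mulr1.
  rewrite -(ler_pM2l cf) [leRHS]mulrC muE; apply: le_trans ge1.
  by rewrite ler_wpM2l // ltW.
apply: le_trans kapm; rewrite XE mxE; apply: norm_sum_ord_le => l; rewrite mxE normrM.
have := Fle l i; have := Fle l j; rewrite -(real_normK (num_real (F l i))) -(real_normK (num_real (F l j))).
have := sqr_ge0 (`|F l i| - `|F l j|); rewrite sqrrB mulr2n; lra.
Qed.

Lemma derive_graph_metric_inv_le i j k :
  `|'D_(E k) X 0 i j| <= p%:R * (p%:R * (kap * (3 * q)) * kap).
Proof.
have -> : 'D_(E k) X 0 = - (X 0 *m 'D_(E k) h 0 *m X 0).
  exact: (derive_graph_metric_inv r0 Cg gp oV Cphi VO V0 k).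
rewrite mxE normrN mxE; apply: norm_sum_ord_le => l; rewrite normrM.
apply: ler_pM => //; last exact: graph_metric_inv_le.
rewrite mxE; apply: norm_sum_ord_le => l'; rewrite normrM.
apply: ler_pM => //; [exact: graph_metric_inv_le|exact: derive_graph_metric_le].
Qed.

Lemma normal_error_le k :
  `|\sum_i \sum_j graph_second_form g phi (b k) i j 0 * 'D_(E k) X 0 i j|
  <= p%:R * (p%:R * (p%:R * (p%:R * (18 * kap ^+ 6)))) * T.
Proof.
have step : `|\sum_i \sum_j graph_second_form g phi (b k) i j 0 * 'D_(E k) X 0 i j|
    <= p%:R * (p%:R * (3 * q * (p%:R * (p%:R * (kap * (3 * q)) * kap)))).
  apply: norm_sum_ord_le => i; apply: norm_sum_ord_le => j; rewrite normrM.
  by apply: ler_pM => //; [exact: graph_second_form_le|exact: derive_graph_metric_inv_le].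
apply: le_trans step _.
rewrite (_ : p%:R * (p%:R * (3 * q * _)) =
  p%:R * (p%:R * (p%:R * (p%:R * (9 * kap ^+ 6)))) * (s ^+ 3 + s * H) ^+ 2); last by rewrite /q; ring.
rewrite (_ : p%:R * (p%:R * (p%:R * (p%:R * (18 * kap ^+ 6)))) * T =
  p%:R * (p%:R * (p%:R * (p%:R * (9 * kap ^+ 6)))) * (2 * T)); last by ring.
apply: ler_wpM2l; first by do 5?[apply: mulr_ge0 => //]; exact: exprn_ge0.
exact: monomial_square.
Qed.

End At_graph.

Lemma cancel_third_order (x q q' t D : R) : q = q' -> x * (q + t + (D - t)) = (q' + D) * x.
Proof. by move=> ->; ring. Qed.

(** Instance of [bochner_algebra] at the centre: [t] holds the third derivatives contracted with d
    phi, [e2] the rest of the derivative of the second form, and [e3] the terms with the derivative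
    of the inverse metric. *)
Lemma bochner : exists2 eps, 0 < eps &
  forall (V : set 'rV[R]_p) (phi : 'rV[R]_p -> 'rV[R]_d),
    open V -> Ck 3 V phi -> (forall y, V y -> O (phi y)) -> V 0 -> phi 0 = w0 ->
    (forall y, V y ->
      minimal_pair (fun z => (conformal_factor r z)%:M) (id : 'rV[R]_p -> _) g phi y) ->
    (forall k, `|'D_(delta_mx 0 k) phi 0| <= eps) ->
    (\forall y \near (0 : 'rV[R]_p), graph_energy r g phi y <= graph_energy r g phi 0) ->
    forall k, 'D_(delta_mx 0 k) phi 0 = 0.
Proof.
have [c c0 cP] := posdef_bound (gs Ow0) (gp Ow0).
pose K := kap + 7 * kap ^+ 2 + p%:R * (p%:R * (p%:R * (p%:R * (18 * kap ^+ 6)))).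
have k2p : 0 <= kap ^+ 2 by exact: exprn_ge0.
have k6p : 0 <= p%:R * (p%:R * (p%:R * (p%:R * (18 * kap ^+ 6)))).
  by do 5?[apply: mulr_ge0 => //]; exact: exprn_ge0.
have K1 : 1 <= K.
  by rewrite /K; move: kap1 k2p k6p; move: kap (kap ^+ 2) (p%:R * _) => ? ? ? ? ? ?; lra.
have [K2 K6 Kk Kr] : [/\ kap ^+ 2 <= K, 6 * kap ^+ 2 <= K, kap <= K
    & p%:R * (p%:R * (p%:R * (p%:R * (18 * kap ^+ 6)))) <= K].
  rewrite /K; move: kap0 k2p k6p; move: kap (kap ^+ 2) (p%:R * _) => ? ? ? ? ? ?.
  by split; lra.
have [e0 e00 eP] := bochner_algebra d hp mu0 c0 K1.
have p0 : 0 < p%:R :> R by rewrite ltr0n; exact: leq_trans hp.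
(* As s^2 is a sum of p squares, the division by p ensures s <= min e0 1. *)
exists (Num.min e0 1 / p%:R) => [|V phi oV Cphi VO V0 phi0 Hmin bE emax].
  by rewrite divr_gt0 // lt_min e00 ltr01.
pose E k : 'rV[R]_p := delta_mx 0 k.
pose b k := 'D_(E k) phi 0.
pose f i j := 'D_(E i) ('D_(E j) phi) 0.
pose h : 'M[R]_p := (conformal_factor r (0 : 'rV[R]_p))%:M + pullback g phi 0.
pose P : 'M[R]_p := \matrix_(i, j) inner (g w0) (b i) (b j).
pose S2 := \sum_k `|b k| ^+ 2.
pose H2 := \sum_i \sum_j `|f i j| ^+ 2.
have S20 : 0 <= S2 by apply: sumr_ge0 => k _; exact: sqr_ge0.
have H20 : 0 <= H2 by apply: sumr_ge0 => i _; apply: sumr_ge0 => j _; exact: sqr_ge0.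
pose s := Num.sqrt S2; pose H := Num.sqrt H2.
have s0 : 0 <= s by exact: sqrtr_ge0.
have H0 : 0 <= H by exact: sqrtr_ge0.
have sb : s ^+ 2 = S2 by rewrite sqr_sqrtr.
have Hf : H ^+ 2 = H2 by rewrite sqr_sqrtr.
have bs k : `|b k| <= s.
  rewrite -(ler_sqr (normr_ge0 _) s0) sb.
  by apply: (ler_sum1 (F := fun k => `|b k| ^+ 2)) => i; exact: sqr_ge0.
have fH i j : `|f i j| <= H.
  rewrite -(ler_sqr (normr_ge0 _) H0) Hf.
  apply: le_trans (ler_sum1 (F := fun j => `|f i j| ^+ 2) j _) _ => [k|]; first exact: sqr_ge0.
  apply: (ler_sum1 (F := fun i => \sum_k `|f i k| ^+ 2)) => k.
  by apply: sumr_ge0 => l _; exact: sqr_ge0.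
have smin : s <= Num.min e0 1.
  have m0 : 0 <= Num.min e0 1 by rewrite le_min (ltW e00) ler01.
  rewrite -(ler_sqr s0 m0) sb.
  apply: (@le_trans _ _ (\sum_(k < p) (Num.min e0 1 / p%:R) ^+ 2)).
    apply: ler_sum => k _; rewrite ler_sqr ?nnegrE // ?divr_ge0 //; exact: bE.
  have aux (m : R) : \sum_(k < p) (m / p%:R) ^+ 2 <= m ^+ 2.
    rewrite sumr_const card_ord -[_ *+ p]mulr_natl.
    have -> : p%:R * (m / p%:R) ^+ 2 = m ^+ 2 / p%:R.
      by rewrite expr_div_n; field; rewrite gt_eqF.
    by rewrite ler_pdivrMr // ler_peMr ?sqr_ge0 // ler1n; exact: leq_trans hp.
  exact: aux.
have s1 : s <= 1 by apply: le_trans smin _; rewrite ge_min lexx orbT.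
have se : 0 <= s <= e0 by rewrite s0 /=; apply: le_trans smin _; rewrite ge_min lexx.
have PE : pullback g phi 0 = P.
  by apply/matrixP => i j; rewrite (pullback_entry g Cphi i j V0) phi0 mxE.
have cfE : conformal_factor r (0 : 'rV[R]_p) = 4 * r ^+ 2.
  by rewrite /conformal_factor norm2_0 addr0 expr1n invr1 mulr1.
have hs : h^T = h by exact: (graph_metric_sym r gs VO V0).
have hpos v : v != 0 -> 0 < inner h v v by exact: (graph_metric_pos r0 gp VO V0).
have uh : h \in unitmx by exact: posdef_unitmx.
have XE : invmx h = mu *: (1%:M - invmx h *m P).
  have := mulVmx uh; rewrite {2}/h PE mulmxDr mul_mx_scalar cfE => E1.
  rewrite -E1 addrK scalerA mulVf ?scale1r //.
  by rewrite gt_eqF // mulr_gt0 // exprn_gt0.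
have trP : \tr P = \sum_k inner (g w0) (b k) (b k).
  by apply: eq_bigr => k _; rewrite mxE.
have PG i j : P i j = inner (g (phi 0)) (b i) (b j) by rewrite mxE phi0.
pose t i j k := inner (g w0) ('D_(E i) ('D_(E j) ('D_(E k) phi)) 0) (b k).
pose e2 i j k := 'D_(E k) (graph_second_form g phi (b k) i j) 0 - t i j k.
pose e3 k := \sum_i \sum_j graph_second_form g phi (b k) i j 0
  * 'D_(E k) (fun y => invmx ((conformal_factor r y)%:M + pullback g phi y)) 0 i j.
pose T := s * (s ^+ 2 + H ^+ 2).
have T0 : 0 <= T by rewrite mulr_ge0 // addr_ge0 // sqr_ge0.
have m6 : 6 * (kap ^+ 2 * T) <= K * T.
  by rewrite mulrA; exact: (ler_wpM2r T0 K6).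
have sz : s = 0.
  apply: (eP (g w0) (invmx h) b f t (energy_error g phi) e2 e3 s H se s1 sb Hf (gs Ow0) cP).
  - move=> v w; apply: le_trans (inner_norm_le kapd kapg (lexx _) (lexx _)) _.
    by rewrite mulrA -expr2; exact: (ler_wpM2r (mulr_ge0 (normr_ge0 v) (normr_ge0 w)) K2).
  - move=> i j; apply: le_trans (graph_metric_inv_le VO V0 i j) _.
    exact: Kk.
  - exact: XE.
  - move=> i j k; apply: le_trans m6.
    exact: (energy_error_le oV Cphi VO V0 phi0 s0 s1 bs fH i j k).
  - move=> i j k; apply: le_trans m6.
    exact: (graph_equation_error_le oV Cphi VO V0 phi0 s0 s1 bs fH i j k).
  - move=> k; apply: le_trans (normal_error_le oV Cphi VO V0 phi0 s0 s1 H0 bs fH k) _.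
    exact: (ler_wpM2r T0 Kr).
  - have := weighted_hessian_at_max oV V0 (Ck_graph_energy r Cg oV Cphi VO) emax hs hpos.
    congr (_ <= 0); apply: eq_bigr => i _; apply: eq_bigr => j _; congr (_ * _).
    apply: etrans (derive2_graph_energy r Cg gs oV Cphi VO V0 phi0 i j) _.
    by rewrite trP.
  - move=> k; have := derive_graph_equation r0 Cg gs gp oV Cphi VO V0 (b k) k Hmin.
    move=> E0; rewrite -[RHS]E0 /e3 -big_split; apply: eq_bigr => i _.
    rewrite -big_split; apply: eq_bigr => j _ /=.
    congr (_ + _); apply: cancel_third_order.
    by rewrite (PG k j) (PG k i) (PG k k).
move=> k; apply/eqP; rewrite -normr_le0 -sz; exact: bs.
Qed.

End Bochner_inequality.

(** * Stereographic coordinates *)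

Section Stereographic_projection.
Context {R : realType} {p : nat}.
Variable r : R.
Hypothesis r0 : 0 < r.
Opaque derive jacobian.
Implicit Types (y v : 'rV[R]_p) (x : 'rV[R]_(1 + p)) (s b : bool).

Let w y : R := (1 + norm2 y)^-1.
Let A : 'rV[R]_(1 + p) := row_mx (1%:M : 'M[R]_1) 0.
Let E : 'M[R]_(p, 1 + p) := row_mx 0 1%:M.

(** [A] is the direction of the poles and [E] the inclusion of the equatorial hyperplane. Apart from
    the linear factor y, everything depends on y through the scalar [w y] only. *)
Lemma stereo_invE s y :
  stereo_inv r s y = ((-1) ^+ s * r * (1 - 2 * w y)) *: A + (2 * r * w y) *: (y *m E).
Proof.
rewrite /stereo_inv mul_mx_row mulmx0 mulmx1 !scale_row_mx !scaler0 add_row_mx addr0 add0r.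
have w0 : 1 + norm2 y != 0 by rewrite gt_eqF // norm2D1_gt0.
congr row_mx; last by rewrite /w addrC.
apply/rowP => i; rewrite !mxE !ord1 eqxx mulr1 /w (addrC (norm2 y)).
by field.
Qed.

Let Ck_w k : Ck k setT w.
Proof.
apply: (CkV openT) => [y _|]; first by rewrite gt_eqF // norm2D1_gt0.
by apply: (CkD openT); [exact: Ck_cst|exact: (Ck_norm2 k openT)].
Qed.

Let Ck_coef k s : Ck k setT (fun y => (-1) ^+ s * r * (1 - 2 * w y)).
Proof.
apply: (CkM openT); first exact: Ck_cst.
apply: (CkD openT); first exact: Ck_cst.
apply: (CkN openT); apply: (CkM openT); [exact: Ck_cst|exact: Ck_w].
Qed.

Let Ck_coef2 k : Ck k setT (fun y => 2 * r * w y).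
Proof. by apply: (CkM openT); [exact: Ck_cst|exact: Ck_w]. Qed.

Let Ck_yE k : Ck k setT (fun y => y *m E).
Proof. by apply: (Ck_mulmx openT); [exact: Ck_id|exact: Ck_cst]. Qed.

Lemma Ck_stereo_inv k s : Ck k setT (stereo_inv r s : 'rV[R]_p -> 'rV[R]_(1 + p)).
Proof.
have -> : stereo_inv r s = fun y : 'rV[R]_p =>
    ((-1) ^+ s * r * (1 - 2 * w y)) *: A + (2 * r * w y) *: (y *m E).
  by apply/funext => y; exact: stereo_invE.
apply: (CkD openT).
  exact: (CkZ openT (Ck_coef k s) (Ck_cst _ _ _)).
exact: (CkZ openT (Ck_coef2 k) (Ck_yE k)).
Qed.

Let derive_w y v : 'D_v w y = - 2 * w y ^+ 2 * dot y v.
Proof.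
rewrite (derive_inv_fun _ (differentiable_norm2D1 y)) ?gt_eqF ?norm2D1_gt0 //.
by rewrite derive_norm2D1 /w exprVn; ring.
Qed.

Let derive_scale (f : 'rV[R]_p -> R) n (h : 'rV[R]_p -> 'rV[R]_n) y v :
  differentiable f y -> differentiable h y ->
  'D_v (fun z => f z *: h z) y = 'D_v f y *: h y + f y *: 'D_v h y.
Proof.
move=> df dh.
exact: (derive_bilinear (B := ( *:%R : {bilinear R -> 'rV[R]_n -> _})) v (@scale_continuous _ _) df dh).
Qed.

Lemma derive_stereo_inv s y v :
  'D_v (stereo_inv r s) y = ((-1) ^+ s * r * (4 * w y ^+ 2 * dot y v)) *: A
    + (2 * r * w y) *: ((v - (2 * w y * dot y v) *: y) *m E).
Proof.
have D1 := Ck_differentiable (Ck_coef 1 s) (I : setT y).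
have D2 := Ck_differentiable (Ck_coef2 1) (I : setT y).
have D3 := Ck_differentiable (Ck_yE 1) (I : setT y).
have Dw := Ck_differentiable (Ck_w 1) (I : setT y).
have DA : differentiable (cst A : 'rV[R]_p -> _) y by exact: differentiable_cst.
have -> : stereo_inv r s = (fun y => ((-1) ^+ s * r * (1 - 2 * w y)) *: cst A y)
    + (fun y : 'rV[R]_p => (2 * r * w y) *: (y *m E)).
  by apply/funext => z; exact: stereo_invE.
have DL : differentiable (fun y => ((-1) ^+ s * r * (1 - 2 * w y)) *: cst A y) y.
  by exact: (Ck_differentiable (CkZ openT (Ck_coef 1 s) (Ck_cst 1 setT A)) I).
have DR : differentiable (fun y => (2 * r * w y) *: (y *m E)) y.
  by exact: (Ck_differentiable (CkZ openT (Ck_coef2 1) (Ck_yE 1)) I).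
apply: etrans (deriveD (diff_derivable DL) (diff_derivable DR)) _.
rewrite (derive_scale v D1 DA) (derive_scale v D2 D3).
have -> : 'D_v (cst A) y = 0 by exact: derive_cst.
have -> : 'D_v (fun z => z *m E) y = v *m E.
  have -> : (fun z : 'rV[R]_p => z *m E) = (mulmxr E \o id) by [].
  rewrite (derive_linear (L := mulmxr E)) //=; first by rewrite derive_id.
  by move=> z; apply: (Ck_continuous (Ck_yE 0)).
have -> : 'D_v (fun y => 2 * r * w y) y = 2 * r * (- 2 * w y ^+ 2 * dot y v).
  by rewrite (derive_cmul_fun _ v Dw) derive_w.
have -> : 'D_v (fun y => (-1) ^+ s * r * (1 - 2 * w y)) y
    = (-1) ^+ s * r * (4 * w y ^+ 2 * dot y v).
  have D4 : differentiable (fun y => 1 - 2 * w y) y.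
    apply: (Ck_differentiable (k := 0) (U := setT)) => //; apply: (CkD openT); first exact: Ck_cst.
    apply: (CkN openT); apply: (CkM openT); [exact: Ck_cst|exact: (Ck_w 1)].
  rewrite (derive_cmul_fun _ v D4); congr (_ * _).
  have D5 : differentiable (fun y => 2 * w y) y.
    apply: (Ck_differentiable (k := 0) (U := setT)) => //.
    apply: (CkM openT); [exact: Ck_cst|exact: (Ck_w 1)].
  rewrite (derive_sub_fun (f := cst 1) v (differentiable_cst _ _) D5) derive_cst.
  by rewrite (derive_cmul_fun _ v Dw) derive_w; ring.
rewrite scaler0 addr0 /cst; congr (_ + _).
rewrite mulmxBl -scalemxAl scalerBr scalerA addrC; congr (_ + _).
by rewrite -scaleNr; congr (_ *: _); ring.
Qed.

Let rowAE (a c : R) v : a *: A + c *: (v *m E) = row_mx (a%:M : 'M[R]_1) (c *: v).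
Proof.
rewrite /A /E !mul_mx_row !mulmx0 !mulmx1 !scale_row_mx !scaler0 !add_row_mx addr0 add0r.
by rewrite scalemx1.
Qed.

Lemma dot_row_mx (a a' : 'M[R]_1) v v' :
  ((row_mx a v : 'rV[R]_(1 + p)) *m (row_mx a' v')^T) 0 0 = a 0 0 * a' 0 0 + dot v v'.
Proof.
by rewrite tr_row_mx mul_row_col [LHS]mxE [X in X + _]mxE big_ord1 [a'^T _ _]mxE.
Qed.

Lemma row_mx00 (a : 'M[R]_1) v : (row_mx a v : 'rV[R]_(1 + p)) 0 0 = a 0 0.
Proof.
have := row_mxEl a v 0 0; rewrite (_ : lshift p 0 = 0 :> 'I_(1 + p)) //.
exact: val_inj.
Qed.

Lemma dot_inner n (x x' : 'rV[R]_n) : dot x x' = inner 1%:M x x'.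
Proof. by rewrite /inner mulmx1. Qed.

Let inner1D (a a' c c' : R) v v' :
  inner (1%:M : 'M[R]_(1 + p)) (a *: A + c *: (v *m E)) (a' *: A + c' *: (v' *m E))
  = a * a' + c * c' * dot v v'.
Proof.
rewrite /inner mulmx1 !rowAE dot_row_mx !mxE !eqxx !mulr1n.
by rewrite !dotE mulr_sumr; congr (_ + _); apply: eq_bigr => i _; rewrite !mxE; ring.
Qed.

(** Conformality of stereographic projection: the terms in y_i y_j from the polar and equatorial
    components cancel because of w (1 + |y|^2) = 1. *)
Lemma pullback_stereo_inv s y :
  pullback (fun=> 1%:M) (stereo_inv r s) y = (conformal_factor r y)%:M.
Proof.
have D := Ck_differentiable (Ck_stereo_inv 1 s) (I : setT y).
apply/matrixP => i j; rewrite -[LHS]inner_delta pullback_inner.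
rewrite -!rowE !(jacobian_row _ D) !derive_stereo_inv inner1D.
have ww : w y * (1 + norm2 y) = 1 by rewrite mulVf // gt_eqF // norm2D1_gt0.
have ss : (-1) ^+ s * (-1) ^+ s = 1 :> R by rewrite -expr2 sqrr_sign.
have -> : conformal_factor r y = 4 * r ^+ 2 * w y ^+ 2 by rewrite /conformal_factor /w exprVn.
have e1 (a c : R) (u v z : 'rV[R]_p) : dot (u - a *: z) (v - c *: z)
    = dot u v - c * dot z u - a * dot z v + a * c * norm2 z.
  rewrite -[norm2 z]/(dot z z) (dotC z u) !dot_inner !(innerDl, innerDr, innerNl, innerNr).
  by rewrite !(innerZl, innerZr); ring.
rewrite e1 !dot_delta [in RHS]mxE -mulr_natr !mxE !eqxx /=.
move: (y 0 i) (y 0 j) (w y) (norm2 y) ((-1) ^+ s : R) ww ss => a c u t e ut es.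
rewrite -[in RHS](mulr1 (_ ^+ 2)) -[in LHS](mulr1 2).
transitivity ((e * e) * (16 * r ^+ 2 * u ^+ 4 * a * c) + 4 * r ^+ 2 * u ^+ 2
  * ((j == i)%:R - 4 * u * a * c + 4 * u * a * c * (u * (1 + t) - u))); first by ring.
by rewrite es ut (eq_sym j); ring.
Qed.

Definition stereo b x : 'rV[R]_p := (r - (-1) ^+ b * x 0 0)^-1 *: rsubmx x.

Lemma stereo_inv00 b y : (-1) ^+ b * stereo_inv r b y 0 0 = r * (1 - 2 * w y).
Proof.
have ss : (-1) ^+ b * (-1) ^+ b = 1 :> R by rewrite -expr2 sqrr_sign.
by rewrite stereo_invE rowAE row_mx00 mxE eqxx mulr1n !mulrA ss mul1r.
Qed.

Lemma stereo_inv_dom b y : (-1) ^+ b * stereo_inv r b y 0 0 != r.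
Proof.
rewrite stereo_inv00; apply/negP => /eqP E1.
have : r * w y = 0 by move: E1; move: (w y) r => u t; lra.
by apply/eqP; rewrite mulf_neq0 ?gt_eqF // /w invr_gt0 norm2D1_gt0.
Qed.

Lemma stereo_invK b y : stereo b (stereo_inv r b y) = y.
Proof.
rewrite /stereo stereo_inv00 /stereo_inv row_mxKr scalerA (addrC (norm2 y)) -/(w y).
rewrite (_ : _ * _ = 1) ?scale1r //.
have w0 : w y != 0 by rewrite gt_eqF // /w invr_gt0 norm2D1_gt0.
rewrite (_ : r - _ = 2 * r * w y); last by ring.
have n0 : 2 * r * w y != 0 by rewrite mulf_neq0 // mulf_neq0 ?pnatr_eq0 ?gt_eqF.
exact: (mulVf n0).
Qed.

Lemma norm2Z n a (z : 'rV[R]_n) : norm2 (a *: z) = a ^+ 2 * norm2 z.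
Proof.
have nE (x : 'rV[R]_n) : norm2 x = inner 1%:M x x by rewrite /inner mulmx1.
by rewrite !nE innerZl innerZr mulrA.
Qed.

Lemma stereoK b x : norm2 x = r ^+ 2 -> (-1) ^+ b * x 0 0 != r ->
  stereo_inv r b (stereo b x) = x.
Proof.
have ss : (-1) ^+ b * (-1) ^+ b = 1 :> R by rewrite -expr2 sqrr_sign.
rewrite -(hsubmxK x); move: (lsubmx x) (rsubmx x) => a z.
rewrite /stereo /stereo_inv row_mx00 row_mxKr; set t := a 0 0.
have nx : norm2 (row_mx a z) = t ^+ 2 + norm2 z.
  by rewrite /norm2 dot_row_mx -expr2.
rewrite nx => nz xr.
have c0 : r - (-1) ^+ b * t != 0 by rewrite subr_eq0 eq_sym.
(* The norm of z squared is r^2 - t^2, which factors as (r - e t) (r + e t) with e = (-1)^b. *)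
have nE : norm2 ((r - (-1) ^+ b * t)^-1 *: z)
    = (r + (-1) ^+ b * t) / (r - (-1) ^+ b * t).
  rewrite norm2Z.
  have -> : norm2 z = r ^+ 2 - ((-1) ^+ b * (-1) ^+ b) * t ^+ 2 by rewrite ss; lra.
  by field.
rewrite nE; set e : R := (-1) ^+ b in ss c0 *.
have d0 : (r + e * t) / (r - e * t) + 1 != 0.
  rewrite (_ : _ + 1 = 2 * r / (r - e * t)); last by field.
  by rewrite mulf_neq0 ?invr_eq0 // mulf_neq0 ?pnatr_eq0 ?gt_eqF.
have r1 : r != 0 by rewrite gt_eqF.
congr row_mx.
  apply/rowP => i; rewrite mxE ord1 -/t; transitivity (e * e * t); last by rewrite ss mul1r.
  field; apply/andP; split=> //.
  by rewrite (_ : _ + _ = 2 * r) ?mulf_neq0 //; ring.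
rewrite scalerA (_ : _ * _ = 1) ?scale1r //; field; apply/andP; split=> //.
by rewrite (_ : _ + _ = 2 * r) ?mulf_neq0 //; ring.
Qed.

Lemma Ck_stereo k b (U : set 'rV[R]_(1 + p)) : open U ->
  (forall x, U x -> (-1) ^+ b * x 0 0 != r) -> Ck k U (stereo b).
Proof.
move=> oU Ub; apply: (CkZ oU).
  apply: (CkV oU) => [x /Ub|]; first by rewrite subr_eq0 eq_sym.
  apply: (CkD oU); first exact: Ck_cst.
  apply: (CkN oU); apply: (CkM oU); first exact: Ck_cst.
  by apply: (Ck_entry 0 0 oU); exact: Ck_id.
apply: (Ck_mx oU) => i j; under eq_fun do rewrite mxE.
by apply: (Ck_entry _ _ oU); exact: Ck_id.
Qed.

Lemma stereo_inv0 b : stereo_inv r b (0 : 'rV[R]_p) = - ((-1) ^+ b * r) *: A.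
Proof.
rewrite stereo_invE /w norm2_0 mul0mx scaler0 !addr0 invr1; congr (_ *: _).
by move: ((-1) ^+ b : R) => e; lra.
Qed.

Lemma norm2_orthogonal n (Q : 'M[R]_n) (x : 'rV[R]_n) : Q *m Q^T = 1%:M ->
  norm2 (x *m Q) = norm2 x.
Proof. by move=> QQ; rewrite /norm2 trmx_mul mulmxA -(mulmxA x) QQ mulmx1. Qed.

(* The Householder reflection exchanging x and a pole. *)
Lemma rotation_to_pole x : norm2 x = r ^+ 2 ->
  exists (Q : 'M[R]_(1 + p)) b, Q *m Q^T = 1%:M /\ x *m Q = stereo_inv r b 0.
Proof.
move=> nx.
have nA : norm2 A = 1.
  by rewrite /norm2 dot_row_mx mxE eqxx mulr1 -[dot 0 0]/(norm2 0) norm2_0 addr0.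
(* A reflection exchanging x and its target needs them distinct; if x is the centre of one chart,
   the centre of the other is the target. *)
have [b xb] : exists b, dot x (stereo_inv r b 0) != r ^+ 2.
  have e b : dot x (stereo_inv r b 0) = - ((-1) ^+ b * dot x (r *: A)).
    by rewrite stereo_inv0 !dot_inner !innerZr; ring.
  case: (eqVneq (dot x (stereo_inv r false 0)) (r ^+ 2)) => [E1|]; last by exists false.
  exists true; rewrite e; move: E1; rewrite e expr0 expr1 mul1r mulN1r opprK => /eqP.
  rewrite eqr_oppLR => /eqP ->; apply/negP => /eqP; have : 0 < r ^+ 2 by exact: exprn_gt0.
  by move: (r ^+ 2) => t; lra.
set t := stereo_inv r b 0 in xb.
have nt : norm2 t = r ^+ 2.
  by have := stereo_inv_sphere r b (0 : 'rV[R]_p); rewrite inE.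
pose v := x - t; pose c := norm2 v.
have dE (z z' : 'rV[R]_(1 + p)) : (z *m z'^T) = (dot z z')%:M.
  by rewrite [LHS]mx11_scalar.
have cE : c = 2 * (r ^+ 2 - dot x t).
  rewrite /c -[norm2 v]/(dot v v) /v dot_inner !(innerDl, innerDr, innerNl, innerNr).
  by rewrite -!dot_inner (dotC t x) -/(norm2 x) -/(norm2 t) -[dot x x]/(norm2 x) nx
    -[dot t t]/(norm2 t) nt; ring.
have c0 : c != 0 by rewrite cE mulf_neq0 // subr_eq0 eq_sym.
pose W : 'M[R]_(1 + p) := v^T *m v.
exists (1%:M - (2 / c) *: W), b.
have WT : W^T = W by rewrite /W trmx_mul trmxK.
have WW : W *m W = c *: W.
  by rewrite /W mulmxA -(mulmxA _ v) dE mul_mx_scalar -scalemxAl.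
have xW : x *m W = dot x v *: v by rewrite /W mulmxA dE mul_scalar_mx.
clearbody W; split.
  have QT : (1%:M - (2 / c) *: W)^T = 1%:M - (2 / c) *: W.
    by apply/matrixP => i j; rewrite -[in RHS]WT !mxE eq_sym.
  have aa : (2 / c) *: ((2 / c) *: (c *: W)) = (2 / c) *: W + (2 / c) *: W.
    by rewrite !scalerA -scalerDl; congr (_ *: _); field.
  rewrite QT mulmxBl mul1mx mulmxBr mulmx1 -scalemxAl -scalemxAr WW aa.
  by rewrite opprB !addrA subrK addrK.
rewrite mulmxBr mulmx1 -scalemxAr xW scalerA.
have -> : dot x v = c / 2.
  rewrite cE /v dot_inner innerDr innerNr -!dot_inner -[dot x x]/(norm2 x) nx.
  by field.
rewrite (_ : _ * _ = 1) ?scale1r; last by field.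
by rewrite /v opprB addrCA subrr addr0.
Qed.

End Stereographic_projection.

(** * Isometries read in charts *)

Section Coordinate_changes.
Context {R : realType}.
Opaque derive jacobian.

(** An isometry relates two invertible Gram matrices by congruence with its Jacobian, which is
    therefore invertible. Used for rotations of the sphere and for isometries of X_2. *)
Lemma congruence_unitmx n (A G : 'M[R]_n) : A *m G *m A^T \in unitmx -> A \in unitmx.
Proof. by rewrite !unitmx_mul => /andP[/andP[]]. Qed.

Lemma open_neq (V : normedModType R) (f : V -> R) (c : R) :
  continuous f -> open [set x | f x != c].
Proof.
move=> cf; have -> : [set x | f x != c] = f @^-1` (~` [set c]).
  by apply/seteqP; split=> x /= /eqP.
by apply: open_comp => [x _|]; [exact: cf|exact: closed_openC].
Qed.

Lemma open_entry_neq n (e c : R) (i : 'I_n) : open [set x : 'rV[R]_n | e * x 0 i != c].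
Proof.
apply: open_neq => x; apply: (Ck_continuous (k := 0) (U := setT)) => //.
apply: (CkM openT); first exact: Ck_cst.
by apply: (Ck_entry 0 i openT); exact: Ck_id.
Qed.

Section Sphere_coordinates.
Context {p : nat}.
Variables (r : R) (r0 : 0 < r) (s b : bool) (Q : 'M[R]_(1 + p)).
Hypothesis QQ : Q *m Q^T = 1%:M.

(** The orthogonal map Q of the sphere read in the charts s and b. It will carry a given point to
    the centre of the chart b. *)
Definition sphere_transition (y : 'rV[R]_p) : 'rV[R]_p := stereo r b (stereo_inv r s y *m Q).
Definition sphere_transition_dom : set 'rV[R]_p :=
  [set y | (-1) ^+ b * (stereo_inv r s y *m Q) 0 0 != r].

Let Ck_rotated k : Ck k setT (fun y => stereo_inv r s y *m Q).
Proof. by apply: (Ck_mulmx openT (Ck_stereo_inv r k s)); exact: Ck_cst. Qed.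

Lemma open_sphere_transition_dom : open sphere_transition_dom.
Proof.
apply: open_neq => y; apply: (Ck_continuous (k := 0) (U := setT)) => //.
apply: (CkM openT); first exact: Ck_cst.
exact: (Ck_entry 0 0 openT (Ck_rotated 0)).
Qed.

Let O := sphere_transition_dom.
Let oO : open O := open_sphere_transition_dom.

Lemma smooth_sphere_transition : smooth_on O sphere_transition.
Proof.
move=> k; apply: (@Ck_comp _ _ _ _ _ _ [set x | (-1) ^+ b * x 0 0 != r]) => //.
  exact: Ck_subset (Ck_rotated k).
by apply: Ck_stereo => //; exact: open_entry_neq.
Qed.

Lemma sphere_transitionE y : O y -> stereo_inv r b (sphere_transition y) = stereo_inv r s y *m Q.
Proof.
move=> Oy; apply: (stereoK r0) => //; rewrite norm2_orthogonal //.
by have := stereo_inv_sphere r s y; rewrite inE.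
Qed.

Lemma sphere_transition_pullback y : O y ->
  (conformal_factor r y)%:M = pullback (fun z => (conformal_factor r z)%:M) sphere_transition y.
Proof.
move=> Oy.
have dT : differentiable sphere_transition y.
  exact: (Ck_differentiable (smooth_sphere_transition 1) Oy).
have di (c : bool) z : differentiable (stereo_inv r c : 'rV[R]_p -> _) z.
  exact: (Ck_differentiable (Ck_stereo_inv r 1 c) (I : setT z)).
have dr := Ck_differentiable (Ck_rotated 1) (I : setT y).
transitivity (pullback (fun=> 1%:M) (stereo_inv r b \o sphere_transition) y); last first.
  by rewrite (pullback_comp _ dT (di b _)) pullback_stereo_inv.
rewrite -(pullback_stereo_inv r s).
have nE : \near y, (stereo_inv r b \o sphere_transition) y = stereo_inv r s y *m Q.
  by apply: (near_open oO Oy) => z Oz; exact: sphere_transitionE.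
have cQ : continuous (mulmxr Q : 'rV[R]_(1 + p) -> 'rV[R]_(1 + p)).
  move=> z; have C : Ck 0 setT (fun x : 'rV[R]_(1 + p) => x *m Q).
    by apply: (Ck_mulmx openT); [exact: Ck_id|exact: Ck_cst].
  exact: (Ck_continuous C (I : setT z)).
have JE : 'J (stereo_inv r b \o sphere_transition) y = 'J (stereo_inv r s) y *m Q.
  have dc : differentiable (stereo_inv r b \o sphere_transition) y by exact: differentiable_comp.
  apply/row_matrixP => i; rewrite (jacobian_row _ dc) row_mul (jacobian_row _ (di s y)).
  rewrite (near_eq_derive (delta_mx 0 i) nE).
  rewrite (_ : (fun z => _) = mulmxr Q \o stereo_inv r s) //.
  exact: (derive_linear (L := mulmxr Q) _ cQ (di s y)).
by rewrite /pullback JE !mulmx1 trmx_mul mulmxA -(mulmxA _ Q) QQ mulmx1.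
Qed.

Lemma sphere_transition_unit y : O y -> 'J sphere_transition y \in unitmx.
Proof.
move=> /sphere_transition_pullback; rewrite /pullback => E1.
apply: (@congruence_unitmx _ _ (conformal_factor r (sphere_transition y))%:M); rewrite -E1.
by rewrite unitmxE det_scalar unitfE expf_neq0 // gt_eqF // conformal_factor_gt0.
Qed.

End Sphere_coordinates.

Lemma open_chart_image d (X : charted R d) (j : chart_index X) (W : set X) :
  is_manifold X -> open W -> W `<=` chart_dom j -> open (chart j @` W).
Proof.
move=> mX oW Wj.
have -> : chart j @` W = chart_img j `&` chart_inv j @^-1` W.
  apply/seteqP; split=> [_ [x Wx <-]|_ [[x jx <-]]] /=.
    by split; [exists x => //; exact: Wj|rewrite (mfd_chartK mX) //; exact: Wj].
  by rewrite (mfd_chartK mX) // => Wx; exists x.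
rewrite openE => y [jy Wy]; rewrite /interior; apply: filterI.
  by apply: open_nbhs_nbhs; split=> //; exact: mfd_open_img.
by apply: (mfd_chart_inv_cont mX jy); apply: open_nbhs_nbhs.
Qed.

Section Isometry_in_charts.
Variables (d : nat) (X : riemannian R d) (h : X -> X) (j k : chart_index X).
Hypotheses (rX : is_riemannian X) (ih : isometric_map h).

Let mX := riem_manifold rX.
Definition isometry_dom : set 'rV[R]_d := chart j @` (chart_dom j `&` h @^-1` chart_dom k).
Let O := isometry_dom.
Let T := chart k \o h \o chart_inv j.

Lemma open_isometry_dom : open O.
Proof.
apply: (open_chart_image mX); last by move=> x [].
apply: openI; first exact: (mfd_open_dom mX).
apply: open_comp => [x _|]; last exact: (mfd_open_dom mX).
by case: ih => -[ch _] _; exact: ch.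
Qed.

Lemma isometry_pullback y : O y -> metric j y = pullback (metric k) T y.
Proof. by move=> [x [jx kx] <-]; case: ih => _; apply. Qed.

Lemma metric_unit (i : chart_index X) y : chart_img i y -> metric i y \in unitmx.
Proof. by move=> iy; apply: posdef_unitmx; exact: riem_pos. Qed.

Lemma isometry_unit y : O y -> 'J T y \in unitmx.
Proof.
move=> Oy; have := isometry_pullback Oy; rewrite /pullback => E1.
apply: (@congruence_unitmx _ _ (metric k (T y))); rewrite -E1; apply: metric_unit.
by case: Oy => x [jx _] <-; exists x.
Qed.

Lemma isometry_smooth : smooth_on O T.
Proof. by case: ih => -[_ sh] _; exact: sh. Qed.

End Isometry_in_charts.

Lemma Ck_metric d (X : riemannian R d) (i : chart_index X) k :
  is_riemannian X -> Ck k (chart_img i) (metric i).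
Proof.
move=> rX; have oi := @mfd_open_img _ _ _ (riem_manifold rX) i.
by apply: (Ck_mx oi) => a b; exact: (riem_smooth rX).
Qed.

Lemma jacobian_near m n (F F' : 'rV[R]_m -> 'rV[R]_n) u :
  differentiable F u -> (\near u, F u = F' u) -> 'J F u = 'J F' u.
Proof.
move=> dF nF; have dF' := near_differentiable nF dF; apply/row_matrixP => i.
apply: etrans (jacobian_row i dF) _; apply: etrans _ (esym (jacobian_row i dF')).
exact: (near_eq_derive (delta_mx 0 i) nF).
Qed.

Lemma pullback_near m n (g : 'rV[R]_n -> 'M[R]_n) (F F' : 'rV[R]_m -> 'rV[R]_n) u :
  differentiable F u -> (\near u, F u = F' u) -> pullback g F u = pullback g F' u.
Proof.
by move=> dF nF; rewrite /pullback (nbhs_singleton nF) (jacobian_near dF nF).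
Qed.

Lemma second_form_near m n (g : 'rV[R]_n -> 'M[R]_n) (F F' : 'rV[R]_m -> 'rV[R]_n) u nu :
  (\near u, F u = F' u) -> second_form g F u nu = second_form g F' u nu.
Proof.
move=> nF; have nD v : \near u, 'D_v F u = 'D_v F' u.
  by apply: filterS (near_join nF) => w; exact: near_eq_derive.
pose S x A B : 'M[R]_m :=
  \matrix_(i, j) (inner (g x) (A i j) nu + koszul g x (B i) (B j) nu).
have SE G : second_form g G u nu = S (G u)
    (fun i j => 'D_(delta_mx 0 i) ('D_(delta_mx 0 j) G) u) (fun i => 'D_(delta_mx 0 i) G u) by [].
apply: etrans (SE F) _; apply: etrans _ (esym (SE F')).
have E1 : (fun i j => 'D_(delta_mx 0 i) ('D_(delta_mx 0 j) F) u)
    = (fun i j => 'D_(delta_mx 0 i) ('D_(delta_mx 0 j) F') u).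
  apply/funext => i; apply/funext => j.
  exact: (near_eq_derive (delta_mx 0 i) (nD (delta_mx 0 j))).
have E2 : (fun i => 'D_(delta_mx 0 i) F u) = (fun i => 'D_(delta_mx 0 i) F' u).
  by apply/funext => i; exact: (near_eq_derive (delta_mx 0 i) nF).
exact: (f_equal3 S (nbhs_singleton nF) E1 E2).
Qed.

(** A composite of coordinate changes agrees with the identity only on a neighbourhood; minimality
    at a point depends on no more than that. *)
Lemma minimal_pair_near m n1 n2 (g1 : 'rV[R]_n1 -> 'M[R]_n1) (F1 F1' : 'rV[R]_m -> 'rV[R]_n1)
    (g2 : 'rV[R]_n2 -> 'M[R]_n2) (F2 : 'rV[R]_m -> 'rV[R]_n2) u :
  differentiable F1 u -> (\near u, F1 u = F1' u) ->
  minimal_pair g1 F1 g2 F2 u -> minimal_pair g1 F1' g2 F2 u.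
Proof.
move=> dF nF H nu1 nu2.
rewrite -(jacobian_near dF nF) -(nbhs_singleton nF) => /H.
by rewrite (second_form_near _ _ nF) (pullback_near _ dF nF).
Qed.

End Coordinate_changes.

(** * Submanifolds of the product *)

Section Product_submanifold.
Context {R : realType} {p d : nat}.
Variables (r : R) (r0 : 0 < r) (X : riemannian R d) (rX : is_riemannian X).
Local Notation S := (sphere p r).
Local Notation N := (prod_riemannian S X).
Local Notation pchart s j := (@chart R (p + d) N (s, j)).
Local Notation pmetric s j := (@metric R (p + d) N (s, j)).
Opaque derive jacobian.

Let mX := riem_manifold rX.

Lemma sphere_val_continuous : continuous (fun x : S => val x : 'rV[R]_(1 + p)).
Proof. exact: initial_continuous. Qed.

Lemma sphere_valE (x : S) : norm2 (val x) = r ^+ 2.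
Proof. by have := valP x; rewrite inE. Qed.

Lemma open_sphere_dom (s : bool) : open (@chart_dom R p S s).
Proof.
apply: (@open_comp _ _ (fun x : S => val x : 'rV[R]_(1 + p)) [set x | (-1) ^+ s * x 0 0 != r]).
  by move=> x _; exact: sphere_val_continuous.
exact: open_entry_neq.
Qed.

Lemma sphere_dom_cover (x : S) : exists s : bool, @chart_dom R p S s x.
Proof.
have [E1|] := eqVneq ((-1) ^+ false * val x 0 0) r; last by exists false.
exists true; rewrite /= expr1 mulN1r; move: E1; rewrite expr0 mul1r => ->.
by rewrite lt_eqF // (@lt_trans _ _ 0) // oppr_lt0.
Qed.

Definition normal_sphere_metric : 'rV[R]_p -> 'M[R]_p := fun y => (conformal_factor r y)%:M.

Lemma sphere_metricE (s : bool) : @metric R p S s = normal_sphere_metric.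
Proof. by apply/funext => y; exact: pullback_stereo_inv. Qed.

Lemma Ck_sphere_metric k (O : set 'rV[R]_p) : open O -> Ck k O normal_sphere_metric.
Proof.
move=> oO; apply: (Ck_mx oO) => i j; under eq_fun do rewrite mxE.
case: (i == j); first exact: Ck_conformal_factor.
exact: Ck_cst.
Qed.

Lemma sphere_metric_sym y : (normal_sphere_metric y)^T = normal_sphere_metric y.
Proof. exact: tr_scalar_mx. Qed.

Lemma inner_scalar n (a : R) (v w : 'rV[R]_n) : inner a%:M v w = a * dot v w.
Proof. by rewrite dot_inner -inner_mxZ scalemx1. Qed.

Lemma sphere_metric_pos y v : v != 0 -> 0 < inner (normal_sphere_metric y) v v.
Proof. by move=> v0; rewrite inner_scalar mulr_gt0 // ?conformal_factor_gt0 // dot_gt0. Qed.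

Section Parametrization.
Variables (M : set N) (U : set 'rV[R]_p) (f : 'rV[R]_p -> N) (lp : local_param M U f).

Definition coord1 (s : bool) (h : 'rV[R]_p -> N) (w : 'rV[R]_p) : 'rV[R]_p :=
  stereo r s (val (h w).1).
Definition coord2 (j : chart_index X) (h : 'rV[R]_p -> N) (w : 'rV[R]_p) : 'rV[R]_d :=
  chart j (h w).2.
(** The sphere component as a vector of R^(1+p). No chart of the sphere is involved, so neither does
    the energy depend on one. *)
Definition embedded1 (h : 'rV[R]_p -> N) (w : 'rV[R]_p) : 'rV[R]_(1 + p) := val (h w).1.

Definition param_dom (s : bool) (j : chart_index X) : set 'rV[R]_p :=
  U `&` f @^-1` (@chart_dom R (p + d) N (s, j)).

Lemma open_preimage (B : set N) : open B -> open (U `&` f @^-1` B).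
Proof.
move=> oB; rewrite openE => u [Uu Bu]; rewrite /interior; apply: filterI.
  by apply: open_nbhs_nbhs; split=> //; exact: lp_open lp.
by apply: (lp_cont lp Uu); apply: open_nbhs_nbhs; split.
Qed.

Lemma open_prod_dom (s : bool) (j : chart_index X) : open (@chart_dom R (p + d) N (s, j)).
Proof.
rewrite openE => -[x y] [/= sx jy]; exists (@chart_dom R p S s, chart_dom j) => //=.
split; apply: open_nbhs_nbhs; split=> //; [exact: open_sphere_dom|exact: mfd_open_dom].
Qed.

Lemma open_param_dom s j : open (param_dom s j).
Proof. by apply: open_preimage; exact: open_prod_dom. Qed.

Lemma coord1E s j : (fun w => lsubmx ((pchart s j \o f) w)) = coord1 s f.
Proof. by apply/funext => w /=; rewrite row_mxKl. Qed.

Lemma coord2E s j : (fun w => rsubmx ((pchart s j \o f) w)) = coord2 j f.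
Proof. by apply/funext => w /=; rewrite row_mxKr. Qed.

Lemma smooth_coord s j :
  smooth_on (param_dom s j) (coord1 s f) /\ smooth_on (param_dom s j) (coord2 j f).
Proof.
have sf k := lp_smooth lp (s, j) k.
have oU := @open_param_dom s j.
split=> k.
  rewrite -(coord1E s j); exact: (Ck_linear_comp oU (@lsubmx_continuous R 1 p d) (sf k)).
rewrite -(coord2E s j); exact: (Ck_linear_comp oU (@rsubmx_continuous R 1 p d) (sf k)).
Qed.

Lemma embedded1E s j w : param_dom s j w -> embedded1 f w = stereo_inv r s (coord1 s f w).
Proof. by move=> [Uw [sw _]]; rewrite /coord1 (stereoK r0) //; exact: sphere_valE. Qed.

Lemma Ck_embedded1 k s j : Ck k (param_dom s j) (embedded1 f).
Proof.
have oU := @open_param_dom s j.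
apply: (eq_Ck oU (fun w Uw => esym (embedded1E Uw))).
exact: (Ck_comp oU (fun _ _ => I) ((smooth_coord s j).1 k) (Ck_stereo_inv r k s)).
Qed.

Lemma coord1_pullback s j u : param_dom s j u ->
  pullback (fun=> 1%:M) (embedded1 f) u = pullback normal_sphere_metric (coord1 s f) u.
Proof.
move=> Uu; have oU := @open_param_dom s j.
have d1 := Ck_differentiable ((smooth_coord s j).1 1%N) Uu.
have ds : differentiable (stereo_inv r s) (coord1 s f u).
  exact: (Ck_differentiable (Ck_stereo_inv r 1 s) (I : setT _)).
have nE : \near u, embedded1 f u = (stereo_inv r s \o coord1 s f) u.
  by apply: (near_open oU Uu) => w Uw; exact: embedded1E Uw.
have dE := Ck_differentiable (Ck_embedded1 1 s j) Uu.
by rewrite (pullback_near _ dE nE) (pullback_comp _ d1 ds) pullback_stereo_inv.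
Qed.

(** With h the identity it compares two charts of X. *)
Lemma isometry_coord2_pullback (h : X -> X) j k u s : isometric_map h ->
  param_dom s j u -> chart_dom k (h (f u).2) ->
  pullback (metric j) (coord2 j f) u
    = pullback (metric k) (fun w => chart k (h (f w).2)) u.
Proof.
move=> ih Uu kx; have oU := @open_param_dom s j.
have Ou : isometry_dom h j k (coord2 j f u).
  by case: Uu => _ [_ ju]; exists (f u).2.
have d2 := Ck_differentiable ((smooth_coord s j).2 1%N) Uu.
have dT := Ck_differentiable (isometry_smooth j k ih 1%N) Ou.
have nE : \near u, ((chart k \o h \o chart_inv j) \o coord2 j f) u = chart k (h (f u).2).
  apply: (near_open oU Uu) => w [_ [_ jw]].
  by rewrite /coord2 /= (mfd_chartK mX).
have dc := differentiable_comp d2 dT.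
rewrite -(pullback_near _ dc nE) (pullback_comp _ d2 dT).
by rewrite {1}/pullback (isometry_pullback ih Ou).
Qed.

Lemma coord_rank s j u : param_dom s j u ->
  \rank (row_mx ('J (coord1 s f) u) ('J (coord2 j f) u)) = p.
Proof.
move=> Uu; have := lp_immersion lp (proj1 Uu) (proj2 Uu).
have dF : differentiable (pchart s j \o f) u.
  exact: (Ck_differentiable (lp_smooth lp (s, j) 1%N) Uu).
rewrite -[X in \rank X](hsubmxK) -(jacobian_lsubmx dF) -(jacobian_rsubmx dF).
by rewrite (coord1E s j) (coord2E s j).
Qed.

Lemma param_minimal_pair s j u : param_dom s j u ->
  minimal_at (pmetric s j) (pchart s j \o f) u ->
  minimal_pair normal_sphere_metric (coord1 s f) (metric j) (coord2 j f) u.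
Proof.
move=> Uu H; have oU := @open_param_dom s j.
rewrite -(coord1E s j) -(coord2E s j).
apply: (minimal_at_pair (U := param_dom s j) (O1 := setT) (O2 := chart_img j)) => //.
- by move=> w [_ [_ jw]]; split=> //; rewrite /= row_mxKr; exists (f w).2.
- exact: (lp_smooth lp (s, j) 2).
- exact: openT.
- exact: (@mfd_open_img _ _ _ mX j).
- exact: (Ck_sphere_metric 1 openT).
- exact: Ck_metric.
- by move=> y _; exact: sphere_metric_sym.
- by move=> y jy; exact: (riem_sym rX).
- by move=> y _ v; exact: sphere_metric_pos.
- by move=> y jy v; exact: (riem_pos rX).
- by move=> w Uw; exact: (lp_immersion lp (proj1 Uw) (proj2 Uw)).
- have E1 : pmetric s j = fun y =>
      block_mx (normal_sphere_metric (lsubmx y)) 0 0 (metric j (rsubmx y)).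
    by apply/funext => y; rewrite -(sphere_metricE s).
  by rewrite -E1.
Qed.

(** The norm of pi_2 compares the part of the metric coming from X with the whole induced metric;
    here it is compared with the part coming from the sphere, as is appropriate for a graph. *)
Definition small_slope (c : R) s j u := forall Y,
  inner (pullback (metric j) (coord2 j f) u) Y Y
    <= c * inner (pullback normal_sphere_metric (coord1 s f) u) Y Y.

Lemma pullback2_ge0 s j u Y : param_dom s j u ->
  0 <= inner (pullback (metric j) (coord2 j f) u) Y Y.
Proof.
move=> [_ [_ ju]]; rewrite pullback_inner; set v := _ *m _.
have [->|v0] := eqVneq v 0; first by rewrite inner0l.
by rewrite ltW // (riem_pos rX) //; exists (f u).2.
Qed.

Lemma pullback1_ge0 s u Y : 0 <= inner (pullback normal_sphere_metric (coord1 s f) u) Y Y.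
Proof.
rewrite pullback_inner; set v := _ *m _.
have [->|v0] := eqVneq v 0; first by rewrite inner0l.
by rewrite ltW // sphere_metric_pos.
Qed.

(** The bound on pi_2 gives P2 <= L^2 (P1 + P2), and L^2 <= 1/2 lets the term L^2 P2 be absorbed,
    whence the factor 2. *)
Lemma norm_pi2_small s j u L : 0 < L -> L ^+ 2 <= 2^-1 -> param_dom s j u ->
  @norm_pi2 R p p d S X (s, j) f u < L -> small_slope (2 * L ^+ 2) s j u.
Proof.
move=> L0 L2 Uu nL Y.
set P1 := pullback normal_sphere_metric (coord1 s f) u.
set P2 := pullback (metric j) (coord2 j f) u.
have PE : pullback (pmetric s j) (pchart s j \o f) u = P1 + P2.
  have dF : differentiable (pchart s j \o f) u.
    exact: (Ck_differentiable (lp_smooth lp (s, j) 1%N) Uu).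
  apply: etrans (pullback_block (@metric R p S s) (metric j) dF) _.
  by rewrite (coord1E s j) (coord2E s j) sphere_metricE.
have P10 Z : 0 <= inner P1 Z Z by exact: pullback1_ge0.
have P20 Z : 0 <= inner P2 Z Z by exact: pullback2_ge0 Uu.
have main Z : inner (P1 + P2) Z Z = 1 -> inner P2 Z Z <= L ^+ 2.
  move=> Z1; have : Num.sqrt (inner P2 Z Z) < L.
    (* The supremum bounds the elements only of a nonempty set that is bounded above; here 1 is an
       upper bound because P2 <= P1 + P2. *)
    apply: le_lt_trans nL; rewrite /norm_pi2 /opnorm PE; apply: sup_upper_bound.
      split; first by exists (Num.sqrt (inner P2 Z Z)); exists Z => //; rewrite /P2 pullback_inner.
      exists 1 => _ [W W1 <-]; rewrite -sqrtr1 ler_wsqrtr // -W1.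
      have -> : inner (metric j (chart j (f u).2)) (W *m 'J (coord2 j f) u) (W *m 'J (coord2 j f) u)
          = inner P2 W W by rewrite /P2 pullback_inner.
      by rewrite inner_mxD lerDr.
    by exists Z => //; rewrite /P2 pullback_inner.
  by move/ltW => sL; rewrite -(sqr_sqrtr (P20 Z)) ler_sqr ?nnegrE // ?sqrtr_ge0 // ltW.
have [a0|a0] := leP (inner (P1 + P2) Y Y) 0.
  have : inner P2 Y Y <= 0 by apply: le_trans a0; rewrite inner_mxD lerDr.
  by move=> /le_trans; apply; rewrite mulr_ge0 // mulr_ge0 // sqr_ge0.
set a := inner (P1 + P2) Y Y in a0.
have sa : Num.sqrt a != 0 by rewrite gt_eqF // sqrtr_gt0.
have : inner P2 ((Num.sqrt a)^-1 *: Y) ((Num.sqrt a)^-1 *: Y) <= L ^+ 2.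
  apply: main; rewrite innerZl innerZr -/a -{3}(sqr_sqrtr (ltW a0)).
  by field.
rewrite innerZl innerZr mulrA -expr2 exprVn (sqr_sqrtr (ltW a0)) mulrC ler_pdivrMr //.
rewrite /a inner_mxD; move: (P10 Y) (P20 Y) L2 (sqr_ge0 L).
move: (inner P1 Y Y) (inner P2 Y Y) (L ^+ 2) => x y l x0 y0 l2 l0 yl.
have : l * y <= 2^-1 * y by exact: ler_wpM2r.
by rewrite -mulrA; lra.
Qed.

(** A vector killed by the differential of the sphere component is killed by that of the other
    component because of the slope bound, and then it is zero since f is an immersion. So M is
    locally a graph. *)
Lemma small_slope_unit c s j u : param_dom s j u -> small_slope c s j u ->
  'J (coord1 s f) u \in unitmx.
Proof.
move=> Uu sm; apply: unitmx_of_inj => v vJ.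
have E2 : v *m 'J (coord2 j f) u = 0.
  apply/eqP; apply: contraT => v0.
  have := sm v; rewrite !pullback_inner vJ inner0l mulr0 leNgt.
  rewrite (riem_pos rX) //; case: Uu => _ [_ ju]; by exists (f u).2.
have : v *m row_mx ('J (coord1 s f) u) ('J (coord2 j f) u) = 0.
  by rewrite mul_mx_row vJ E2 row_mx0.
move/eqP; rewrite mulmx_free_eq0 ?/row_free ?(coord_rank Uu) //.
by move/eqP.
Qed.

(** The last clause uses that f is a homeomorphism onto a relatively open part of M: every point of
    M near f u0, from whichever parametrization, is recovered from its value under Phi. *)
Lemma local_inverse (W : set 'rV[R]_p) (Phi : N -> 'rV[R]_p) u0 :
  open W -> W `<=` U -> W u0 -> smooth_on W (Phi \o f) -> 'J (Phi \o f) u0 \in unitmx ->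
  exists (V : set 'rV[R]_p) (k : 'rV[R]_p -> 'rV[R]_p),
  [/\ open V /\ smooth_on V k, V (Phi (f u0)) /\ k (Phi (f u0)) = u0,
      forall y, V y -> [/\ W (k y), Phi (f (k y)) = y, 'J (Phi \o f) (k y) \in unitmx
        & 'J k y \in unitmx]
    & exists B : set N, [/\ open B, B (f u0)
        & forall z, M z -> B z -> V (Phi z) /\ f (k (Phi z)) = z]].
Proof.
move=> oW WU Wu0 sF uJ.
have [V [k [[oV sk] [Vy ky] kP kn]]] := inverse_function oW Wu0 sF uJ.
exists V, k; split; [exact: conj oV sk|exact: conj Vy ky| |].
  move=> y Vy'; have [Wk ek uk] := kP y Vy'; split; [exact: Wk|exact: ek|exact: uk|].
  have dk := Ck_differentiable (sk 1%N) Vy'.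
  have dF := Ck_differentiable (sF 1%N) Wk.
  have nE : \near y, ((Phi \o f) \o k) y = id y.
    by apply: (near_open oV Vy') => z /kP[].
  have JJ : 'J k y *m 'J (Phi \o f) (k y) = 1%:M.
    rewrite -(jacobian_comp dk dF) (jacobian_near (differentiable_comp dk dF) nE).
    by apply/row_matrixP => i; rewrite jacobian_row // derive_id row1.
  exact: (proj1 (mulmx1_unit JJ)).
pose A := [set u | V (Phi (f u)) /\ k (Phi (f u)) = u]°.
have Au0 : A u0 by exact: kn.
have AP u : A u -> V (Phi (f u)) /\ k (Phi (f u)) = u by move=> /interior_subset.
have oA : open A by exact: open_interior.
have [B oB BE] := lp_homeo lp (openI oA oW) (subset_trans (@subIsetr _ _ _) WU).
exists B; split=> //.
  have fA : (f @` (A `&` W)) (f u0) by exists u0.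
  by move: fA; rewrite BE => -[].
move=> z Mz Bz; have : (M `&` B) z by [].
by rewrite -BE => -[u [Au Wu] <-]; have [VF kF] := AP u Au; split=> //; congr f.
Qed.

End Parametrization.
End Product_submanifold.

(** * The energy of a submanifold and its graph coordinates *)

Section Energy.
Context {R : realType} {p d : nat}.
Variables (r : R) (r0 : 0 < r) (X : riemannian R d) (rX : is_riemannian X).
Local Notation S := (sphere p r).
Local Notation N := (prod_riemannian S X).
Local Notation pchart s j := (@chart R (p + d) N (s, j)).
Local Notation pmetric s j := (@metric R (p + d) N (s, j)).
Local Notation g1 := (@normal_sphere_metric R p r).
Local Notation F1 := (@coord1 R p d r X).
Local Notation F2 := (@coord2 R p d r X).
Opaque derive jacobian.

Let mX := riem_manifold rX.

Lemma open_Ck_preimage (V : normedModType R) n (U : set V) (f : V -> 'rV[R]_n) O :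
  open U -> Ck 0 U f -> open O -> open (U `&` f @^-1` O).
Proof.
move=> oU Cf oO; rewrite openE => u [Uu Ou]; rewrite /interior; apply: filterI.
  exact: open_nbhs_nbhs.
by apply: (Cf u Uu); exact: open_nbhs_nbhs.
Qed.

Lemma jacobian_id n (y : 'rV[R]_n) : 'J (id : 'rV[R]_n -> 'rV[R]_n) y = 1%:M.
Proof.
have di : differentiable (id : 'rV[R]_n -> 'rV[R]_n) y by [].
apply/row_matrixP => i; rewrite row1; apply: etrans (jacobian_row i di) _.
exact: derive_id.
Qed.

Lemma isometric_id : isometric_map (id : X -> X).
Proof.
split; first split.
- by move=> x; exact: cvg_id.
- by move=> i j; exact: (mfd_transition mX).
- by move=> i j x ix jx; apply: (riem_transition rX); exists x.
Qed.

(** Only the chart j of X occurs; [energy_well_defined] removes the dependence on it and on the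
    parametrization. *)
Definition energy (j : chart_index X) (f : 'rV[R]_p -> N) (u : 'rV[R]_p) : R :=
  \tr (pullback (metric j) (F2 j f) u *m invmx (pullback (fun=> 1%:M) (embedded1 f) u)).

Variables (M : set N) (c : R).
Hypothesis small : forall U f, local_param M U f -> forall s j u,
  param_dom U f s j u -> small_slope f c s j u.

Lemma coord1_unit U f s j u : local_param M U f -> param_dom U f s j u ->
  'J (F1 s f) u \in unitmx.
Proof. by move=> lp Uu; exact: (small_slope_unit rX lp Uu (small lp Uu)). Qed.

Lemma pullback1_unit U f s j u : local_param M U f -> param_dom U f s j u ->
  pullback g1 (F1 s f) u \in unitmx.
Proof.
move=> lp Uu; have uJ := coord1_unit lp Uu.
rewrite /pullback !unitmx_mul unitmx_tr uJ /= andbT.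
by rewrite /normal_sphere_metric unitmxE det_scalar unitfE expf_neq0 // gt_eqF // conformal_factor_gt0.
Qed.

Lemma energy_chart U f s j k u : local_param M U f -> param_dom U f s j u ->
  chart_dom k (f u).2 -> energy j f u = energy k f u.
Proof.
move=> lp Uu ku.
exact: (congr1 (fun P => \tr (P *m _)) (isometry_coord2_pullback rX lp isometric_id Uu ku)).
Qed.

(** By [local_inverse], f' is locally f after a change of parameters, and the trace is invariant
    under the congruence that this induces. *)
Lemma energy_transition U U' f f' s j u u' :
  local_param M U f -> local_param M U' f' ->
  param_dom U f s j u -> param_dom U' f' s j u' -> f u = f' u' ->
  energy j f u = energy j f' u'.
Proof.
move=> lp lp' Uu Uu' ff; pose Phi (z : N) := stereo r s (val z.1).
have oW := @open_param_dom _ _ _ _ _ rX _ _ _ lp s j.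
have oW' := @open_param_dom _ _ _ _ _ rX _ _ _ lp' s j.
have [sF1 sF2] := smooth_coord rX lp s j.
have [sF1' sF2'] := smooth_coord rX lp' s j.
have [V [k [[oV sk] [Vy ky] kP [B [oB Bu BP]]]]] :=
  local_inverse lp oW (@subIsetl _ _ _) Uu (sF1 : smooth_on _ (Phi \o f)) (coord1_unit lp Uu).
pose kap := k \o F1 s f'.
have F1u : F1 s f' u' = Phi (f u) by rewrite ff.
have kapu : kap u' = u by rewrite /kap /= F1u.
have nE : \near u', f (kap u') = f' u'.
  have oB' := open_preimage lp' oB.
  have Bu' : (U' `&` f' @^-1` B) u' by split; [exact: (proj1 Uu')|rewrite /= -ff].
  apply: (near_open oB' Bu') => w [Uw Bw].
  have Mw : M (f' w) by apply: (lp_sub lp'); exists w.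
  exact: (proj2 (BP _ Mw Bw)).
have dF1' := Ck_differentiable (sF1' 1%N) Uu'.
have dk : differentiable k (F1 s f' u').
  by rewrite F1u; exact: (Ck_differentiable (sk 1%N) Vy).
have dkap : differentiable kap u' by exact: differentiable_comp.
have uK : 'J kap u' \in unitmx.
  have uk : 'J k (F1 s f' u') \in unitmx by rewrite F1u; case: (kP _ Vy).
  have JE : 'J kap u' = 'J (F1 s f') u' *m 'J k (F1 s f' u') := jacobian_comp dF1' dk.
  by rewrite JE unitmx_mul; apply/andP; exact: (conj (coord1_unit lp' Uu') uk).
have dE : differentiable (embedded1 f) (kap u').
  by rewrite kapu; exact: (Ck_differentiable (Ck_embedded1 r0 rX lp 1 s j) Uu).
have dF2 : differentiable (F2 j f) (kap u').
  by rewrite kapu; exact: (Ck_differentiable (sF2 1%N) Uu).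
have nE1 : \near u', (embedded1 f \o kap) u' = embedded1 f' u'.
  by apply: filterS nE => w fw; rewrite /embedded1 /= fw.
have nE2 : \near u', (F2 j f \o kap) u' = F2 j f' u'.
  by apply: filterS nE => w fw; rewrite /coord2 /= fw.
rewrite {2}/energy -(pullback_near _ (differentiable_comp dkap dE) nE1).
rewrite -(pullback_near _ (differentiable_comp dkap dF2) nE2).
rewrite (pullback_comp _ dkap dE) (pullback_comp _ dkap dF2).
have uP : pullback (fun=> 1%:M) (embedded1 f) (kap u') \in unitmx.
  by rewrite kapu (coord1_pullback r0 rX lp Uu); exact: (pullback1_unit lp Uu).
exact: (esym (etrans (mxtrace_congruence _ uK uP) (congr1 (energy j f) kapu))).
Qed.

Lemma energy_well_defined U U' f f' j j' u u' :
  local_param M U f -> local_param M U' f' -> U u -> U' u' ->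
  chart_dom j (f u).2 -> chart_dom j' (f' u').2 -> f u = f' u' ->
  energy j f u = energy j' f' u'.
Proof.
move=> lp lp' Uu Uu' ju ju' ff; have [s su] := sphere_dom_cover r0 (f u).1.
have Du : param_dom U f s j u by [].
have Du' : param_dom U' f' s j u' by split=> //; rewrite /= -ff.
rewrite (energy_transition lp lp' Du Du' ff); exact: (energy_chart lp' Du').
Qed.

Section At_a_point.
Variables (U : set 'rV[R]_p) (f : 'rV[R]_p -> N) (lp : local_param M U f).
Variables (s b : bool) (j j0 : chart_index X) (u0 : 'rV[R]_p) (Q : 'M[R]_(1 + p)) (h : X -> X).
Hypotheses (Uu : param_dom U f s j u0) (QQ : Q *m Q^T = 1%:M).
Hypotheses (xQ : embedded1 f u0 *m Q = stereo_inv r b 0).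
Hypotheses (ih : isometric_map h) (hj : chart_dom j0 (h (f u0).2)).
Hypothesis Hmin : forall u, param_dom U f s j u -> minimal_at (pmetric s j) (pchart s j \o f) u.

Let T1 := sphere_transition r s b Q.
Let O1 := sphere_transition_dom r s b Q.
Let T2 := chart j0 \o h \o chart_inv j.
Let O2 := isometry_dom h j j0.
Let W := (param_dom U f s j `&` F1 s f @^-1` O1) `&` F2 j f @^-1` O2.
Let D := param_dom U f s j.
Let oD : open D := @open_param_dom _ _ _ _ _ rX _ _ _ lp s j.
Let sF1 : smooth_on D (F1 s f) := proj1 (smooth_coord rX lp s j).
Let sF2 : smooth_on D (F2 j f) := proj2 (smooth_coord rX lp s j).
Let oO1 : open O1 := @open_sphere_transition_dom _ _ r s b Q.
Let oO2 : open O2 := @open_isometry_dom _ _ _ _ j j0 rX ih.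
Let WD : W `<=` D. Proof. by move=> w [[]]. Qed.

Let oW : open W.
Proof.
have oD1 : open (param_dom U f s j `&` F1 s f @^-1` O1).
  exact: open_Ck_preimage oD (sF1 0%N) oO1.
by apply: (open_Ck_preimage oD1 _ oO2); apply: Ck_subset (sF2 0%N) => w [].
Qed.

(** The rotated sphere coordinate as a function on the ambient product, as [local_inverse]
    requires. *)
Let Phi (z : N) : 'rV[R]_p := stereo r b (val z.1 *m Q).

Let PhiE w : D w -> Phi (f w) = (T1 \o F1 s f) w.
Proof. by move=> Dw; rewrite /= /T1 /sphere_transition -(embedded1E r0 Dw). Qed.

Let T2E w : D w -> T2 (F2 j f w) = chart j0 (h (f w).2).
Proof. by move=> [_ [_ jw]]; rewrite /T2 /coord2 /= (mfd_chartK mX). Qed.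

Let Wu : W u0.
Proof.
split; first split=> //.
  rewrite /= /O1 /sphere_transition_dom /= -(embedded1E r0 Uu) xQ.
  exact: stereo_inv_dom.
by rewrite /= /O2; case: Uu => _ [_ ju]; exists (f u0).2.
Qed.

Let Phiu : Phi (f u0) = 0.
Proof. by rewrite /Phi -/(embedded1 f u0) xQ (stereo_invK r0). Qed.

Let sT1 : smooth_on W (T1 \o F1 s f).
Proof.
move=> k; apply: (Ck_comp oW (U' := O1)); first by move=> w [[]].
  exact: Ck_subset WD (sF1 k).
exact: smooth_sphere_transition.
Qed.

Let sT2 : smooth_on W (T2 \o F2 j f).
Proof.
move=> k; apply: (Ck_comp oW (U' := O2)); first by move=> w [].
  exact: Ck_subset WD (sF2 k).
exact: isometry_smooth.
Qed.

Let sPhi : smooth_on W (Phi \o f).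
Proof. by move=> k; apply: eq_Ck oW _ (sT1 k) => w /WD Dw; rewrite -(PhiE Dw). Qed.

Let Phi_unit : 'J (Phi \o f) u0 \in unitmx.
Proof.
have [[_ O1u] _] := Wu.
have d1 := Ck_differentiable (sF1 1%N) Uu.
have dT := Ck_differentiable (smooth_sphere_transition r s b Q 1%N) O1u.
have nE : \near u0, (T1 \o F1 s f) u0 = (Phi \o f) u0.
  by apply: (near_open oD Uu) => w Dw; rewrite -(PhiE Dw).
rewrite -(jacobian_near (differentiable_comp d1 dT) nE) (jacobian_comp d1 dT) unitmx_mul.
apply/andP; exact: (conj (coord1_unit lp Uu) (sphere_transition_unit r0 QQ O1u)).
Qed.

Let pullback_T1 w : W w -> pullback g1 (T1 \o F1 s f) w = pullback g1 (F1 s f) w.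
Proof.
move=> [[Dw O1w] _].
have d1 := Ck_differentiable (sF1 1%N) Dw.
have dT := Ck_differentiable (smooth_sphere_transition r s b Q 1%N) O1w.
by rewrite (pullback_comp _ d1 dT) -(sphere_transition_pullback r0 QQ O1w).
Qed.

Let pullback_T2 w : W w -> pullback (metric j0) (T2 \o F2 j f) w = pullback (metric j) (F2 j f) w.
Proof.
move=> [[Dw _] O2w].
have d2 := Ck_differentiable (sF2 1%N) Dw.
have dT := Ck_differentiable (isometry_smooth j j0 ih 1%N) O2w.
by rewrite (pullback_comp _ d2 dT) -(isometry_pullback ih O2w).
Qed.

(** As k inverts Phi o f, in the parameter y the sphere component is y itself and the component in X
    is phi. Minimality survives the isometries Q and h and then the reparametrization k; the
    congruences of the last clause transfer the energy and the slope bound. *)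
Lemma graph_coordinates : exists (V : set 'rV[R]_p) (k : 'rV[R]_p -> 'rV[R]_p)
    (phi : 'rV[R]_p -> 'rV[R]_d),
  [/\ open V /\ V 0, (forall n, Ck n V phi) /\ (forall y, V y -> chart_img j0 (phi y)),
      k 0 = u0 /\ phi 0 = chart j0 (h (f u0).2),
      forall y, V y -> minimal_pair g1 (id : 'rV[R]_p -> _) (metric j0) phi y
    & forall y, V y -> [/\ D (k y), 'J k y \in unitmx,
        'J k y *m pullback g1 (F1 s f) (k y) *m ('J k y)^T = g1 y
      & 'J k y *m pullback (metric j) (F2 j f) (k y) *m ('J k y)^T = pullback (metric j0) phi y]].
Proof.
have WU : W `<=` U by move=> w [[[]]].
have [V [k [[oV sk] [Vy ky] kP _]]] := local_inverse lp oW WU Wu sPhi Phi_unit.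
rewrite Phiu in Vy ky.
pose phi := (T2 \o F2 j f) \o k.
have kW y : V y -> W (k y) by move=> /kP[].
have nid y : V y -> \near y, ((T1 \o F1 s f) \o k) y = id y.
  move=> Vy'; apply: (near_open oV Vy') => z Vz; have [Wz Phz _ _] := kP z Vz.
  by rewrite /= -[RHS]Phz (PhiE (WD Wz)).
have dk y : V y -> differentiable k y by move=> Vy'; exact: (Ck_differentiable (sk 1%N) Vy').
have d1 y : V y -> differentiable (T1 \o F1 s f) (k y).
  by move=> Vy'; exact: (Ck_differentiable (sT1 1%N) (kW y Vy')).
have d2 y : V y -> differentiable (T2 \o F2 j f) (k y).
  by move=> Vy'; exact: (Ck_differentiable (sT2 1%N) (kW y Vy')).
have KK1 y : V y -> 'J k y *m pullback g1 (F1 s f) (k y) *m ('J k y)^T = g1 y.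
  move=> Vy'; rewrite -(pullback_T1 (kW y Vy')) -(pullback_comp _ (dk y Vy') (d1 y Vy')).
  rewrite (pullback_near _ (differentiable_comp (dk y Vy') (d1 y Vy')) (nid y Vy')).
  by rewrite /pullback jacobian_id trmx1 mulmx1 mul1mx.
have KK2 y : V y -> 'J k y *m pullback (metric j) (F2 j f) (k y) *m ('J k y)^T
    = pullback (metric j0) phi y.
  by move=> Vy'; rewrite -(pullback_T2 (kW y Vy')) -(pullback_comp _ (dk y Vy') (d2 y Vy')).
exists V, k, phi; split.
- exact: conj oV Vy.
- split; first by move=> n; exact: (Ck_comp oV kW (sk n) (sT2 n)).
  move=> y /kW[[Dw _] [x [jx j0x] ex]]; rewrite /phi /= -ex /T2 /= (mfd_chartK mX) //.
  by exists (h x).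
- by split=> //; rewrite /phi /= ky; exact: (T2E Uu).
- move=> y Vy'; have Wy := kW y Vy'; have Dy := WD Wy.
  have H0 := param_minimal_pair r0 rX lp Dy (Hmin Dy).
  have O1y : O1 (F1 s f (k y)) by case: Wy => -[].
  have O2y : O2 (F2 j f (k y)) by case: Wy.
  have ji : chart_img j (F2 j f (k y)) by case: Dy => _ [_ jy]; exists (f (k y)).2.
  have j0i : chart_img j0 (T2 (F2 j f (k y))).
    by case: O2y => x [jx j0x] <-; rewrite /T2 /= (mfd_chartK mX) //; exists (h x).
  have dg1 z : differentiable g1 z.
    exact: (Ck_differentiable (Ck_sphere_metric r 1 openT) (I : setT z)).
  have dg (i : chart_index X) z : chart_img i z -> differentiable (metric i) z.
    exact: (Ck_differentiable (Ck_metric i 1 rX)).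
  have H1 : minimal_pair g1 (T1 \o F1 s f) (metric j0) (T2 \o F2 j f) (k y).
    have W1 w : W w -> O1 (F1 s f w) by case=> -[].
    have W2 w : W w -> O2 (F2 j f w) by case.
    have C1 := Ck_subset WD (sF1 2).
    have C2 := Ck_subset WD (sF2 2).
    have uT1 := sphere_transition_unit r0 QQ O1y.
    have uT2 := isometry_unit rX ih O2y.
    have sym1 := sphere_metric_sym r (T1 (F1 s f (k y))).
    have sym2 := riem_sym rX j0i.
    exact: (minimal_pair_postcomp oW Wy W1 W2 C1 C2 oO1 oO2
      (@smooth_sphere_transition _ _ r s b Q 2) (@isometry_smooth _ _ _ h j j0 ih 2)
      (fun z Oz => sphere_transition_pullback r0 QQ Oz) (fun z Oz => isometry_pullback ih Oz)
      (dg1 _) (dg _ _ ji) (dg1 _) (dg _ _ j0i) sym1 sym2 uT1 uT2 H0).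
  have H2 : minimal_pair g1 ((T1 \o F1 s f) \o k) (metric j0) phi y.
    have uk : 'J k y \in unitmx by case: (kP y Vy').
    have uP : pullback g1 (T1 \o F1 s f) (k y) + pullback (metric j0) (T2 \o F2 j f) (k y) \in unitmx.
      rewrite (pullback_T1 Wy) (pullback_T2 Wy); apply: posdef_unitmx => v v0.
      rewrite inner_mxD ltr_wpDr ?(pullback2_ge0 rX _ Dy) // pullback_inner.
      apply: (sphere_metric_pos r0); apply: contra_neq v0 => vJ.
      by rewrite -(mulmxK (coord1_unit lp Dy) v) vJ mul0mx.
    exact: (minimal_pair_precomp oV Vy' kW (sk 2) oW (sT1 2) (sT2 2)
      (dg1 _) (dg _ _ j0i) uk uP H1).
  exact: (minimal_pair_near (differentiable_comp (dk y Vy') (d1 y Vy')) (nid y Vy') H2).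
- move=> y Vy'; split; [exact: WD (kW y Vy')|by have [] := kP y Vy'|exact: KK1|exact: KK2].
Qed.

End At_a_point.

End Energy.

(** * Vanishing of the energy at a maximum *)

Section Energy_at_maximum.
Context {R : realType} {p d : nat}.
Variables (r : R) (r0 : 0 < r) (X : riemannian R d) (rX : is_riemannian X).
Local Notation S := (sphere p r).
Local Notation N := (prod_riemannian S X).
Local Notation pchart s j := (@chart R (p + d) N (s, j)).
Local Notation pmetric s j := (@metric R (p + d) N (s, j)).
Local Notation g1 := (@normal_sphere_metric R p r).
Local Notation F1 := (@coord1 R p d r X).
Local Notation F2 := (@coord2 R p d r X).
Opaque derive jacobian.

(* Diagonalising P1, the trace is the sum of the values of P2 on a basis. *)
Lemma mxtrace_frame n (P1 P2 : 'M[R]_n) : P1^T = P1 ->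
  (forall v, v != 0 -> 0 < inner P1 v v) ->
  exists2 E : 'M[R]_n, E \in unitmx
    & \tr (P2 *m invmx P1) = \sum_k inner P2 (row k E) (row k E).
Proof.
move=> Ps Pp; have [E EE] := posdef_frame Ps Pp.
have uE : E \in unitmx by have [] := mulmx1_unit EE; rewrite unitmx_mul => /andP[].
exists E => //; have uP := posdef_unitmx Pp.
rewrite -(mxtrace_congruence P2 uE uP) EE invmx1 mulmx1; apply: eq_bigr => k _.
by rewrite inner_mxE.
Qed.

Variables (M : set N) (c : R).
Hypothesis small : forall U f, local_param M U f -> forall s j u,
  param_dom U f s j u -> small_slope f c s j u.

Section Nonnegative.
Variables (U : set 'rV[R]_p) (f : 'rV[R]_p -> N) (lp : local_param M U f).
Variables (s : bool) (j : chart_index X) (u : 'rV[R]_p).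
Hypothesis Uu : param_dom U f s j u.

Let frame : exists2 E : 'M[R]_p, E \in unitmx & energy j f u
  = \sum_k inner (metric j (F2 j f u)) (row k E *m 'J (F2 j f) u) (row k E *m 'J (F2 j f) u).
Proof.
have sP : (pullback g1 (F1 s f) u)^T = pullback g1 (F1 s f) u.
  by rewrite /pullback !trmx_mul trmxK sphere_metric_sym mulmxA.
have pP v : v != 0 -> 0 < inner (pullback g1 (F1 s f) u) v v.
  move=> v0; rewrite pullback_inner; apply: (sphere_metric_pos r0).
  apply: contra_neq v0 => vJ.
  by rewrite -(mulmxK (coord1_unit rX small lp Uu) v) vJ mul0mx.
have [E uE tE] := mxtrace_frame (pullback (metric j) (F2 j f) u) sP pP.
exists E => //; rewrite /energy (coord1_pullback r0 rX lp Uu) tE.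
by apply: eq_bigr => k _; rewrite pullback_inner.
Qed.

Let inner_ge0 v : 0 <= inner (metric j (F2 j f u)) v v.
Proof.
have [->|v0] := eqVneq v 0; first by rewrite inner0l.
by case: Uu => _ [_ ju]; rewrite ltW // (riem_pos rX) //; exists (f u).2.
Qed.

Lemma energy_ge0 : 0 <= energy j f u.
Proof. by have [E _ ->] := frame; apply: sumr_ge0 => k _; exact: inner_ge0. Qed.

(** A sum of nonnegative terms over a frame is zero, so the differential vanishes on a basis. *)
Lemma energy_eq0 : energy j f u = 0 -> 'J (F2 j f) u = 0.
Proof.
have [E uE ->] := frame => /eqP; rewrite psumr_eq0 => [/allP z0|k _]; last exact: inner_ge0.
suff EJ : E *m 'J (F2 j f) u = 0 by rewrite -(mulKmx uE ('J (F2 j f) u)) EJ mulmx0.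
apply/row_matrixP => k; rewrite row_mul row0; apply/eqP.
have := z0 k (mem_index_enum k); apply: contraTT => v0; rewrite gt_eqF //.
by case: Uu => _ [_ ju]; apply: (riem_pos rX) => //; exists (f u).2.
Qed.

End Nonnegative.

Lemma graph_energyE (g : 'rV[R]_d -> 'M[R]_d) (V : set 'rV[R]_p) phi y :
  Ck 1 V phi -> V y -> \tr (pullback g phi y *m invmx (g1 y)) = graph_energy r g phi y.
Proof.
move=> Cphi Vy.
have cf0 : conformal_factor r y != 0 by rewrite gt_eqF // conformal_factor_gt0.
have -> : invmx (g1 y) = (conformal_inv r y)%:M.
  rewrite /normal_sphere_metric invmx_scalar; congr (_%:M).
  by apply: (mulIf cf0); rewrite mulVf // conformal_factorK.
rewrite mul_mx_scalar mxtraceZ /graph_energy; congr (_ * _); apply: eq_bigr => k _.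
by have dphi := Ck_differentiable Cphi Vy; rewrite inner_mxE !(jacobian_row _ dphi).
Qed.

Variables (o : X) (j0 : chart_index X) (oj : chart_dom j0 o) (eps c0 : R).
Hypothesis transitive : forall x, exists2 h : X -> X, isometric_map h & h x = o.
Hypotheses (eps0 : 0 < eps) (c00 : 0 < c0).
Hypothesis c0P : forall v, c0 * `|v| ^+ 2 <= inner (metric j0 (chart j0 o)) v v.
Hypothesis c_small : c * (4 * r ^+ 2) <= c0 * eps ^+ 2.
Hypothesis rigidity : forall (V : set 'rV[R]_p) (phi : 'rV[R]_p -> 'rV[R]_d),
    open V -> Ck 3 V phi -> (forall y, V y -> chart_img j0 (phi y)) -> V 0 ->
    phi 0 = chart j0 o ->
    (forall y, V y -> minimal_pair g1 (id : 'rV[R]_p -> _) (metric j0) phi y) ->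
    (forall k, `|'D_(delta_mx 0 k) phi 0| <= eps) ->
    (\forall y \near (0 : 'rV[R]_p),
       graph_energy r (metric j0) phi y <= graph_energy r (metric j0) phi 0) ->
    forall k, 'D_(delta_mx 0 k) phi 0 = 0.
Hypothesis Hmin : minimal_submanifold p M.

(** In the coordinates of [graph_coordinates] the point lies at the centre over the base point o,
    where [rigidity] applies; its smallness hypothesis comes from the slope bound. *)
Lemma max_energy_eq0 U f s j u : local_param M U f -> param_dom U f s j u ->
  (forall w, param_dom U f s j w -> energy j f w <= energy j f u) -> energy j f u = 0.
Proof.
move=> lp Uu umax; have [h ih hx] := transitive (f u).2.
have [Q [b [QQ xQ]]] := rotation_to_pole r0 (sphere_valE (f u).1).
have hj : chart_dom j0 (h (f u).2) by rewrite hx.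
have Hm w : param_dom U f s j w -> minimal_at (pmetric s j) (pchart s j \o f) w.
  by move=> [Uw dw]; exact: (Hmin lp Uw dw).
have [V [k [phi [[oV V0] [Cphi Vimg] [k0 phi0] Vmin Vk]]]] :=
  graph_coordinates r0 rX small lp Uu QQ xQ ih hj Hm.
have GE y : V y -> energy j f (k y) = graph_energy r (metric j0) phi y.
  move=> Vy; have [Dy uK K1 K2] := Vk y Vy.
  rewrite -(graph_energyE _ (Cphi 1%N) Vy) -K1 -K2.
  rewrite (mxtrace_congruence _ uK (pullback1_unit r0 rX small lp Dy)).
  by rewrite /energy (coord1_pullback r0 rX lp Dy).
have dphi := Ck_differentiable (Cphi 1%N) V0.
have small0 i : `|'D_(delta_mx 0 i) phi 0| <= eps.
  have [Dy uK K1 K2] := Vk 0 V0.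
  pose e : 'rV[R]_p := delta_mx 0 i.
  have JE : e *m 'J phi 0 = 'D_e phi 0 by rewrite -rowE; exact: (jacobian_row i dphi).
  have E2 : inner (pullback (metric j) (F2 j f) (k 0)) (e *m 'J k 0) (e *m 'J k 0)
      = inner (metric j0 (chart j0 o)) ('D_e phi 0) ('D_e phi 0).
    by rewrite -inner_mulmx K2 pullback_inner JE phi0 hx.
  have E1 : inner (pullback g1 (F1 s f) (k 0)) (e *m 'J k 0) (e *m 'J k 0) = g1 0 i i.
    by rewrite -inner_mulmx K1 inner_delta.
  have := small lp Dy (e *m 'J k 0); rewrite E1 E2 => sm.
  (* At the centre the round metric is 4 r^2 times the Euclidean one, which explains the factor in
     [c_small]. *)
  have : c0 * `|'D_(delta_mx 0 i) phi 0| ^+ 2 <= c0 * eps ^+ 2.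
    apply: le_trans (c0P _) _; apply: le_trans sm _; apply: le_trans c_small.
    rewrite /normal_sphere_metric mxE eqxx mulr1n /conformal_factor norm2_0 addr0 expr1n invr1 mulr1.
    exact: lexx.
  by rewrite ler_pM2l // ler_sqr ?nnegrE // ltW.
have D0 := rigidity oV (Cphi 3) Vimg V0 (etrans phi0 (congr1 _ hx)) Vmin small0.
rewrite -{1}k0 (GE 0 V0) /graph_energy big1 ?mulr0 // => i _.
rewrite D0 ?inner0l //; apply: (near_open oV V0) => y Vy.
by rewrite -(GE y Vy) -(GE 0 V0) k0; apply: umax; have [] := Vk y Vy.
Qed.

Lemma Ck_energy U f s j : local_param M U f -> Ck 0 (param_dom U f s j) (energy j f).
Proof.
move=> lp; have oD := @open_param_dom _ _ _ _ _ rX _ _ _ lp s j.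
have [sF1 sF2] := smooth_coord rX lp s j.
have CE := Ck_embedded1 r0 rX lp 1 s j.
have CP1 : Ck 0 (param_dom U f s j) (fun w => pullback (fun=> 1%:M) (embedded1 f) w).
  have CJ := Ck_jacobian oD CE.
  apply: (Ck_mulmx oD); last exact: (Ck_trmx oD).
  by apply: (Ck_mulmx oD) => //; exact: Ck_cst.
have CP2 : Ck 0 (param_dom U f s j) (fun w => pullback (metric j) (F2 j f) w).
  have CJ := Ck_jacobian oD (sF2 1%N).
  apply: (Ck_mulmx oD); last exact: (Ck_trmx oD).
  apply: (Ck_mulmx oD) => //.
  apply: (Ck_comp oD _ (sF2 0%N) (Ck_metric j 0 rX)) => w [_ [_ jw]].
  by exists (f w).2.
have CI : Ck 0 (param_dom U f s j) (fun w => invmx (pullback (fun=> 1%:M) (embedded1 f) w)).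
  apply: (Ck_invmx oD) => // w Dw; rewrite (coord1_pullback r0 rX lp Dw).
  exact: (pullback1_unit r0 rX small lp Dw).
apply: (Ck_sum _ oD) => i _; apply: (Ck_entry _ _ oD); exact: (Ck_mulmx oD).
Qed.

End Energy_at_maximum.

(** * Connectedness arguments *)

Section Locally_constant.

(** [level P] is an open set of T that cuts out on A the points with value in P. Applied to a value
    and to its complement, it shows the level sets to be relatively open and closed. *)
Lemma connected_locally_constant (T : topologicalType) (Y : Type) (A : set T) (f : T -> Y) :
  connected A ->
  (forall x, A x -> exists B, [/\ open B, B x & forall y, A y -> B y -> f y = f x]) ->
  forall x y, A x -> A y -> f y = f x.
Proof.
move=> cA loc x y Ax Ay.
pose level (P : set Y) := \bigcup_(B in [set B | open B /\ forall z, A z -> B z -> P (f z)]) B.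
have olevel P : open (level P) by apply: bigcup_open => B [].
have levelE P : A `&` level P = A `&` f @^-1` P.
  apply/seteqP; split=> [z [Az [B [_ BP] Bz]]|z [Az Pz]]; split=> //; first exact: BP.
  have [B [oB Bz Bf]] := loc z Az; exists B => //; split=> // w Aw Bw.
  by rewrite (Bf w Aw Bw).
have : A `&` level [set f x] = A.
  apply: cA; first by exists x; rewrite levelE; split.
    by exists (level [set f x]).
  exists (~` level (~` [set f x])); first exact: open_closedC.
  rewrite levelE; apply/seteqP; split=> z [Az Pz]; split=> //.
    move=> Lz; have : (A `&` level (~` [set f x])) z by [].
    by rewrite levelE => -[].
  apply: contrapT => nz; apply: Pz; have : (A `&` f @^-1` (~` [set f x])) z by [].
  by rewrite -levelE => -[].
by rewrite levelE => /seteqP[_ /(_ _ Ay)[]].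
Qed.

(** A union of lines through the origin. *)
Lemma connected_rV (R : realType) n : connected [set: 'rV[R]_n].
Proof.
have -> : [set: 'rV[R]_n] = \bigcup_(v in setT) ((fun t : R => t *: v) @` setT).
  by apply/seteqP; split=> // v _; exists v => //; exists 1 => //; rewrite scale1r.
apply: bigcup_connected => [|v _]; first by exists 0 => v _; exists 0 => //; rewrite scale0r.
apply: connected_continuous_connected; first exact/connected_intervalP.
by apply: continuous_subspaceT => t; exact: scalel_continuous.
Qed.

Lemma locally_constant_of_jacobian (R : realType) m n (U : set 'rV[R]_m)
    (f : 'rV[R]_m -> 'rV[R]_n) u :
  open U -> U u -> Ck 1 U f -> (forall w, U w -> 'J f w = 0) ->
  exists2 e : R, 0 < e & forall w, ball u e w -> U w /\ f w = f u.
Proof.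
move=> oU Uu Cf Jf.
have /nbhs_ballP[e /= e0 eU] : nbhs u U by exact: open_nbhs_nbhs.
exists e => // w uw; split; first exact: eU.
apply/rowP => i; apply/eqP; rewrite -subr_eq0; apply/eqP.
have inU s : 0 <= s <= 1 -> U (u + s *: (w - u)).
  move=> /andP[s0 s1]; apply: eU; rewrite -ball_normE /ball_ /= opprD addNKr normrN normrZ.
  rewrite (ger0_norm s0); apply: le_lt_trans (_ : `|w - u| < e).
    by rewrite ler_piMl.
  by rewrite distrC; move: uw; rewrite -ball_normE.
have dfi s : 0 <= s <= 1 -> differentiable (fun w => f w 0 i) (u + s *: (w - u)).
  move=> s01; apply: differentiable_entry; exact: (Ck_differentiable Cf (inU s s01)).
have [s /andP[s0 s1]] := mvt_line ltr01 dfi.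
rewrite scale1r (addrC u) subrK mul1r => ->.
have Us : U (u + s *: (w - u)) by apply: inU; rewrite !ltW.
have df := Ck_differentiable Cf Us.
rewrite (derive_entry 0 i _ df) (derivemxE _ df).
by rewrite (Jf _ Us) mulmx0 mxE.
Qed.

End Locally_constant.

Section Sphere_topology.
Context {R : realType} {p : nat}.
Variables (r : R) (r0 : 0 < r).
Local Notation S := (sphere p r).

Lemma sphere_continuous (T : topologicalType) (f : T -> S) :
  continuous (fun t => val (f t) : 'rV[R]_(1 + p)) -> continuous f.
Proof. by move=> cf; apply: continuous_comp_initial. Qed.

(** The sphere is covered by two images of R^p, which for p > 0 share the equatorial points, those
    with |y| = 1. *)
Lemma connected_sphere : (0 < p)%N -> connected [set: S].
Proof.
move=> p0.
have inv_cont s : continuous (@chart_inv R p S s).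
  apply: sphere_continuous => y.
  exact: (Ck_continuous (Ck_stereo_inv r 0 s) (I : setT y)).
have conn s : connected (@chart_inv R p S s @` setT).
  apply: connected_continuous_connected; first exact: connected_rV.
  exact: continuous_subspaceT.
have onto s (x : S) : @chart_dom R p S s x -> (@chart_inv R p S s @` setT) x.
  move=> sx; exists (@chart R p S s x) => //; apply: val_inj.
  by apply: (stereoK r0) => //; exact: sphere_valE.
have -> : [set: S] = (@chart_inv R p S false @` setT) `|` (@chart_inv R p S true @` setT).
  apply/seteqP; split=> // x _; have [[] sx] := sphere_dom_cover r0 x.
    by right; exact: onto.
  by left; exact: onto.
apply: connectedU; [|exact: conn|exact: conn].
pose y : 'rV[R]_p := delta_mx 0 (Ordinal p0).
exists (@chart_inv R p S false y); split; first by exists y.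
have y1 : norm2 y = 1 by rewrite -[norm2 y]/(dot y y) dot_delta mxE !eqxx.
have E0 : stereo_inv r false y 0 0 = 0.
  have := stereo_inv00 r false y; rewrite expr0 mul1r y1 => ->.
  by rewrite (_ : 1 - 2 * (1 + 1)^-1 = 0 :> R) ?mulr0 //; field.
by apply: onto; rewrite /= E0 mulr0 lt_eqF.
Qed.

End Sphere_topology.

(** * From vanishing energy to a slice *)

Section Rigidity.
Context {R : realType} {p d : nat}.
Variables (r : R) (r0 : 0 < r) (p0 : (0 < p)%N) (X : riemannian R d) (rX : is_riemannian X).
Local Notation S := (sphere p r).
Local Notation N := (prod_riemannian S X).
Local Notation F1 := (@coord1 R p d r X).
Local Notation F2 := (@coord2 R p d r X).
Opaque derive jacobian.

Let mX := riem_manifold rX.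

Variables (M : set N) (c : R).
Hypothesis clM : closed_connected_submanifold p M.
Hypothesis small : forall U f, local_param M U f -> forall s j u,
  param_dom U f s j u -> small_slope f c s j u.

(** All values that parametrizations and charts give at z. At a point of M there is exactly one, so
    choosing an element defines a function on M; [global_energy] takes the default value 0
    elsewhere. *)
Let energy_values (z : N) : set R :=
  [set t | exists U f u j, [/\ local_param M U f, U u, chart_dom j (f u).2, f u = z
    & t = energy j f u]].

Definition global_energy (z : N) : R := xget 0 (energy_values z).

Lemma global_energyE U f u j : local_param M U f -> U u -> chart_dom j (f u).2 ->
  global_energy (f u) = energy j f u.
Proof.
move=> lp Uu ju.
have ex : exists t, energy_values (f u) t by exists (energy j f u), U, f, u, j.
have [U' [f' [u' [j' [lp' Uu' ju' ff]]]]] := xgetPex 0 ex.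
rewrite -/(global_energy (f u)) => ->.
exact: (energy_well_defined r0 rX small lp' lp).
Qed.

Lemma param_at z : M z -> exists U f u s j,
  [/\ local_param M U f, param_dom U f s j u & f u = z].
Proof.
move=> Mz; have [eM _ _ _] := clM; have [U [f [u [lp Uu fu]]]] := eM z Mz.
have [j ju] := mfd_cover mX (f u).2; have [s su] := sphere_dom_cover r0 (f u).1.
by exists U, f, u, s, j; split.
Qed.

Lemma param_neighborhood U f (O : set 'rV[R]_p) u :
  local_param M U f -> open O -> O `<=` U -> O u ->
  exists B : set N, [/\ open B, B (f u) & forall z, M z -> B z -> exists2 w, O w & f w = z].
Proof.
move=> lp oO OU Ou; have [B oB BE] := lp_homeo lp oO OU; exists B; split=> //.
  have fO : (f @` O) (f u) by exists u.
  by move: fO; rewrite BE => -[].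
by move=> z Mz Bz; have : (M `&` B) z by []; rewrite -BE => -[w Ow <-]; exists w.
Qed.

Lemma global_energy_continuous : {within M, continuous global_energy}.
Proof.
apply/subspace_continuousP => z Mz.
have [U [f [u [s [j [lp Du <-]]]]]] := param_at Mz.
have [Uu [_ ju]] := Du.
have oD := @open_param_dom _ _ _ _ _ rX _ _ _ lp s j.
move=> A nA.
have nu : nbhs u [set w | A (energy j f w)].
  have nA' : nbhs (energy j f u) A by rewrite -(global_energyE lp Uu ju).
  have cE : {for u, continuous (energy j f)} by exact: (Ck_continuous (Ck_energy r0 rX small lp) Du).
  exact: cE nA'.
pose O := param_dom U f s j `&` [set w | A (energy j f w)]°.
have oO : open O by apply: openI => //; exact: open_interior.
have OU : O `<=` U by move=> w [[]].
have [B [oB Bu BP]] := param_neighborhood lp oO OU (conj Du nu).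
have nB : nbhs (f u) B by exact: open_nbhs_nbhs.
apply: filterS nB => z' Bz' Mz'; have [w [[Uw [_ jw]] Aw] <-] := BP z' Mz' Bz'.
have Aw' : A (energy j f w) by exact: (interior_subset Aw).
by move: Aw'; rewrite -(global_energyE lp Uw jw).
Qed.

Lemma energy_eq0_everywhere :
  (forall U f s j u, local_param M U f -> param_dom U f s j u ->
    (forall w, param_dom U f s j w -> energy j f w <= energy j f u) -> energy j f u = 0) ->
  forall U f s j u, local_param M U f -> param_dom U f s j u -> energy j f u = 0.
Proof.
move=> max0; have [_ M0 cM _] := clM.
have [z0] := compact_EVT_max M0 cM global_energy_continuous.
rewrite inE => Mz0 zmax; have [U0 [f0 [u0 [s0 [j0 [lp0 Du0 fz]]]]]] := param_at Mz0.
have inM U f u : local_param M U f -> U u -> M (f u).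
  by move=> lp Uu; apply: (lp_sub lp); exists u.
have z00 : global_energy z0 = 0.
  have [Uu0 [_ ju0]] := Du0; rewrite -fz (global_energyE lp0 Uu0 ju0).
  apply: (max0 _ _ _ _ _ lp0 Du0) => w [Uw [_ jw]].
  rewrite -(global_energyE lp0 Uw jw) -(global_energyE lp0 Uu0 ju0) fz.
  by apply: zmax; rewrite inE; exact: inM lp0 Uw.
move=> U f s j u lp Du; have [Uu [_ ju]] := Du.
apply/eqP; rewrite eq_le (energy_ge0 r0 rX small lp Du) andbT.
rewrite -(global_energyE lp Uu ju) -z00; apply: zmax; rewrite inE; exact: inM lp Uu.
Qed.

Hypothesis energy0 : forall U f s j u, local_param M U f -> param_dom U f s j u ->
  energy j f u = 0.

Lemma second_factor_locally_constant z : M z ->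
  exists B, [/\ open B, B z & forall z', M z' -> B z' -> z'.2 = z.2].
Proof.
move=> Mz; have [U [f [u [s [j [lp Du <-]]]]]] := param_at Mz.
have oD := @open_param_dom _ _ _ _ _ rX _ _ _ lp s j.
have [_ sF2] := smooth_coord rX lp s j.
have J0 w : param_dom U f s j w -> 'J (F2 j f) w = 0.
  by move=> Dw; exact: (energy_eq0 r0 rX small lp Dw (energy0 lp Dw)).
have [e e0 eP] := locally_constant_of_jacobian oD Du (sF2 1%N) J0.
have OU : ball u e `<=` U by move=> w /eP[[]].
have [B [oB Bu BP]] := param_neighborhood lp (ball_open u e) OU (ballxx u e0).
exists B; split=> // z' Mz' Bz'; have [w /eP[[_ [_ jw]] Fw] <-] := BP z' Mz' Bz'.
have [_ [_ ju]] := Du.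
by rewrite -(mfd_chartK mX jw) -(mfd_chartK mX ju); congr (chart_inv j _).
Qed.

(** M is locally a graph over the sphere: f o k provides a point of M above each point near z.1. *)
Lemma first_projection_open z : M z ->
  exists B : set S, [/\ open B, B z.1 & B `<=` fst @` M].
Proof.
move=> Mz; have [U [f [u [s [j [lp Du <-]]]]]] := param_at Mz.
have oD := @open_param_dom _ _ _ _ _ rX _ _ _ lp s j.
have [sF1 _] := smooth_coord rX lp s j.
pose Phi (z : N) := stereo r s (val z.1).
have [V [k [[oV _] [Vu _] kP _]]] :=
  local_inverse lp oD (@subIsetl _ _ _) Du (sF1 : smooth_on _ (Phi \o f)) (coord1_unit rX small lp Du).
have [_ [su _]] := Du.
pose O := [set x : 'rV[R]_(1 + p) | (-1) ^+ s * x 0 0 != r] `&` stereo r s @^-1` V.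
have oO : open O.
  have oE : open [set x : 'rV[R]_(1 + p) | (-1) ^+ s * x 0 0 != r] by exact: open_entry_neq.
  have CE : Ck 0 [set x : 'rV[R]_(1 + p) | (-1) ^+ s * x 0 0 != r] (stereo r s).
    by apply: Ck_stereo.
  exact: (open_Ck_preimage oE CE oV).
exists ((fun x : S => val x : 'rV[R]_(1 + p)) @^-1` O); split.
- by apply: open_comp => // x _; exact: sphere_val_continuous.
- by split.
move=> x [sx Vx]; have [Dk Phk _ _] := kP _ Vx; exists (f (k (stereo r s (val x)))).
  by apply: (lp_sub lp); exists (k (stereo r s (val x))) => //; case: Dk.
have [_ [sk _]] := Dk; apply: val_inj.
apply: etrans (esym (stereoK r0 (sphere_valE _) sk)) _.
apply: etrans _ (stereoK r0 (sphere_valE x) sx); exact: (congr1 (stereo_inv r s) Phk).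
Qed.

(** The image is open by the previous lemma, closed because it is compact in R^(1+p), and nonempty,
    while the sphere is connected. *)
Lemma first_projection_surjective : fst @` M = [set: S].
Proof.
have [_ [z0 Mz0] cM _] := clM.
apply: (connected_sphere r0 p0); first by exists z0.1, z0.
  exists (\bigcup_(B in [set B : set S | open B /\ B `<=` fst @` M]) B).
    by apply: bigcup_open => B [].
  rewrite setTI; apply/seteqP; split=> [_ [z Mz <-]|x [B [_ BM] Bx]]; last exact: BM.
  by have [B [oB Bz BM]] := first_projection_open Mz; exists B.
exists (fst @` M); last by rewrite setTI.
pose v (z : N) : 'rV[R]_(1 + p) := val z.1.
have -> : fst @` M = (fun x : S => val x : 'rV[R]_(1 + p)) @^-1` (v @` M).
  apply/seteqP; split=> [_ [z Mz <-]|x [z Mz zx]]; first by exists z.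
  by exists z => //; apply: val_inj.
apply: closed_comp => [x _|]; first exact: sphere_val_continuous.
apply: compact_closed; first exact: norm_hausdorff.
apply: continuous_compact => //; apply: continuous_subspaceT => z.
apply: (@continuous_comp _ _ _ fst); first exact: cvg_fst.
exact: sphere_val_continuous.
Qed.

Lemma submanifold_is_slice : exists x : X, M = [set: S] `*` [set x].
Proof.
have [_ [z0 Mz0] _ conM] := clM; exists z0.2.
have const := connected_locally_constant conM second_factor_locally_constant.
apply/seteqP; split=> [z Mz|[y x] [_ /= ->]].
  by split=> //; exact: (const _ _ Mz0 Mz).
have : (fst @` M) y by rewrite first_projection_surjective.
move=> [z Mz <-]; rewrite -(const _ _ Mz0 Mz); by case: z Mz.
Qed.

End Rigidity.

Theorem theorem3p1 (R : realType) (p d : nat) (hp : (2 <= p)%N) (hd : (0 < d)%N)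
    (X2 : riemannian R d) (hX2 : symmetric_space_of_compact_type X2)
    (rho : R) (hrho : smallest_ricci (prod_riemannian (killing_sphere R p) X2) rho) :
  let N := prod_riemannian (killing_sphere R p) X2 in
  let q : R := 2 - 1 / d%:R in
  exists2 Lambda : R, 0 < Lambda &
    forall M : set N,
      closed_connected_submanifold p M ->
      minimal_submanifold p M ->
      at_all_points M (fun i (f : 'rV[R]_p -> N) u =>
        norm_pi2 i f u < Lambda /\
        sff_norm2_lt (metric i) (chart i \o f) u (rho / q)) ->
      exists x : X2, M = [set: killing_sphere R p] `*` [set x].
Proof.
move=> N q; pose r : R := Num.sqrt (2 * (p%:R - 1)).
have r0 : 0 < r by rewrite sqrtr_gt0 mulr_gt0 // subr_gt0 ltr1n.
case: (hX2) => k [] G [] mul [] inv [] one [] sigma [] act [] o sym.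
have rX := sym_riemannian sym; have mX := riem_manifold rX.
have [j0 oj] := mfd_cover mX o.
(* The group acts transitively by isometries, so one base point o and one chart j0 serve for all
   points of X2. *)
have transitive x : exists2 h : X2 -> X2, isometric_map h & h x = o.
  have [a ax] := sym_transitive sym x o; exists (act a) => //; exact: (sym_invariant sym a).
have oO : open (chart_img j0) := @mfd_open_img _ _ _ mX j0.
have Ow0 : chart_img j0 (chart j0 o) by exists o.
have gs y : chart_img j0 y -> (metric j0 y)^T = metric j0 y := @riem_sym _ _ _ rX j0 y.
have gp y : chart_img j0 y -> forall v, v != 0 -> 0 < inner (metric j0 y) v v
  := @riem_pos _ _ _ rX j0 y.
have [eps eps0 rigidity] := bochner r0 hp oO Ow0 (Ck_metric j0 2 rX) gs gp.
have [c0 c00 c0P] := posdef_bound (gs _ Ow0) (gp _ Ow0).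
(* The threshold for L^2 below which the slope bound 2 L^2 satisfies [c_small], and the graph is in
   the range of [bochner]. *)
pose b : R := c0 * eps ^+ 2 / (8 * r ^+ 2).
have b0 : 0 < b by rewrite divr_gt0 // mulr_gt0 // exprn_gt0.
(* L <= 1/2 gives L^2 <= L, so L^2 is at most both 1/2, as [norm_pi2_small] requires, and b. *)
pose L : R := Num.min 2^-1 b.
have L0 : 0 < L by rewrite lt_min b0 invr_gt0 ltr0n.
have [L2 Lb] : L <= 2^-1 /\ L <= b by rewrite !ge_min !lexx orbT.
have LL : L ^+ 2 <= L by rewrite expr2 ler_piMl ?ltW //; lra.
exists L => // M clM Hmin Hsmall.
have small U f : local_param M U f -> forall s j u,
    param_dom U f s j u -> small_slope f (2 * L ^+ 2) s j u.
  move=> lp s j u Du; have [Uu fu] := Du.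
  have [nL _] := Hsmall U f lp (s, j) u Uu fu.
  exact: (norm_pi2_small r0 rX lp L0 (le_trans LL L2) Du nL).
have c_small : 2 * L ^+ 2 * (4 * r ^+ 2) <= c0 * eps ^+ 2.
  have -> : c0 * eps ^+ 2 = b * (8 * r ^+ 2).
    by rewrite /b divfK // mulf_neq0 // ?pnatr_eq0 // expf_neq0 // gt_eqF.
  rewrite (_ : _ * _ = L ^+ 2 * (8 * r ^+ 2)); last by ring.
  by apply: ler_wpM2r (le_trans LL Lb); rewrite mulr_ge0 // sqr_ge0.
apply: (submanifold_is_slice r0 (ltnW hp) rX clM small).
apply: (energy_eq0_everywhere r0 rX clM small) => U f s j u lp Du umax.
exact: (max_energy_eq0 r0 rX small oj transitive eps0 c00 c0P c_small rigidity Hmin lp Du umax).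
Qed.
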